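(* Let $X$ be a connected simplicial abelian group. 1. The triple $(\mathcal R(X),\vee_X,\wedge_\mu)$, where $\vee_X$ is the operation of union along the common subspace $X$ and $\wedge_\mu$ is the internal smash product, is a symmetric bimonoidal category. 2. The pairing $\wedge_\mu$ restricts to $\mathcal R_f(X)$, where it is biexact, i.e. exact in each variable separately: for each $Y\in\mathcal R_f(X)$ the functors $-\wedge_\mu Y$ and $Y\wedge_\mu-$ preserve cofibrations, pushouts along cofibrations, and weak equivalences.
   Context: For a simplicial set $X$, $\mathcal R(X)$ is the category of retractive simplicial sets $(Y,r\colon Y\to X,s\colon X\to Y)$ with $rs=\mathrm{id}_X$; morphisms respect all data. $\mathcal R_f(X)$ is the full subcategory of those with only finitely many nondegenerate simplices in $Y-X$. A cofibration is a morphism that is injective; a weak equivalence is a morphism whose geometric realization is a homotopy equivalence. For $(Y_i,r_i,s_i)\in\mathcal R(X_i)$, $i=1,2$, the exterior smash product $Y_1\wedge_eY_2\in\mathcal R(X_1\times X_2)$ is the pushout of $$X_1\times X_2\xleftarrow{\ r_1\times r_2\ }Y_1\times X_2\cup_{X_1\times X_2}X_1\times Y_2\rightarrowtail Y_1\times Y_2,$$ with evident section and retraction. For $\mu\colon X\times X\to X$ the multiplication, $Y_1\wedge_\mu Y_2=\mu_*(Y_1\wedge_eY_2)$, where $\mu_*\colon\mathcal R(X\times X)\to\mathcal R(X)$ is pushout along $\mu$. ''Symmetric bimonoidal category'' is meant in the sense of Laplaza: two symmetric monoidal structures (sum, with neutral object $(X,\mathrm{id},\mathrm{id})$; product, with neutral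 object $X\vee S^0$, where the base point of $S^0$ is identified with the identity element of $X$ and the retraction collapses $S^0$ to it), with natural annihilation isomorphisms $X\wedge_\mu Y\cong X\cong Y\wedge_\mu X$ and natural left and right distributivity isomorphisms, satisfying Laplaza's coherence conditions. *)

(* Defs.v *)
From HB Require Import structures.
From Stdlib Require Import Relation_Operators.
From mathcomp Require Import all_boot all_order all_algebra generic_quotient.
From mathcomp Require Import all_classical all_reals topology normedtype.

Set Implicit Arguments.
Unset Strict Implicit.
Unset Printing Implicit Defensive.

Import Order.TTheory GRing.Theory Num.Theory.
Import numFieldNormedType.Exports.

Local Open Scope ring_scope.

Local Obligation Tactic := idtac.

Declare Scope cat_scope.

Record category := Category {
  ob :> Type;
  hom : ob -> ob -> Type;
  idm : forall a, hom a a;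
  cmp : forall a b c, hom b c -> hom a b -> hom a c;
  cmp_idl : forall a b (f : hom a b), cmp (idm b) f = f;
  cmp_idr : forall a b (f : hom a b), cmp f (idm a) = f;
  cmp_assoc : forall a b c d (h : hom c d) (g : hom b c) (f : hom a b),
    cmp h (cmp g f) = cmp (cmp h g) f }.

Arguments hom {_} a b : rename.
Arguments idm {_} a : rename.
Arguments cmp {_ a b c} g f : rename.

Notation "g ∘ f" := (cmp g f)
  (at level 40, left associativity) : cat_scope.
Local Open Scope cat_scope.

Record functor (C D : category) := Functor {
  fob :> C -> D;
  fmap : forall a b, hom a b -> hom (fob a) (fob b);
  fmap_id : forall a, fmap (idm a) = idm (fob a);
  fmap_cmp : forall a b c (g : hom b c) (f : hom a b),
    fmap (g ∘ f) = fmap g ∘ fmap f }.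

Arguments fmap {C D} F {a b} f : rename.

Section Constructions.
Variables C D E : category.

Program Definition prod_cat : category :=
  @Category (C * D) (fun a b => hom a.1 b.1 * hom a.2 b.2)%type
    (fun a => (idm a.1, idm a.2))
    (fun a b c g f => (g.1 ∘ f.1, g.2 ∘ f.2)) _ _ _.
Next Obligation. by move=> /= a b [f g] /=; rewrite !cmp_idl. Qed.
Next Obligation. by move=> /= a b [f g] /=; rewrite !cmp_idr. Qed.
Next Obligation. by move=> /= a b c d f g h; rewrite !cmp_assoc. Qed.

Program Definition comp_functor (G : functor D E) (F : functor C D) :
    functor C E :=
  @Functor _ _ (fun a => G (F a)) (fun a b f => fmap G (fmap F f)) _ _.
Next Obligation. by move=> G F a /=; rewrite !fmap_id. Qed.
Next Obligation. by move=> G F a b c g f /=; rewrite !fmap_cmp. Qed.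

Program Definition full_sub (P : C -> Prop) : category :=
  @Category {a : C | P a} (fun a b => hom (sval a) (sval b))
    (fun a => idm (sval a)) (fun a b c g f => g ∘ f) _ _ _.
Next Obligation. by move=> P a b f; apply: cmp_idl. Qed.
Next Obligation. by move=> P a b f; apply: cmp_idr. Qed.
Next Obligation. by move=> P a b c d h g f; apply: cmp_assoc. Qed.

End Constructions.

Section PartialFunctors.
Variables (C D E : category) (F : functor (prod_cat C D) E).

Definition bimap a a' b b' (f : hom a a') (g : hom b b') :
    hom (F (a, b)) (F (a', b')) := @fmap _ _ F (a, b) (a', b') (f, g).

Lemma bimap_id a b : bimap (idm a) (idm b) = idm (F (a, b)).
Proof. exact: (fmap_id F (a, b)). Qed.

Lemma bimap_cmp a a' a'' b b' b'' (f' : hom a' a'') (f : hom a a')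
    (g' : hom b' b'') (g : hom b b') :
  bimap (f' ∘ f) (g' ∘ g) = bimap f' g' ∘ bimap f g.
Proof.
exact: (@fmap_cmp _ _ F (a, b) (a', b') (a'', b'') (f', g') (f, g)).
Qed.

Program Definition functor_l (b : D) : functor C E :=
  @Functor _ _ (fun a => F (a, b))
    (fun a a' f => bimap f (idm b)) _ _.
Next Obligation. by move=> b a; apply: bimap_id. Qed.
Next Obligation. by move=> b a a' a'' g f /=; rewrite -bimap_cmp cmp_idl. Qed.

Program Definition functor_r (a : C) : functor D E :=
  @Functor _ _ (fun b => F (a, b))
    (fun b b' f => bimap (idm a) f) _ _.
Next Obligation. by move=> a b; apply: bimap_id. Qed.
Next Obligation. by move=> a b b' b'' g f /=; rewrite -bimap_cmp cmp_idl. Qed.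

End PartialFunctors.

Program Definition restrict_functor (C : category) (F : functor (prod_cat C C) C)
    (P : C -> Prop) (closedP : forall a b, P a -> P b -> P (F (a, b))) :
    functor (prod_cat (full_sub P) (full_sub P)) (full_sub P) :=
  @Functor (prod_cat (full_sub P) (full_sub P)) (full_sub P)
    (fun a => exist P (F (sval a.1, sval a.2))
                (closedP _ _ (svalP a.1) (svalP a.2)))
    (fun a b f => @fmap _ _ F (sval a.1, sval a.2) (sval b.1, sval b.2) f) _ _.
Next Obligation.
by move=> C F P cP a /=; rewrite -(@fmap_id _ _ F (sval a.1, sval a.2)).
Qed.
Next Obligation.
move=> C F P cP a b c g f /=.
by rewrite -(@fmap_cmp _ _ F (sval a.1, sval a.2) (sval b.1, sval b.2)
               (sval c.1, sval c.2)).
Qed.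

Record iso (C : category) (a b : C) := Iso {
  iso_fwd :> hom a b;
  iso_bwd : hom b a;
  iso_fwdK : iso_bwd ∘ iso_fwd = idm a;
  iso_bwdK : iso_fwd ∘ iso_bwd = idm b }.

Definition is_pushout (C : category) (a b c d : C)
    (f : hom a b) (g : hom a c) (i : hom b d) (j : hom c d) : Prop :=
  i ∘ f = j ∘ g /\
  forall (e : C) (u : hom b e) (v : hom c e), u ∘ f = v ∘ g ->
    exists! w : hom d e, w ∘ i = u /\ w ∘ j = v.

Definition hom_class (C : category) := forall a b : C, hom a b -> Prop.

Record exact (C D : category) (cofC weC : hom_class C) (cofD weD : hom_class D)
    (F : functor C D) : Prop := Exact {
  exact_cof : forall (a b : C) (f : hom a b), cofC _ _ f -> cofD _ _ (fmap F f);
  exact_pushout : forall (a b c d : C)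
      (f : hom a b) (g : hom a c) (i : hom b d) (j : hom c d),
    cofC _ _ f -> is_pushout f g i j ->
    is_pushout (fmap F f) (fmap F g) (fmap F i) (fmap F j);
  exact_we : forall (a b : C) (f : hom a b), weC _ _ f -> weD _ _ (fmap F f) }.

Definition biexact (C : category) (cof we : hom_class C)
    (F : functor (prod_cat C C) C) : Prop :=
  forall a : C, exact cof we cof we (functor_l F a) /\
                exact cof we cof we (functor_r F a).

Section SymmetricMonoidal.
Variables (C : category) (T : functor (prod_cat C C) C) (I : C).

Local Notation "a ⊗ b" := (T (a, b)) (at level 40, left associativity).
Local Notation "f ⊗₁ g" := (bimap T f g)
  (at level 40, left associativity).

Record symmetric_monoidal := SymmetricMonoidal {
  assoc : forall a b c, iso ((a ⊗ b) ⊗ c) (a ⊗ (b ⊗ c));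
  lunit : forall a, iso (I ⊗ a) a;
  runit : forall a, iso (a ⊗ I) a;
  symm : forall a b, iso (a ⊗ b) (b ⊗ a);
  assoc_nat : forall a b c a' b' c'
      (f : hom a a') (g : hom b b') (h : hom c c'),
    assoc a' b' c' ∘ ((f ⊗₁ g) ⊗₁ h) = (f ⊗₁ (g ⊗₁ h)) ∘ assoc a b c;
  lunit_nat : forall a a' (f : hom a a'),
    lunit a' ∘ (idm I ⊗₁ f) = f ∘ lunit a;
  runit_nat : forall a a' (f : hom a a'),
    runit a' ∘ (f ⊗₁ idm I) = f ∘ runit a;
  symm_nat : forall a b a' b' (f : hom a a') (g : hom b b'),
    symm a' b' ∘ (f ⊗₁ g) = (g ⊗₁ f) ∘ symm a b;
  pentagon : forall a b c d,
    assoc a b (c ⊗ d) ∘ assoc (a ⊗ b) c d =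
    (idm a ⊗₁ assoc b c d) ∘ assoc a (b ⊗ c) d ∘ (assoc a b c ⊗₁ idm d);
  triangle : forall a b,
    (idm a ⊗₁ lunit b) ∘ assoc a I b = runit a ⊗₁ idm b;
  symm_inv : forall a b, symm b a ∘ symm a b = idm (a ⊗ b);
  symm_unit : forall a, lunit a ∘ symm a I = runit a;
  hexagon : forall a b c,
    assoc b c a ∘ symm a (b ⊗ c) ∘ assoc a b c =
    (idm b ⊗₁ symm a c) ∘ assoc b a c ∘ (symm a b ⊗₁ idm c) }.

Definition middle_swap (M : symmetric_monoidal) (a b c d : C) :
    hom ((a ⊗ b) ⊗ (c ⊗ d)) ((a ⊗ c) ⊗ (b ⊗ d)) :=
  iso_bwd (assoc M a c (b ⊗ d))
  ∘ (idm a ⊗₁ (assoc M c b d ∘ (symm M b c ⊗₁ idm d)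
               ∘ iso_bwd (assoc M b c d)))
  ∘ assoc M a b (c ⊗ d).

End SymmetricMonoidal.

Section SymmetricBimonoidal.
Variables (C : category).
Variables (S : functor (prod_cat C C) C) (O : C).
Variables (T : functor (prod_cat C C) C) (I : C).

Local Notation "a ⊕ b" := (S (a, b)) (at level 50, left associativity).
Local Notation "a ⊗ b" := (T (a, b)) (at level 40, left associativity).
Local Notation "f ⊕₁ g" := (bimap S f g)
  (at level 50, left associativity).
Local Notation "f ⊗₁ g" := (bimap T f g)
  (at level 40, left associativity).

(** The fields from [distl_symm] on are the 24 coherence conditions of
    M. L. Laplaza, Coherence for distributivity (1972); his distributivity
    monomorphisms are required to be isomorphisms. *)
Record symmetric_bimonoidal := SymmetricBimonoidal {
  add : symmetric_monoidal S O;
  mul : symmetric_monoidal T I;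
  annl : forall a, iso (O ⊗ a) O;
  annr : forall a, iso (a ⊗ O) O;
  distl : forall a b c, iso (a ⊗ (b ⊕ c)) ((a ⊗ b) ⊕ (a ⊗ c));
  distr : forall a b c, iso ((a ⊕ b) ⊗ c) ((a ⊗ c) ⊕ (b ⊗ c));

  annl_nat : forall a a' (f : hom a a'), annl a' ∘ (idm O ⊗₁ f) = annl a;
  annr_nat : forall a a' (f : hom a a'), annr a' ∘ (f ⊗₁ idm O) = annr a;
  distl_nat : forall a b c a' b' c'
      (f : hom a a') (g : hom b b') (h : hom c c'),
    distl a' b' c' ∘ (f ⊗₁ (g ⊕₁ h)) =
    ((f ⊗₁ g) ⊕₁ (f ⊗₁ h)) ∘ distl a b c;
  distr_nat : forall a b c a' b' c'
      (f : hom a a') (g : hom b b') (h : hom c c'),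
    distr a' b' c' ∘ ((f ⊕₁ g) ⊗₁ h) =
    ((f ⊗₁ h) ⊕₁ (g ⊗₁ h)) ∘ distr a b c;

  distl_symm : forall a b c,
    distl a c b ∘ (idm a ⊗₁ symm add b c) =
    symm add (a ⊗ b) (a ⊗ c) ∘ distl a b c;
  distr_symm : forall a b c,
    distr b a c ∘ (symm add a b ⊗₁ idm c) =
    symm add (a ⊗ c) (b ⊗ c) ∘ distr a b c;
  distr_distl : forall a b c,
    (symm mul a c ⊕₁ symm mul b c) ∘ distr a b c =
    distl c a b ∘ symm mul (a ⊕ b) c;
  distr_assoc_add : forall a b c d,
    (idm (a ⊗ d) ⊕₁ distr b c d) ∘ distr a (b ⊕ c) d
      ∘ (assoc add a b c ⊗₁ idm d) =
    assoc add (a ⊗ d) (b ⊗ d) (c ⊗ d) ∘ (distr a b d ⊕₁ idm (c ⊗ d))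
      ∘ distr (a ⊕ b) c d;
  distl_assoc_add : forall a b c d,
    (idm (a ⊗ b) ⊕₁ distl a c d) ∘ distl a b (c ⊕ d)
      ∘ (idm a ⊗₁ assoc add b c d) =
    assoc add (a ⊗ b) (a ⊗ c) (a ⊗ d) ∘ (distl a b c ⊕₁ idm (a ⊗ d))
      ∘ distl a (b ⊕ c) d;
  distl_assoc_mul : forall a b c d,
    (assoc mul a b c ⊕₁ assoc mul a b d) ∘ distl (a ⊗ b) c d =
    distl a (b ⊗ c) (b ⊗ d) ∘ (idm a ⊗₁ distl b c d)
      ∘ assoc mul a b (c ⊕ d);
  distr_assoc_mul : forall a b c d,
    (assoc mul a c d ⊕₁ assoc mul b c d) ∘ distr (a ⊗ c) (b ⊗ c) d
      ∘ (distr a b c ⊗₁ idm d) =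
    distr a b (c ⊗ d) ∘ assoc mul (a ⊕ b) c d;
  distlr_assoc_mul : forall a b c d,
    (assoc mul a b d ⊕₁ assoc mul a c d) ∘ distr (a ⊗ b) (a ⊗ c) d
      ∘ (distl a b c ⊗₁ idm d) =
    distl a (b ⊗ d) (c ⊗ d) ∘ (idm a ⊗₁ distr b c d)
      ∘ assoc mul a (b ⊕ c) d;
  distl_distr : forall a b c d,
    middle_swap add (a ⊗ c) (b ⊗ c) (a ⊗ d) (b ⊗ d)
      ∘ (distr a b c ⊕₁ distr a b d) ∘ distl (a ⊕ b) c d =
    (distl a c d ⊕₁ distl b c d) ∘ distr a b (c ⊕ d);
  annl_annr : annl O = annr O :> hom _ _;
  annl_dist : forall a b,
    annl (a ⊕ b) = lunit add O ∘ (annl a ⊕₁ annl b) ∘ distl O a b :> hom _ _;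
  annr_dist : forall a b,
    annr (a ⊕ b) = lunit add O ∘ (annr a ⊕₁ annr b) ∘ distr a b O :> hom _ _;
  annl_unit : annl I = runit mul O :> hom _ _;
  annr_unit : annr I = lunit mul O :> hom _ _;
  annr_symm : forall a, annr a = annl a ∘ symm mul a O :> hom _ _;
  annl_assoc : forall a b,
    annl (a ⊗ b) ∘ assoc mul O a b = annl b ∘ (annl a ⊗₁ idm b);
  annlr_assoc : forall a b,
    annr a ∘ (idm a ⊗₁ annl b) ∘ assoc mul a O b =
    annl b ∘ (annr a ⊗₁ idm b);
  annr_assoc : forall a b,
    annr (a ⊗ b) = annr a ∘ (idm a ⊗₁ annr b) ∘ assoc mul a b O
      :> hom _ _;
  distl_lunit : forall a b,
    lunit add (a ⊗ b) ∘ (annr a ⊕₁ idm (a ⊗ b)) ∘ distl a O b =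
    idm a ⊗₁ lunit add b;
  distr_lunit : forall a b,
    lunit add (b ⊗ a) ∘ (annl a ⊕₁ idm (b ⊗ a)) ∘ distr O b a =
    lunit add b ⊗₁ idm a;
  distl_runit : forall a b,
    runit add (a ⊗ b) ∘ (idm (a ⊗ b) ⊕₁ annr a) ∘ distl a b O =
    idm a ⊗₁ runit add b;
  distr_runit : forall a b,
    runit add (b ⊗ a) ∘ (idm (b ⊗ a) ⊕₁ annl a) ∘ distr b O a =
    runit add b ⊗₁ idm a;
  distl_unit : forall a b,
    (lunit mul a ⊕₁ lunit mul b) ∘ distl I a b = lunit mul (a ⊕ b);
  distr_unit : forall a b,
    (runit mul a ⊕₁ runit mul b) ∘ distr a b I = runit mul (a ⊕ b) }.

End SymmetricBimonoidal.

Section Quot.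
Local Open Scope quotient_scope.
Variables (T : choiceType) (R : T -> T -> Prop).

Definition gen_rel : rel T := fun x y => `[< clos_refl_sym_trans T R x y >].

Lemma gen_rel_equiv : equiv_class_of gen_rel.
Proof.
split.
- by move=> x; apply/asboolP; apply: rst_refl.
- by move=> x y; apply/asboolP/asboolP => h; apply: rst_sym.
- by move=> y x z /asboolP xy /asboolP yz; apply/asboolP; apply: rst_trans yz.
Qed.

Canonical gen_equiv := EquivRelPack gen_rel_equiv.

Definition quot := {eq_quot gen_equiv}.

Definition qpi (x : T) : quot := \pi_quot x.

Lemma qpiP x y : qpi x = qpi y <-> clos_refl_sym_trans T R x y.
Proof.
by split=> [/eqmodP/asboolP //|xy]; apply/eqmodP/asboolP.
Qed.

Lemma quot_ind (P : quot -> Prop) : (forall x, P (qpi x)) -> forall q, P q.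
Proof. by move=> h q; rewrite -[q]reprK; apply: h. Qed.

(** Meaningful when [f] is compatible with [R]; see [qliftE]. *)
Definition qlift (U : Type) (f : T -> U) : quot -> U := f \o repr.

Lemma qliftE (U : Type) (f : T -> U) :
  (forall x y, R x y -> f x = f y) -> forall x, qlift f (qpi x) = f x.
Proof.
move=> fR x; rewrite /qlift /=.
have h y z : clos_refl_sym_trans T R y z -> f y = f z.
  by elim=> // a b c _ -> _ ->.
by apply/h/qpiP; apply: reprK.
Qed.

End Quot.

(** The ordinal [[n]] is ['I_n.+1], and a morphism of the simplex category is a
    nondecreasing map. *)
Definition delta (m n : nat) := {omorphism 'I_m.+1 -> 'I_n.+1}.

Definition delta_id n : delta n n := @idfun 'I_n.+1.
Definition delta_comp l m n (g : delta m n) (f : delta l m) : delta l n :=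
  g \o f.

Lemma cst_nondecreasing n (i : 'I_n.+1) :
  {homo (fun=> i) : x y / (x <= y :> 'I_1)%O >-> (x <= y)%O}.
Proof. by move=> x y _. Qed.
Definition vertex n (i : 'I_n.+1) : delta 0 n :=
  HB.pack (fun _ : 'I_1 => i)
    (Order.isOrderMorphism.Build _ _ _ _ _ (cst_nondecreasing i)).

Record sset := SSet {
  simp :> nat -> Type;
  act : forall m n, delta m n -> simp n -> simp m;
  act_id : forall n (x : simp n), act (delta_id n) x = x;
  act_comp : forall l m n (g : delta m n) (f : delta l m) (x : simp n),
    act (delta_comp g f) x = act f (act g x) }.

Arguments act {X m n} f x : rename.

Record smap (X Y : sset) := SMap {
  sfun :> forall n, X n -> Y n;
  sfun_act : forall m n (f : delta m n) (x : X n),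
    sfun (act f x) = act f (sfun x) }.

Arguments sfun {X Y} f n x : rename.

Lemma smap_ext (X Y : sset) (f g : smap X Y) :
  (forall n (x : X n), f n x = g n x) -> f = g.
Proof.
case: f g => f fP [g gP] /= fg.
have e : f = g by apply: functional_extensionality_dep => n; apply/funext.
by case: _ / e gP => gP; congr SMap; apply: Prop_irrelevance.
Qed.

Section SMap.
Variables X Y Z : sset.

Definition smap_id : smap X X :=
  @SMap X X (fun n x => x) (fun m n f x => erefl).

Program Definition smap_comp (g : smap Y Z) (f : smap X Y) : smap X Z :=
  @SMap X Z (fun n x => g n (f n x)) _.
Next Obligation. by move=> g f m n h x /=; rewrite !sfun_act. Qed.

End SMap.

Definition injective_smap (X Y : sset) (f : smap X Y) : Prop :=
  forall n, injective (f n).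

Program Definition const_sset (T : Type) : sset :=
  @SSet (fun _ => T) (fun _ _ _ x => x) _ _.
Next Obligation. by []. Qed.
Next Obligation. by []. Qed.

Program Definition sprod (X Y : sset) : sset :=
  @SSet (fun n => X n * Y n)%type
    (fun m n f x => (act f x.1, act f x.2)) _ _.
Next Obligation. by move=> X Y n [x y] /=; rewrite !act_id. Qed.
Next Obligation. by move=> X Y l m n g f x /=; rewrite !act_comp. Qed.

Program Definition sprod_map (X Y X' Y' : sset) (f : smap X X')
    (g : smap Y Y') : smap (sprod X Y) (sprod X' Y') :=
  @SMap (sprod X Y) (sprod X' Y') (fun n x => (f n x.1, g n x.2)) _.
Next Obligation. by move=> X Y X' Y' f g m n h x /=; rewrite !sfun_act. Qed.

Definition edge (X : sset) (x y : X 0) : Prop :=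
  exists e : X 1, act (vertex ord0) e = x /\ act (vertex ord_max) e = y.

Definition connected_sset (X : sset) : Prop :=
  inhabited (X 0) /\
  forall x y : X 0, clos_refl_sym_trans (X 0) (@edge X) x y.

Definition degenerate (X : sset) n (x : X n) : Prop :=
  exists m (f : delta n m) (y : X m),
    [/\ (m < n)%N, (forall j, exists i, f i = j) & x = act f y].

Section Pushout.
Variables (A B C : sset) (f : smap A B) (g : smap A C).

Definition glue n (u v : {classic (B n + C n)%type}) : Prop :=
  exists a : A n, u = inl (f n a) /\ v = inr (g n a).

Definition sum_act m n (h : delta m n) (u : B n + C n) : B m + C m :=
  match u with inl b => inl (act h b) | inr c => inr (act h c) end.

Definition pushout_simp n := quot (@glue n).

Definition po_pi n (u : B n + C n) : pushout_simp n := qpi (@glue n) u.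

Definition pushout_act m n (h : delta m n) :
    pushout_simp n -> pushout_simp m :=
  qlift (fun u : {classic (B n + C n)%type} => po_pi (sum_act h u)).

Lemma po_pi_ind n (P : pushout_simp n -> Prop) :
  (forall u, P (po_pi u)) -> forall x, P x.
Proof. exact: (@quot_ind _ (@glue n) P). Qed.

Lemma pushout_actE m n (h : delta m n) u :
  pushout_act h (po_pi u) = po_pi (sum_act h u).
Proof.
apply: (@qliftE _ (@glue n) _ (fun w => po_pi (sum_act h w))) => {}u v
  [a [-> ->]].
by apply/qpiP/rst_step; exists (act h a); rewrite /= !sfun_act.
Qed.

Program Definition pushout : sset := @SSet pushout_simp pushout_act _ _.
Next Obligation.
move=> n; apply: po_pi_ind => u; rewrite pushout_actE; congr po_pi.
by case: u => u /=; rewrite act_id.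
Qed.
Next Obligation.
move=> l m n h k; apply: po_pi_ind => u; rewrite !pushout_actE; congr po_pi.
by case: u => u /=; rewrite act_comp.
Qed.

Program Definition po_inl : smap B pushout :=
  @SMap B pushout (fun n b => po_pi (inl b)) _.
Next Obligation. by move=> m n h b /=; rewrite pushout_actE. Qed.

Program Definition po_inr : smap C pushout :=
  @SMap C pushout (fun n c => po_pi (inr c)) _.
Next Obligation. by move=> m n h c /=; rewrite pushout_actE. Qed.

Lemma po_glue n (a : A n) : po_inl n (f n a) = po_inr n (g n a).
Proof. by apply/qpiP/rst_step; exists a. Qed.

Lemma po_ind n (P : pushout n -> Prop) :
  (forall b, P (po_inl n b)) -> (forall c, P (po_inr n c)) -> forall x, P x.
Proof. by move=> hb hc; apply: po_pi_ind => -[b|c]; [apply: hb|apply: hc]. Qed.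

Section Case.
Variables (Z : sset) (u : smap B Z) (v : smap C Z).
Hypothesis uv : forall n (a : A n), u n (f n a) = v n (g n a).

Definition po_case_fun n : pushout n -> Z n :=
  qlift (fun x : {classic (B n + C n)%type} =>
    match x with inl b => u n b | inr c => v n c end).

Lemma po_case_funE n x : @po_case_fun n (po_pi x) =
  match x with inl b => u n b | inr c => v n c end.
Proof. apply: (@qliftE _ (@glue n) _ (fun w => match w with inl b => u n b
  | inr c => v n c end)) => {}x y [a [-> ->]].
exact: uv. Qed.

Program Definition po_case : smap pushout Z := @SMap pushout Z po_case_fun _.
Next Obligation.
move=> m n h; apply: po_pi_ind => x.
by rewrite /= pushout_actE !po_case_funE; case: x => x /=; rewrite sfun_act.
Qed.

Lemma po_case_inl n b : po_case n (po_inl n b) = u n b.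
Proof. exact: po_case_funE. Qed.

Lemma po_case_inr n c : po_case n (po_inr n c) = v n c.
Proof. exact: po_case_funE. Qed.

End Case.

Lemma po_ext (Z : sset) (h k : smap pushout Z) :
  (forall n b, h n (po_inl n b) = k n (po_inl n b)) ->
  (forall n c, h n (po_inr n c) = k n (po_inr n c)) -> h = k.
Proof. by move=> hb hc; apply: smap_ext => n; apply: po_ind. Qed.

End Pushout.

(** Keeps [/=] from unfolding these to the quotients that implement them. *)
Local Opaque po_inl po_inr po_case.

Section PushoutMap.
Variables (A B C : sset) (f : smap A B) (g : smap A C).
Variables (A' B' C' : sset) (f' : smap A' B') (g' : smap A' C').
Variables (a : smap A A') (b : smap B B') (c : smap C C').
Hypothesis bf : forall n x, b n (f n x) = f' n (a n x).
Hypothesis cg : forall n x, c n (g n x) = g' n (a n x).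

Lemma po_map_proof n (x : A n) :
  smap_comp (po_inl f' g') b n (f n x) = smap_comp (po_inr f' g') c n (g n x).
Proof. by rewrite /= bf cg; apply: po_glue. Qed.

Definition po_map : smap (pushout f g) (pushout f' g') := po_case po_map_proof.

Lemma po_map_inl n x : po_map n (po_inl f g n x) = po_inl f' g' n (b n x).
Proof. exact: po_case_inl. Qed.

Lemma po_map_inr n x : po_map n (po_inr f g n x) = po_inr f' g' n (c n x).
Proof. exact: po_case_inr. Qed.

End PushoutMap.

Local Opaque po_map.

Record retr (X : sset) := Retr {
  tot :> sset;
  ret : smap tot X;
  sec : smap X tot;
  retK : forall n (x : X n), ret n (sec n x) = x }.

Record rhom (X : sset) (Y Z : retr X) := RHom {
  rmap :> smap Y Z;
  rmap_ret : forall n (y : Y n), ret Z n (rmap n y) = ret Y n y;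
  rmap_sec : forall n (x : X n), rmap n (sec Y n x) = sec Z n x }.

Lemma rhom_ext (X : sset) (Y Z : retr X) (f g : rhom Y Z) :
  (forall n (y : Y n), f n y = g n y) -> f = g.
Proof.
case: f g => f f1 f2 [g g1 g2] /= /smap_ext fg.
by case: _ / fg g1 g2 => g1 g2; congr RHom; apply: Prop_irrelevance.
Qed.

Section RetrCat.
Variable X : sset.

Program Definition rhom_id (Y : retr X) : rhom Y Y :=
  @RHom X Y Y (smap_id Y) _ _.
Next Obligation. by []. Qed.
Next Obligation. by []. Qed.

Program Definition rhom_comp (Y Z W : retr X) (g : rhom Z W) (f : rhom Y Z) :
    rhom Y W := @RHom X Y W (smap_comp g f) _ _.
Next Obligation. by move=> Y Z W g f n y; rewrite /= !rmap_ret. Qed.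
Next Obligation. by move=> Y Z W g f n y; rewrite /= !rmap_sec. Qed.

Program Definition R_ : category := @Category (retr X) (@rhom X) rhom_id
  rhom_comp _ _ _.
Next Obligation. by move=> Y Z f; apply: rhom_ext. Qed.
Next Obligation. by move=> Y Z f; apply: rhom_ext. Qed.
Next Obligation. by move=> Y Z W V h g f; apply: rhom_ext. Qed.

Definition finite_retr (Y : R_) : Prop :=
  finite_set [set y : {n : nat & Y n} |
    (forall x, projT2 y <> sec Y (projT1 y) x) /\ ~ degenerate (projT2 y)].

Definition Rf : category := full_sub finite_retr.

Program Definition zero_retr : R_ := @Retr X X (smap_id X) (smap_id X) _.
Next Obligation. by []. Qed.

Section Vee.
Variables Y Z : retr X.

Lemma vee_ret_proof n (x : X n) : ret Y n (sec Y n x) = ret Z n (sec Z n x).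
Proof. by rewrite !retK. Qed.

Program Definition vee_ob : retr X :=
  @Retr X (pushout (sec Y) (sec Z)) (po_case vee_ret_proof)
    (smap_comp (po_inl (sec Y) (sec Z)) (sec Y)) _.
Next Obligation. by move=> n x; rewrite /= po_case_inl retK. Qed.

End Vee.

Program Definition vee_map (Y Z Y' Z' : retr X) (f : rhom Y Y')
    (g : rhom Z Z') : rhom (vee_ob Y Z) (vee_ob Y' Z') :=
  @RHom X (vee_ob Y Z) (vee_ob Y' Z')
    (@po_map _ _ _ (sec Y) (sec Z) _ _ _ (sec Y') (sec Z') (smap_id X) f g
      (rmap_sec f) (rmap_sec g)) _ _.
Next Obligation.
move=> Y Z Y' Z' f g n; apply: po_ind => y /=.
- by rewrite po_map_inl !po_case_inl rmap_ret.
- by rewrite po_map_inr !po_case_inr rmap_ret.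
Qed.
Next Obligation.
by move=> Y Z Y' Z' f g n x; rewrite /= po_map_inl rmap_sec.
Qed.

Program Definition vee : functor (prod_cat R_ R_) R_ :=
  @Functor (prod_cat R_ R_) R_ (fun Y => vee_ob Y.1 Y.2)
    (fun Y Z f => vee_map f.1 f.2) _ _.
Next Obligation.
move=> [Y Z]; apply: rhom_ext => n; apply: po_ind => y.
- exact: po_map_inl.
- exact: po_map_inr.
Qed.
Next Obligation.
move=> [Y Z] [Y' Z'] [Y'' Z''] [g g'] [f f'].
apply: rhom_ext => n; apply: po_ind => y /=.
- by rewrite !po_map_inl.
- by rewrite !po_map_inr.
Qed.

End RetrCat.

Section Push.
Variables (X X' : sset) (p : smap X X').

Section Ob.
Variable Y : retr X.

Lemma push_ret_proof n (x : X n) :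
  smap_comp p (ret Y) n (sec Y n x) = smap_id X' n (p n x).
Proof. by rewrite /= retK. Qed.

Program Definition push_ob : retr X' :=
  @Retr X' (pushout (sec Y) p) (po_case push_ret_proof) (po_inr (sec Y) p) _.
Next Obligation. by move=> n x; rewrite /= po_case_inr. Qed.

End Ob.

Program Definition push_map (Y Z : retr X) (f : rhom Y Z) :
    rhom (push_ob Y) (push_ob Z) :=
  @RHom X' (push_ob Y) (push_ob Z)
    (@po_map _ _ _ (sec Y) p _ _ _ (sec Z) p (smap_id X) f (smap_id X')
      (rmap_sec f) (fun _ _ => erefl)) _ _.
Next Obligation.
move=> Y Z f n; apply: po_ind => y /=.
- by rewrite po_map_inl !po_case_inl /= rmap_ret.
- by rewrite po_map_inr !po_case_inr.
Qed.
Next Obligation. by move=> Y Z f n x; rewrite /= po_map_inr. Qed.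

Program Definition push : functor (R_ X) (R_ X') :=
  @Functor (R_ X) (R_ X') push_ob push_map _ _.
Next Obligation.
move=> Y; apply: rhom_ext => n; apply: po_ind => y.
- exact: po_map_inl.
- exact: po_map_inr.
Qed.
Next Obligation.
move=> Y Z W g f; apply: rhom_ext => n; apply: po_ind => y /=.
- by rewrite !po_map_inl.
- by rewrite !po_map_inr.
Qed.

End Push.

Section ExtSmash.
Variables X1 X2 : sset.

Section Ob.
Variables (Y1 : retr X1) (Y2 : retr X2).

(** [Y1 * X2] and [X1 * Y2] glued along [X1 * X2]. *)
Definition fat_wedge : sset :=
  pushout (sprod_map (sec Y1) (smap_id X2)) (sprod_map (smap_id X1) (sec Y2)).

Lemma fat_wedge_ret_proof n (x : sprod X1 X2 n) :
  sprod_map (ret Y1) (smap_id X2) n (sprod_map (sec Y1) (smap_id X2) n x) =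
  sprod_map (smap_id X1) (ret Y2) n (sprod_map (smap_id X1) (sec Y2) n x).
Proof. by rewrite /= !retK. Qed.

Definition fat_wedge_ret : smap fat_wedge (sprod X1 X2) :=
  po_case fat_wedge_ret_proof.

Lemma fat_wedge_incl_proof n (x : sprod X1 X2 n) :
  sprod_map (smap_id Y1) (sec Y2) n (sprod_map (sec Y1) (smap_id X2) n x) =
  sprod_map (sec Y1) (smap_id Y2) n (sprod_map (smap_id X1) (sec Y2) n x).
Proof. by []. Qed.

Definition fat_wedge_incl : smap fat_wedge (sprod Y1 Y2) :=
  po_case fat_wedge_incl_proof.

Lemma ext_smash_ret_proof n (w : fat_wedge n) :
  smap_id (sprod X1 X2) n (fat_wedge_ret n w) =
  sprod_map (ret Y1) (ret Y2) n (fat_wedge_incl n w).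
Proof.
elim/po_ind: w => -[y1 y2] /=; rewrite ?po_case_inl ?po_case_inr /=;
  by rewrite retK.
Qed.

Program Definition ext_smash_ob : retr (sprod X1 X2) :=
  @Retr (sprod X1 X2) (pushout fat_wedge_ret fat_wedge_incl)
    (po_case ext_smash_ret_proof) (po_inl fat_wedge_ret fat_wedge_incl) _.
Next Obligation. by move=> n x; rewrite /= po_case_inl. Qed.

End Ob.

Section Map.
Variables (Y1 Z1 : retr X1) (Y2 Z2 : retr X2).
Variables (f1 : rhom Y1 Z1) (f2 : rhom Y2 Z2).

Lemma fat_wedge_map_proof1 n (x : sprod X1 X2 n) :
  sprod_map f1 (smap_id X2) n (sprod_map (sec Y1) (smap_id X2) n x) =
  sprod_map (sec Z1) (smap_id X2) n (smap_id (sprod X1 X2) n x).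
Proof. by rewrite /= rmap_sec. Qed.

Lemma fat_wedge_map_proof2 n (x : sprod X1 X2 n) :
  sprod_map (smap_id X1) f2 n (sprod_map (smap_id X1) (sec Y2) n x) =
  sprod_map (smap_id X1) (sec Z2) n (smap_id (sprod X1 X2) n x).
Proof. by rewrite /= rmap_sec. Qed.

Definition fat_wedge_map : smap (fat_wedge Y1 Y2) (fat_wedge Z1 Z2) :=
  po_map fat_wedge_map_proof1 fat_wedge_map_proof2.

Lemma ext_smash_map_proof1 n (w : fat_wedge Y1 Y2 n) :
  smap_id (sprod X1 X2) n (fat_wedge_ret Y1 Y2 n w) =
  fat_wedge_ret Z1 Z2 n (fat_wedge_map n w).
Proof.
elim/po_ind: w => -[y1 y2] /=.
- by rewrite po_map_inl !po_case_inl /= rmap_ret.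
- by rewrite po_map_inr !po_case_inr /= rmap_ret.
Qed.

Lemma ext_smash_map_proof2 n (w : fat_wedge Y1 Y2 n) :
  sprod_map f1 f2 n (fat_wedge_incl Y1 Y2 n w) =
  fat_wedge_incl Z1 Z2 n (fat_wedge_map n w).
Proof.
elim/po_ind: w => -[y1 y2] /=.
- by rewrite po_map_inl !po_case_inl /= rmap_sec.
- by rewrite po_map_inr !po_case_inr /= rmap_sec.
Qed.

Program Definition ext_smash_map :
    rhom (ext_smash_ob Y1 Y2) (ext_smash_ob Z1 Z2) :=
  @RHom _ (ext_smash_ob Y1 Y2) (ext_smash_ob Z1 Z2)
    (po_map ext_smash_map_proof1 ext_smash_map_proof2) _ _.
Next Obligation.
move=> n; apply: po_ind => y /=.
- by rewrite po_map_inl !po_case_inl.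
- by rewrite po_map_inr !po_case_inr /= !rmap_ret.
Qed.
Next Obligation. by move=> n x; rewrite /= po_map_inl. Qed.

End Map.

Program Definition ext_smash :
    functor (prod_cat (R_ X1) (R_ X2)) (R_ (sprod X1 X2)) :=
  @Functor (prod_cat (R_ X1) (R_ X2)) (R_ (sprod X1 X2))
    (fun Y => ext_smash_ob Y.1 Y.2) (fun Y Z f => ext_smash_map f.1 f.2) _ _.
Next Obligation.
move=> [Y Z]; apply: rhom_ext => n; apply: po_ind => y /=.
- exact: po_map_inl.
- by rewrite po_map_inr; case: y.
Qed.
Next Obligation.
move=> [Y Z] [Y' Z'] [Y'' Z''] [g g'] [f f'].
apply: rhom_ext => n; apply: po_ind => y /=.
- by rewrite !po_map_inl.
- by rewrite !po_map_inr.
Qed.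

End ExtSmash.

Record sabgroup := SAbGroup {
  sab : nat -> zmodType;
  sab_act : forall m n, delta m n -> {additive sab n -> sab m};
  sab_act_id : forall n (x : sab n), sab_act (delta_id n) x = x;
  sab_act_comp : forall l m n (g : delta m n) (f : delta l m) (x : sab n),
    sab_act (delta_comp g f) x = sab_act f (sab_act g x) }.

Coercion sset_of_sab (X : sabgroup) : sset :=
  @SSet (sab X) (fun m n f => sab_act X f) (@sab_act_id X) (@sab_act_comp X).

Section Smash.
Variable X : sabgroup.

Program Definition mult : smap (sprod X X) X :=
  @SMap (sprod X X) X (fun n (x : sab X n * sab X n) => x.1 + x.2) _.
Next Obligation. by move=> m n f x /=; rewrite raddfD. Qed.

Definition smash : functor (prod_cat (R_ X) (R_ X)) (R_ X) :=
  comp_functor (push mult) (ext_smash X X).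

(** [X] glued to [S^0] (the constant simplicial set on [bool]) by identifying
    the base point [true] with [0]. *)
Program Definition zero_pt : smap (const_sset unit) X :=
  @SMap (const_sset unit) X (fun n _ => 0 : sab X n) _.
Next Obligation. by move=> m n f x /=; rewrite raddf0. Qed.

Definition base_pt : smap (const_sset unit) (const_sset bool) :=
  @SMap (const_sset unit) (const_sset bool) (fun _ _ => true)
    (fun _ _ _ _ => erefl).

Program Definition zero_S0 : smap (const_sset bool) X :=
  @SMap (const_sset bool) X (fun n _ => 0 : sab X n) _.
Next Obligation. by move=> m n f x /=; rewrite raddf0. Qed.

Lemma unit_ret_proof n (x : const_sset unit n) :
  smap_id X n (zero_pt n x) = zero_S0 n (base_pt n x).
Proof. by []. Qed.

Program Definition unit_retr : R_ X :=
  @Retr X (pushout zero_pt base_pt) (po_case unit_ret_proof)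
    (po_inl zero_pt base_pt) _.
Next Obligation. by move=> n x; rewrite /= po_case_inl. Qed.

End Smash.

Section Realization.
Variable R : realType.
Local Open Scope classical_set_scope.

Definition simplex_set n : set 'rV[R]_n.+1 :=
  [set t | (forall i, 0 <= t ord0 i) /\ \sum_i t ord0 i = 1].

Definition simplex n : topologicalType := set_type (@simplex_set n).

Definition simplex_push_row m n (f : delta m n) (t : 'rV[R]_m.+1) :
    'rV[R]_n.+1 :=
  \row_j \sum_(i | f i == j) t ord0 i.

Lemma simplex_push_subproof m n (f : delta m n) (t : simplex m) :
  simplex_push_row f (\val t) \in @simplex_set n.
Proof.
case: t => t /= /set_mem[t0 t1]; apply/mem_set; split=> [j|].
  by rewrite mxE; apply: sumr_ge0.
rewrite -t1 (partition_big (fun i => f i) xpredT) //=.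
by apply: eq_bigr => j _; rewrite mxE.
Qed.

Definition simplex_push m n (f : delta m n) (t : simplex m) : simplex n :=
  exist (fun u => u \in @simplex_set n) _ (simplex_push_subproof f t).

(** The disjoint union of the [X_n * Delta^n], with [X_n] discrete. *)
Definition cells (X : sset) : topologicalType :=
  {n : nat & (discrete_topology {classic X n} * simplex n)%type}.

Definition cell (X : sset) n (x : X n) (t : simplex n) : cells X :=
  existT (fun n => (discrete_topology {classic X n} * simplex n)%type) n (x, t).

Definition cell_rel (X : sset) (u v : cells X) : Prop :=
  exists m n (f : delta m n) (x : X n) (t : simplex m),
    u = cell (act f x) t /\ v = cell x (simplex_push f t).

Definition realization (X : sset) : topologicalType :=
  quotient_topology (quot (@cell_rel X)).

Definition cell_map (X Y : sset) (f : smap X Y) (u : cells X) : cells Y :=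
  cell (f _ (projT2 u).1) (projT2 u).2.

Definition realization_map (X Y : sset) (f : smap X Y) :
    realization X -> realization Y :=
  qlift (fun u => qpi (@cell_rel Y) (cell_map f u)).

Lemma realization_mapE (X Y : sset) (f : smap X Y) (u : cells X) :
  realization_map f (qpi (@cell_rel X) u) = qpi (@cell_rel Y) (cell_map f u).
Proof.
apply: qliftE => {}u v [m [n [h [x [t [-> ->]]]]]]; apply/qpiP/rst_step.
by exists m, n, h, (f n x), t; rewrite /cell_map /= sfun_act.
Qed.

Definition homotopic (S T : topologicalType) (f g : S -> T) : Prop :=
  exists H : S * R -> T,
    [/\ {within [set p | 0 <= p.2 <= 1], continuous H},
        (forall s, H (s, 0) = f s) & (forall s, H (s, 1) = g s)].

Definition homotopy_equivalence (S T : topologicalType) (f : S -> T) : Prop :=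
  continuous f /\
  exists g : T -> S,
    [/\ continuous g, homotopic (g \o f) id & homotopic (f \o g) id].

End Realization.

Definition cof_f (X : sset) : hom_class (Rf X) :=
  fun Y Z (f : rhom (sval Y) (sval Z)) => injective_smap f.

Definition we_f (R : realType) (X : sset) : hom_class (Rf X) :=
  fun Y Z (f : rhom (sval Y) (sval Z)) =>
    homotopy_equivalence R (@realization_map R _ _ f).

(* Main.v *)
Require Import Defs.
From HB Require Import structures.
From mathcomp Require Import all_boot all_order all_algebra.
From mathcomp Require Import all_classical all_reals topology normedtype.
From mathcomp Require Import zify lra ring.

(** Every simplex of [Y ∧ Z] is the class of a pair [(y, z)], and two distinct
    pairs have the same class only if both lie in the fat wedge and have the same
    image in [X]; hence bimonoidal coherence, preservation of injections and
    preservation of pushouts are checked on pairs. A pair of degeneracies of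
    nondegenerate simplices of dimensions [p] and [q] is degenerate above
    dimension [(p+1)(q+1)-1], which gives finiteness.

    For weak equivalences, realizations of inclusions have the homotopy extension
    property, so an injective weak equivalence is a strong deformation retract.
    Deformation retracts are stable under pushouts and under products with a
    simplicial set; the latter because the inverse of the continuous bijection
    from [|Y * W|] to [|Y| * |W|], given by comonotone couplings of barycentric
    coordinates, is continuous on [|Y|] times a cell. Pushout-products with
    inclusions follow, hence the smash product with an injective weak equivalence;
    a reduced mapping cylinder handles the general case. *)

Set Implicit Arguments.
Unset Strict Implicit.
Unset Printing Implicit Defensive.

Import Order.TTheory GRing.Theory Num.Theory.
Import numFieldNormedType.Exports.
Local Open Scope cat_scope.
Local Open Scope ring_scope.

Local Opaque po_inl po_inr po_case po_map.

(** With the product topology on |Y| * |W|, the comparison map from |Y * W| need not be a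
    homeomorphism: neither factor is assumed locally compact. The deformations that have to be
    transported move only the |Y|-coordinate, so over each cell of Y * W the |W|-coordinate stays in
    a single cell, and partial continuity of the inverse suffices. The notion carried along is the
    strong deformation retract: a homotopy extends over a pushout by the constant one only if it
    fixes the attaching subspace at all times. For a pushout-product, two-out-of-three yields merely
    a homotopy equivalence; as the map is injective, homotopy extension makes it a strong
    deformation retract again, and only then can it be pushed out a second time to reach the smash
    product. *)

Program Definition iso_comp (C : category) (a b c : C) (g : iso b c)
  (f : iso a b) : iso a c :=
  @Iso C a c (g ∘ f) (iso_bwd f ∘ iso_bwd g) _ _.
Next Obligation.
by move=> C a b c g f; rewrite -cmp_assoc (cmp_assoc (iso_bwd g))
  iso_fwdK cmp_idl iso_fwdK.
Qed.
Next Obligation.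
by move=> C a b c g f; rewrite -cmp_assoc (cmp_assoc f)
  iso_bwdK cmp_idl iso_bwdK.
Qed.

(** * Coherence *)

Section Collapsed.
Variable X : sabgroup.
Implicit Types Y Z : retr X.

Definition collapsed Y Z n (y : Y n) (z : Z n) : Prop :=
  (exists x, y = sec Y n x) \/ (exists x, z = sec Z n x).

Definition retsum Y Z n (y : Y n) (z : Z n) : X n :=
  (ret Y n y : sab X n) + (ret Z n z : sab X n).

Lemma collapsed_secl Y Z n x (z : Z n) : collapsed (sec Y n x) z.
Proof. by left; exists x. Qed.

Lemma collapsed_secr Y Z n (y : Y n) x : collapsed y (sec Z n x).
Proof. by right; exists x. Qed.

Lemma collapsed_sym Y Z n (y : Y n) (z : Z n) : collapsed y z -> collapsed z y.
Proof. by case; [right|left]. Qed.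

End Collapsed.

Section Homs.
Variable X : sset.
Implicit Types Y Z W : retr X.

Lemma rhom_cmpE (Y Z W : R_ X) (g : Defs.hom Z W) (f : Defs.hom Y Z)
  n (y : (Y : retr X) n) :
  rmap (g ∘ f) n y = rmap g n (rmap f n y).
Proof. by []. Qed.

Lemma rhom_compE Y Z W (g : rhom Z W) (f : rhom Y Z) n (y : Y n) :
  rhom_comp g f n y = g n (f n y).
Proof. by []. Qed.

Lemma rhom_idE (Y : R_ X) n (y : (Y : retr X) n) : rmap (idm Y) n y = y.
Proof. by []. Qed.

Lemma sec_inj Y n : injective (sec Y n).
Proof. by move=> x y /(congr1 (ret Y n)); rewrite !retK. Qed.

End Homs.

(** Coherence only uses these elementwise descriptions. Keeping the functors
    abstract also stops conversion from unfolding the nested quotients behind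
    [smash] and [vee]. *)
Record smash_spec (X : sabgroup) (T : functor (prod_cat (R_ X) (R_ X)) (R_ X))
  := SmashSpec {
  spair : forall (Y Z : retr X) n, Y n -> Z n -> T (Y, Z) n;
  spair_ind : forall (Y Z : retr X) n (P : T (Y, Z) n -> Prop),
    (forall y z, P (spair y z)) -> forall p, P p;
  act_spair : forall (Y Z : retr X) m n (h : delta m n) (y : Y n) (z : Z n),
    act h (spair y z) = spair (act h y) (act h z);
  ret_spair : forall (Y Z : retr X) n (y : Y n) (z : Z n),
    ret (T (Y, Z)) n (spair y z) = retsum y z;
  spair_collapsed : forall (Y Z : retr X) n (y : Y n) (z : Z n),
    collapsed y z ->
    spair y z = sec (T (Y, Z)) n (retsum y z);
  spair_eq : forall (Y Z : retr X) n (y y' : Y n) (z z' : Z n),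
    spair y z = spair y' z' ->
    (y = y' /\ z = z') \/ (collapsed y z /\ collapsed y' z');
  bimap_spair : forall (Y Z Y' Z' : retr X) (f : rhom Y Y') (g : rhom Z Z')
    n (y : Y n) (z : Z n),
    rmap (@bimap (R_ X) (R_ X) (R_ X) T Y Y' Z Z' f g) n (spair y z)
      = spair (f n y) (g n z) }.

Record vee_spec (X : sset) (S : functor (prod_cat (R_ X) (R_ X)) (R_ X)) :=
  VeeSpec {
  vinl : forall (Y Z : retr X) n, Y n -> S (Y, Z) n;
  vinr : forall (Y Z : retr X) n, Z n -> S (Y, Z) n;
  vee_ind : forall (Y Z : retr X) n (P : S (Y, Z) n -> Prop),
    (forall y, P (@vinl Y Z n y)) -> (forall z, P (@vinr Y Z n z)) -> forall p,
      P p;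
  act_vinl : forall (Y Z : retr X) m n (h : delta m n) (y : Y n),
    act h (@vinl Y Z n y) = @vinl Y Z m (act h y);
  act_vinr : forall (Y Z : retr X) m n (h : delta m n) (z : Z n),
    act h (@vinr Y Z n z) = @vinr Y Z m (act h z);
  ret_vinl : forall (Y Z : retr X) n (y : Y n), ret (S (Y, Z)) n (@vinl Y Z n y)
    = ret Y n y;
  ret_vinr : forall (Y Z : retr X) n (z : Z n), ret (S (Y, Z)) n (@vinr Y Z n z)
    = ret Z n z;
  vinl_sec : forall (Y Z : retr X) n x, @vinl Y Z n (sec Y n x) = sec (S (Y, Z))
    n x;
  vinr_sec : forall (Y Z : retr X) n x, @vinr Y Z n (sec Z n x) = sec (S (Y, Z))
    n x;
  vinl_inj : forall (Y Z : retr X) n, injective (@vinl Y Z n);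
  vinr_inj : forall (Y Z : retr X) n, injective (@vinr Y Z n);
  vinl_vinr : forall (Y Z : retr X) n (y : Y n) (z : Z n),
    @vinl Y Z n y = @vinr Y Z n z ->
    exists2 x, y = sec Y n x & z = sec Z n x;
  vee_mapl : forall (Y Z Y' Z' : retr X) (f : rhom Y Y') (g : rhom Z Z')
    n (y : Y n),
    rmap (@bimap (R_ X) (R_ X) (R_ X) S Y Y' Z Z' f g) n (@vinl Y Z n y)
      = @vinl Y' Z' n (f n y);
  vee_mapr : forall (Y Z Y' Z' : retr X) (f : rhom Y Y') (g : rhom Z Z')
    n (z : Z n),
    rmap (@bimap (R_ X) (R_ X) (R_ X) S Y Y' Z Z' f g) n (@vinr Y Z n z)
      = @vinr Y' Z' n (g n z) }.

Record unit_spec (X : sabgroup) (I : retr X) := UnitSpec {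
  upt : forall n, I n;
  unit_ind : forall n (P : I n -> Prop),
    (forall x, P (sec I n x)) -> P (upt n) -> forall i, P i;
  act_upt : forall m n (h : delta m n), act h (upt n) = upt m;
  ret_upt : forall n, ret I n (upt n) = (0 : sab X n);
  upt_sec : forall n x, upt n <> sec I n x }.

Arguments spair_ind {X T} s [Y Z n] P h p : rename.
Arguments spair_collapsed {X T} s {Y Z n y z} c : rename.
Arguments vinl {X S} v {Y} Z {n} y : rename.
Arguments vinr {X S} v Y {Z n} z : rename.
Arguments vee_ind {X S} v [Y Z n] P hl hr p : rename.
Arguments unit_ind {X I} u [n] P hs hp i : rename.

(** * Symmetry, associativity and unit of the smash product *)

Section SmashIsos.
Variables (X : sabgroup) (T : functor (prod_cat (R_ X) (R_ X)) (R_ X)).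
Variable sm : smash_spec T.
Implicit Types Y Z W : retr X.
Local Notation "y ∧ z" := (spair sm y z) (at level 40, left associativity).

(** A section simplex is itself a pair, of [sec x] and [sec 0], and that pair is collapsed;
    [spair_eq] then forces any other representative to be collapsed. *)
Lemma spair_secP Y Z n (y : Y n) (z : Z n) x :
  y ∧ z = sec (T (Y, Z)) n x -> collapsed y z.
Proof.
move=> e; have : y ∧ z = sec Y n x ∧ sec Z n (0 : sab X n).
  rewrite e (spair_collapsed sm (collapsed_secl _ _ _)).
  by rewrite /retsum !retK addr0.
by move=> /spair_eq[[-> _]|[]//]; apply: collapsed_secl.
Qed.

Lemma spair_collapsed_eq Y Z n (y y' : Y n) (z z' : Z n) :
  collapsed y z -> collapsed y' z' -> retsum y z = retsum y' z' ->
    y ∧ z = y' ∧ z'.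
Proof. by move=> c c' e; rewrite !(spair_collapsed sm) // e. Qed.

(** Both bracketings collapse exactly the triples with some entry in a section; this is what makes
    the associator well defined. *)
Lemma collapsed_spairl Y Z W n (y : Y n) (z : Z n) (w : W n) :
  collapsed (y ∧ z) w <-> [\/ exists x, y = sec Y n x, exists x,
    z = sec Z n x | exists x, w = sec W n x].
Proof.
split=> [[[x /spair_secP[h|h]]|h]|[h|h|h]].
- exact: Or31.
- exact: Or32.
- exact: Or33.
- by left; exists (retsum y z); apply: spair_collapsed; left.
- by left; exists (retsum y z); apply: spair_collapsed; right.
- by right.
Qed.

Lemma collapsed_spairr Y Z W n (y : Y n) (z : Z n) (w : W n) :
  collapsed y (z ∧ w) <-> [\/ exists x, y = sec Y n x, exists x,
    z = sec Z n x | exists x, w = sec W n x].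
Proof.
split=> [[h|[x /spair_secP[h|h]]]|[h|h|h]].
- exact: Or31.
- exact: Or32.
- exact: Or33.
- by left.
- by right; exists (retsum z w); apply: spair_collapsed; left.
- by right; exists (retsum z w); apply: spair_collapsed; right.
Qed.

Lemma smash_surj Y Z n (p : T (Y, Z) n) : exists yz : Y n * Z n,
  p = yz.1 ∧ yz.2.
Proof. by elim/(spair_ind sm): p => y z; exists (y, z). Qed.

(** Evaluates on a chosen representing pair; [smash_elimE] gives the condition under which the
    choice does not matter. *)
Definition smash_elim Y Z n U (u : Y n -> Z n -> U) (p : T (Y, Z) n) : U :=
  let yz := projT1 (cid (smash_surj p)) in u yz.1 yz.2.

Lemma smash_elimE Y Z n U (u : Y n -> Z n -> U) :
  (forall y z y' z', collapsed y z -> collapsed y' z' ->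
    retsum y z = retsum y' z' ->
     u y z = u y' z') ->
  forall y z, smash_elim u (y ∧ z) = u y z.
Proof.
move=> uE y z; rewrite /smash_elim; case: cid => -[y' z'] /= e.
have := congr1 (ret (T (Y, Z)) n) e; rewrite !ret_spair => re.
by have [[-> ->]//|[c c']] := spair_eq e; exact: uE.
Qed.

Section Case.
Variables (Y Z W : retr X) (u : forall n, Y n -> Z n -> W n).
Hypothesis u_act : forall m n (h : delta m n) y z,
  u (act h y) (act h z) = act h (u y z).
Hypothesis u_ret : forall n (y : Y n) (z : Z n),
  ret W n (u y z) = retsum y z.
Hypothesis u_collapsed : forall n (y : Y n) (z : Z n), collapsed y z ->
  u y z = sec W n (retsum y z).

Lemma smash_case_elimE n y z : smash_elim (@u n) (y ∧ z) = u y z.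
Proof.
by apply: smash_elimE => a b a' b' c c' e; rewrite !u_collapsed // e.
Qed.

(** Universal property of the smash product: a compatible family on pairs that sends collapsed pairs
    to the section descends. *)
Lemma smash_case_subproof : exists f : rhom (T (Y, Z)) W,
  forall n y z, f n (y ∧ z) = u y z.
Proof.
unshelve eexists (@RHom X (T (Y, Z)) W (@SMap _ W (fun n => smash_elim (@u n))
  _) _ _).
- move=> m n h p; elim/(spair_ind sm): p => y z.
  by rewrite act_spair !smash_case_elimE u_act.
- move=> n p; elim/(spair_ind sm): p => y z.
  by rewrite ret_spair [LHS]/= smash_case_elimE u_ret.
- move=> n x.
  (* Adding 0 leaves [x] unchanged, so this collapsed pair represents the section simplex of [x]. *)
  have -> : sec (T (Y, Z)) n x = sec Y n x ∧ sec Z n (0 : sab X n).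
    by rewrite (spair_collapsed sm (collapsed_secl _ _ _)) /retsum !retK addr0.
  rewrite [LHS]/= smash_case_elimE u_collapsed; last exact: collapsed_secl.
  by rewrite /retsum !retK addr0.
- by move=> n y z; apply: smash_case_elimE.
Qed.

Definition smash_case : rhom (T (Y, Z)) W := projT1 (cid smash_case_subproof).

Lemma smash_caseE n (y : Y n) (z : Z n) : smash_case n (y ∧ z) = u y z.
Proof. by rewrite /smash_case; case: cid => f fE /=. Qed.

End Case.

Program Definition smash_symm_hom Y Z : rhom (T (Y, Z)) (T (Z, Y)) :=
  @smash_case Y Z (T (Z, Y)) (fun n y z => z ∧ y) _ _ _.
Next Obligation. by move=> Y Z m n h y z; rewrite act_spair. Qed.
Next Obligation. by move=> Y Z n y z; rewrite ret_spair /retsum addrC. Qed.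
Next Obligation.
move=> Y Z n y z /collapsed_sym c.
by rewrite (spair_collapsed sm c) /retsum addrC.
Qed.

Lemma smash_symm_homE Y Z n (y : Y n) (z : Z n) :
  smash_symm_hom Y Z n (y ∧ z) = z ∧ y.
Proof. exact: smash_caseE. Qed.

Program Definition smash_symm Y Z : @iso (R_ X) (T (Y, Z)) (T (Z, Y)) :=
  @Iso (R_ X) _ _ (smash_symm_hom Y Z) (smash_symm_hom Z Y) _ _.
Next Obligation.
by move=> Y Z; apply: rhom_ext => n; apply: (spair_ind sm) => y z;
  rewrite rhom_cmpE !smash_symm_homE.
Qed.
Next Obligation.
by move=> Y Z; apply: rhom_ext => n; apply: (spair_ind sm) => y z;
  rewrite rhom_cmpE !smash_symm_homE.
Qed.

Lemma smash_symmE Y Z n (y : Y n) (z : Z n) :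
  iso_fwd (smash_symm Y Z) n (y ∧ z) = z ∧ y.
Proof. exact: smash_symm_homE. Qed.

Section Assoc.
Variables Y Z W : retr X.

(** The inner pair is eliminated with [w] fixed; the outer elimination is left to [smash_case]. *)
Let u n (p : T (Y, Z) n) (w : W n) : T (Y, T (Z, W)) n :=
  smash_elim (fun y z => y ∧ (z ∧ w)) p.

Let uE n (y : Y n) (z : Z n) w : u (y ∧ z) w = y ∧ (z ∧ w).
Proof.
rewrite /u smash_elimE // => a b a' b' c c' e.
apply: spair_collapsed_eq.
- by apply/collapsed_spairr; case: c; [constructor 1|constructor 2].
- by apply/collapsed_spairr; case: c'; [constructor 1|constructor 2].
- by move: e; rewrite /retsum !ret_spair /retsum !addrA => ->.
Qed.

Program Definition smash_assoc_hom : rhom (T (T (Y, Z), W)) (T (Y, T (Z, W))) :=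
  @smash_case (T (Y, Z)) W (T (Y, T (Z, W))) u _ _ _.
Next Obligation.
move=> m n h p w; elim/(spair_ind sm): p => y z.
by rewrite act_spair !uE !act_spair.
Qed.
Next Obligation.
move=> n p w; elim/(spair_ind sm): p => y z.
by rewrite uE !ret_spair /retsum !ret_spair /retsum addrA.
Qed.
Next Obligation.
move=> n p w; elim/(spair_ind sm): p => y z c.
have {}c := (collapsed_spairl y z w).1 c.
rewrite uE (spair_collapsed sm); last exact/collapsed_spairr.
by rewrite /retsum !ret_spair /retsum addrA.
Qed.

Lemma smash_assoc_homE n (y : Y n) (z : Z n) (w : W n) :
  smash_assoc_hom n (y ∧ z ∧ w) = y ∧ (z ∧ w).
Proof. by rewrite /smash_assoc_hom smash_caseE uE. Qed.
End Assoc.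

Definition smash_map Y Z Y' Z' (f : rhom Y Y') (g : rhom Z Z') : rhom (T (Y, Z))
  (T (Y', Z')) :=
  @bimap (R_ X) (R_ X) (R_ X) T Y Y' Z Z' f g.

Lemma smash_mapE Y Z Y' Z' (f : rhom Y Y') (g : rhom Z Z') n (y : Y n) (z : Z n)
  :
  smash_map f g n (y ∧ z) = f n y ∧ g n z.
Proof. exact: bimap_spair. Qed.

(** The inverse is the forward associator with the factors reversed, conjugated by symmetries, which
    spares a second elimination. *)
Program Definition smash_assoc Y Z W : @iso (R_ X)
   (T (T (Y, Z), W)) (T (Y, T (Z, W))) :=
  @Iso (R_ X) _ _ (smash_assoc_hom Y Z W)
    (rhom_comp (smash_symm_hom W (T (Y, Z)))
      (rhom_comp (smash_map (rhom_id W) (smash_symm_hom Z Y))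
        (rhom_comp (smash_assoc_hom W Z Y)
          (rhom_comp (smash_map (smash_symm_hom Z W) (rhom_id Y))
            (smash_symm_hom Y (T (Z, W))))))) _ _.
Next Obligation.
move=> Y Z W; apply: rhom_ext => n; apply: (spair_ind sm) => p z;
  elim/(spair_ind sm): p => x y.
by do ?rewrite !(rhom_cmpE, rhom_compE, smash_assoc_homE, smash_symm_homE,
  smash_mapE, rhom_idE).
Qed.
Next Obligation.
move=> Y Z W; apply: rhom_ext => n; apply: (spair_ind sm) => z p;
  elim/(spair_ind sm): p => x y.
by do ?rewrite !(rhom_cmpE, rhom_compE, smash_assoc_homE, smash_symm_homE,
  smash_mapE, rhom_idE).
Qed.

Lemma smash_assocE Y Z W n (y : Y n) (z : Z n) (w : W n) :
  iso_fwd (smash_assoc Y Z W) n (y ∧ z ∧ w) = y ∧ (z ∧ w).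
Proof. exact: smash_assoc_homE. Qed.

Section Unit.
Variables (I : retr X) (un : unit_spec I).
Local Notation "∗" := (upt un _).

(** A simplex of [I] outside the section can only be the extra point, hence the default [v]. *)
Definition unit_elim n U (u : X n -> U) (v : U) (i : I n) : U :=
  if pselect (exists x, i = sec I n x) is left h then u (projT1 (cid h)) else v.

Lemma unit_elim_sec n U (u : X n -> U) v x : unit_elim u v (sec I n x) = u x.
Proof.
rewrite /unit_elim; case: pselect => [h|[]]; last by exists x.
by case: cid => x' /= /sec_inj ->.
Qed.

Lemma unit_elim_pt n U (u : X n -> U) v : unit_elim u v (upt un n) = v.
Proof. by rewrite /unit_elim; case: pselect => // h; exfalso; have [x /upt_sec]
  := h. Qed.

Program Definition smash_lunit_hom Y : rhom (T (I, Y)) Y :=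
  @smash_case I Y Y (fun n i y => unit_elim (fun x =>
    sec Y n (x + ret Y n y : sab X n)) y i) _ _ _.
Next Obligation.
move=> Y m n h i y; elim/(unit_ind un): i => [x|].
  by rewrite -sfun_act !unit_elim_sec -!sfun_act /= raddfD sfun_act.
by rewrite act_upt !unit_elim_pt.
Qed.
Next Obligation.
move=> Y n i y; elim/(unit_ind un): i => [x|].
  by rewrite unit_elim_sec /retsum !retK.
by rewrite unit_elim_pt /retsum ret_upt add0r.
Qed.
Next Obligation.
move=> Y n i y; elim/(unit_ind un): i => [x|].
  by rewrite unit_elim_sec /retsum !retK.
move=> [[x /upt_sec//]|[x ->]].
by rewrite unit_elim_pt /retsum ret_upt !retK add0r.
Qed.

Lemma smash_lunit_homE Y n (y : Y n) : smash_lunit_hom Y n (upt un n ∧ y) = y.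
Proof. by rewrite smash_caseE unit_elim_pt. Qed.

Program Definition smash_lunit_inv Y : rhom Y (T (I, Y)) :=
  @RHom X Y (T (I, Y)) (@SMap Y (T (I, Y)) (fun n y => upt un n ∧ y) _) _ _.
Next Obligation. by move=> Y m n h y; rewrite act_spair act_upt. Qed.
Next Obligation. by move=> Y n y; rewrite ret_spair /retsum ret_upt add0r. Qed.
Next Obligation.
move=> Y n y; rewrite [LHS]/= spair_collapsed; last exact: collapsed_secr.
by rewrite /retsum ret_upt add0r retK.
Qed.

Lemma smash_lunit_invE Y n (y : Y n) : smash_lunit_inv Y n y = upt un n ∧ y.
Proof. by []. Qed.

Program Definition smash_lunit Y : @iso (R_ X) (T (I, Y)) Y :=
  @Iso (R_ X) _ _ (smash_lunit_hom Y) (smash_lunit_inv Y) _ _.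
Next Obligation.
move=> Y; apply: rhom_ext => n; apply: (spair_ind sm) => i y;
  elim/(unit_ind un): i => [x|].
  rewrite rhom_cmpE rhom_idE (spair_collapsed sm (collapsed_secl _ _ _)).
  by rewrite !rmap_sec.
by rewrite rhom_cmpE smash_lunit_homE.
Qed.
Next Obligation.
by move=> Y; apply: rhom_ext => n y; rewrite rhom_cmpE smash_lunit_invE
  smash_lunit_homE.
Qed.

Lemma smash_lunitE Y n (y : Y n) : iso_fwd (smash_lunit Y) n (upt un n ∧ y) = y.
Proof. exact: smash_lunit_homE. Qed.

(** With the right unit defined through the symmetry, the axiom [symm_unit] holds by conversion. *)
Definition smash_runit Y : @iso (R_ X) (T (Y, I)) Y :=
  iso_comp (smash_lunit Y) (smash_symm Y I).

Lemma smash_runitE Y n (y : Y n) : iso_fwd (smash_runit Y) n (y ∧ upt un n) = y.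
Proof. by rewrite rhom_cmpE smash_symmE smash_lunitE. Qed.

End Unit.
End SmashIsos.

(** * Structure isomorphisms of the sum *)

Section VeeIsos.
Variables (X : sset) (S : functor (prod_cat (R_ X) (R_ X)) (R_ X)).
Variable ve : vee_spec S.
Implicit Types Y Z W : retr X.
Let O : retr X := zero_retr X.

(** [None] never occurs, since the two inclusions cover; the option only avoids asking for an
    element of [U]. *)
Definition vee_elim Y Z n U (u : Y n -> U) (v : Z n -> U) (p : S (Y, Z) n)
  : option U :=
  if pselect (exists y, p = vinl ve Z y) is left h then Some (u (projT1 (cid
    h)))
  else if pselect (exists z, p = vinr ve Y z)
    is left h then Some (v (projT1 (cid h)))
  else None.

Lemma vee_elim_inl Y Z n U (u : Y n -> U) (v : Z n -> U) y :
  vee_elim u v (vinl ve Z y) = Some (u y).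
Proof.
rewrite /vee_elim; case: pselect => [h|[]]; last by exists y.
by case: cid => y' /= /vinl_inj ->.
Qed.

(** The left inclusion is tested first, so a simplex in both summands, which must come from the
    section, is evaluated by [u]; hence the agreement hypothesis. *)
Lemma vee_elim_inr Y Z n U (u : Y n -> U) (v : Z n -> U) z :
  (forall x, u (sec Y n x) = v (sec Z n x)) ->
  vee_elim u v (vinr ve Y z) = Some (v z).
Proof.
move=> uv; rewrite /vee_elim; case: pselect => [h|_].
  by case: cid => y /= /esym/vinl_vinr[x -> ->]; rewrite uv.
case: pselect => [h|[]]; last by exists z.
by case: cid => z' /= /vinr_inj ->.
Qed.

Section Case.
Variables (Y Z W : retr X) (f : rhom Y W) (g : rhom Z W).

Lemma vee_case_subproof : exists h : rhom (S (Y, Z)) W,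
  (forall n y, h n (vinl ve Z y) = f n y) /\ (forall n z, h n (vinr ve Y z)
    = g n z).
Proof.
pose h n (p : S (Y, Z) n) : W n :=
  odflt (sec W n (ret (S (Y, Z)) n p)) (vee_elim (f n) (g n) p).
have hl n y : h n (vinl ve Z y) = f n y by rewrite /h vee_elim_inl.
have hr n z : h n (vinr ve Y z) = g n z.
  by rewrite /h vee_elim_inr // => x; rewrite !rmap_sec.
unshelve eexists (@RHom X (S (Y, Z)) W (@SMap _ W h _) _ _) => //.
- move=> m n k p; elim/(vee_ind ve): p => y.
    by rewrite act_vinl !hl sfun_act.
  by rewrite act_vinr !hr sfun_act.
- move=> n p; elim/(vee_ind ve): p => y /=.
    by rewrite hl ret_vinl rmap_ret.
  by rewrite hr ret_vinr rmap_ret.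
- by move=> n x; rewrite -(vinl_sec ve) [LHS]/= hl rmap_sec.
Qed.

Definition vee_case : rhom (S (Y, Z)) W := projT1 (cid vee_case_subproof).

Lemma vee_case_inl n y : vee_case n (vinl ve Z y) = f n y.
Proof. by rewrite /vee_case; case: cid => h [/= hl _]. Qed.

Lemma vee_case_inr n z : vee_case n (vinr ve Y z) = g n z.
Proof. by rewrite /vee_case; case: cid => h [/= _ hr]. Qed.

End Case.

Definition vinl_map Y Z : rhom Y (S (Y, Z)) :=
  @RHom X Y (S (Y, Z)) (@SMap Y (S (Y, Z)) (fun n => @vinl _ _ ve Y Z n)
    (fun m n h y => esym (act_vinl ve Z h y))) (@ret_vinl _ _ ve Y Z)
    (@vinl_sec _ _ ve Y Z).

Definition vinr_map Y Z : rhom Z (S (Y, Z)) :=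
  @RHom X Z (S (Y, Z)) (@SMap Z (S (Y, Z)) (fun n => @vinr _ _ ve Y Z n)
    (fun m n h z => esym (act_vinr ve Y h z))) (@ret_vinr _ _ ve Y Z)
    (@vinr_sec _ _ ve Y Z).

Lemma vinl_mapE Y Z n (y : Y n) : vinl_map Y Z n y = vinl ve Z y.
Proof. by []. Qed.

Lemma vinr_mapE Y Z n (z : Z n) : vinr_map Y Z n z = vinr ve Y z.
Proof. by []. Qed.

Definition caseE := (rhom_cmpE, rhom_compE, rhom_idE, vee_case_inl,
  vee_case_inr, vinl_mapE, vinr_mapE).

Program Definition from_zero (Y : retr X) : rhom O Y := @RHom X O Y (sec Y) _ _.
Next Obligation. by move=> Y n x; rewrite retK. Qed.
Next Obligation. by []. Qed.

Program Definition to_zero (Y : retr X) : rhom Y O := @RHom X Y O (ret Y) _ _.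
Next Obligation. by []. Qed.
Next Obligation. by move=> Y n x; rewrite /= retK. Qed.

Lemma from_zeroE Y n x : from_zero Y n x = sec Y n x. Proof. by []. Qed.

(** The zero object is terminal: compatibility with retractions determines a morphism to it. Every
    coherence condition with target zero follows. *)
Lemma to_zero_eq (Y : retr X) (f g : rhom Y O) : f = g.
Proof.
apply: rhom_ext => n y.
by have /= := rmap_ret f y; have /= := rmap_ret g y => -> ->.
Qed.

Program Definition vee_assoc (Y Z W : retr X) : @iso (R_ X)
    (S (S (Y, Z), W)) (S (Y, S (Z, W))) :=
  @Iso (R_ X) _ _
    (vee_case (vee_case (vinl_map Y (S (Z, W)))
       (rhom_comp (vinr_map Y (S (Z, W))) (vinl_map Z W)))
       (rhom_comp (vinr_map Y (S (Z, W))) (vinr_map Z W)))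
    (vee_case (rhom_comp (vinl_map (S (Y, Z)) W) (vinl_map Y Z))
       (vee_case (rhom_comp (vinl_map (S (Y, Z)) W) (vinr_map Y Z))
         (vinr_map (S (Y, Z)) W))) _ _.
Next Obligation.
move=> Y Z W; apply: rhom_ext => n; apply: (vee_ind ve) => y;
  first elim/(vee_ind ve): y => y; by rewrite !caseE.
Qed.
Next Obligation.
move=> Y Z W; apply: rhom_ext => n; apply: (vee_ind ve) => y;
  last elim/(vee_ind ve): y => y; by rewrite !caseE.
Qed.

Lemma vee_assocl Y Z W n (y : Y n) :
  iso_fwd (vee_assoc Y Z W) n (vinl ve W (vinl ve Z y)) = vinl ve (S (Z, W)) y.
Proof. by rewrite !caseE. Qed.

Lemma vee_assocm Y Z W n (z : Z n) :
  iso_fwd (vee_assoc Y Z W) n (vinl ve W (vinr ve Y z))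
    = vinr ve Y (vinl ve W z).
Proof. by rewrite !caseE. Qed.

Lemma vee_assocr Y Z W n (w : W n) :
  iso_fwd (vee_assoc Y Z W) n (vinr ve (S (Y, Z)) w) = vinr ve Y (vinr ve Z w).
Proof. by rewrite !caseE. Qed.

Lemma vee_assocVl Y Z W n (y : Y n) :
  iso_bwd (vee_assoc Y Z W) n (vinl ve (S (Z, W)) y) = vinl ve W (vinl ve Z y).
Proof. by rewrite !caseE. Qed.

Lemma vee_assocVm Y Z W n (z : Z n) :
  iso_bwd (vee_assoc Y Z W) n (vinr ve Y (vinl ve W z))
    = vinl ve W (vinr ve Y z).
Proof. by rewrite !caseE. Qed.

Lemma vee_assocVr Y Z W n (w : W n) :
  iso_bwd (vee_assoc Y Z W) n (vinr ve Y (vinr ve Z w)) = vinr ve (S (Y, Z)) w.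
Proof. by rewrite !caseE. Qed.

Program Definition vee_symm Y Z : @iso (R_ X) (S (Y, Z)) (S (Z, Y)) :=
  @Iso (R_ X) _ _ (vee_case (vinr_map Z Y) (vinl_map Z Y))
                  (vee_case (vinr_map Y Z) (vinl_map Y Z)) _ _.
Next Obligation.
by move=> Y Z; apply: rhom_ext => n; apply: (vee_ind ve) => y; rewrite !caseE.
Qed.
Next Obligation.
by move=> Y Z; apply: rhom_ext => n; apply: (vee_ind ve) => y; rewrite !caseE.
Qed.

Lemma vee_symml Y Z n (y : Y n) :
  iso_fwd (vee_symm Y Z) n (vinl ve Z y) = vinr ve Z y.
Proof. by rewrite !caseE. Qed.

Lemma vee_symmr Y Z n (z : Z n) :
  iso_fwd (vee_symm Y Z) n (vinr ve Y z) = vinl ve Y z.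
Proof. by rewrite !caseE. Qed.

Program Definition vee_lunit Y : @iso (R_ X) (S (O, Y)) Y :=
  @Iso (R_ X) _ _ (vee_case (from_zero Y) (rhom_id Y)) (vinr_map O Y) _ _.
Next Obligation.
move=> Y; apply: rhom_ext => n; apply: (vee_ind ve) => y; rewrite !caseE //.
by rewrite from_zeroE vinr_sec -(vinl_sec ve).
Qed.
Next Obligation. by move=> Y; apply: rhom_ext => n y; rewrite !caseE. Qed.

Program Definition vee_runit Y : @iso (R_ X) (S (Y, O)) Y :=
  @Iso (R_ X) _ _ (vee_case (rhom_id Y) (from_zero Y)) (vinl_map Y O) _ _.
Next Obligation.
move=> Y; apply: rhom_ext => n; apply: (vee_ind ve) => y; rewrite !caseE //.
by rewrite from_zeroE vinl_sec -(vinr_sec ve).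
Qed.
Next Obligation. by move=> Y; apply: rhom_ext => n y; rewrite !caseE. Qed.

Lemma vee_lunitl Y n (x : O n) : iso_fwd (vee_lunit Y) n (vinl ve Y x)
  = sec Y n x.
Proof. by rewrite !caseE. Qed.

Lemma vee_lunitr Y n (y : Y n) : iso_fwd (vee_lunit Y) n (vinr ve O y) = y.
Proof. by rewrite !caseE. Qed.

Lemma vee_runitl Y n (y : Y n) : iso_fwd (vee_runit Y) n (vinl ve O y) = y.
Proof. by rewrite !caseE. Qed.

Lemma vee_runitr Y n (x : O n) : iso_fwd (vee_runit Y) n (vinr ve Y x)
  = sec Y n x.
Proof. by rewrite !caseE. Qed.

End VeeIsos.

Definition veeE := (vee_assocl, vee_assocm, vee_assocr,
  vee_assocVl, vee_assocVm, vee_assocVr, vee_symml, vee_symmr,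
  vee_lunitl, vee_lunitr, vee_runitl, vee_runitr, vee_mapl, vee_mapr).

Definition smashE := (bimap_spair, smash_assocE, smash_symmE, smash_lunitE,
  smash_runitE).

(** * Distributivity, annihilation and the two monoidal structures *)

Section Isos.
Variables (X : sabgroup) (S T : functor (prod_cat (R_ X) (R_ X)) (R_ X)).
Variables (ve : vee_spec S) (sm : smash_spec T) (I : retr X) (un : unit_spec I).
Implicit Types Y Z W : retr X.
Let O : retr X := zero_retr X.

Section Distl.
Variables Y Z W : retr X.

Let u n (y : Y n) (p : S (Z, W) n) : S (T (Y, Z), T (Y, W)) n :=
  odflt (sec (S (T (Y, Z), T (Y, W))) n (retsum y p))
    (vee_elim ve (fun z => vinl ve (T (Y, W)) (spair sm y z))
       (fun w => vinr ve (T (Y, Z)) (spair sm y w)) p).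

Let ul n (y : Y n) z : u y (vinl ve W z) = vinl ve (T (Y, W)) (spair sm y z).
Proof. by rewrite /u vee_elim_inl. Qed.

Let ur n (y : Y n) w : u y (vinr ve Z w) = vinr ve (T (Y, Z)) (spair sm y w).
Proof.
rewrite /u vee_elim_inr // => x.
rewrite !(spair_collapsed sm (collapsed_secr _ _ _)) vinl_sec vinr_sec.
by rewrite /retsum !retK.
Qed.

Program Definition smash_distl_hom : rhom (T (Y, S (Z, W))) (S (T (Y, Z), T (Y,
  W))) :=
  @smash_case _ _ sm Y (S (Z, W)) (S (T (Y, Z), T (Y, W))) u _ _ _.
Next Obligation.
move=> m n h y p; elim/(vee_ind ve): p => z.
  by rewrite act_vinl !ul act_vinl act_spair.
by rewrite act_vinr !ur act_vinr act_spair.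
Qed.
Next Obligation.
move=> n y p; elim/(vee_ind ve): p => z.
  by rewrite ul ret_vinl ret_spair /retsum ret_vinl.
by rewrite ur ret_vinr ret_spair /retsum ret_vinr.
Qed.
Next Obligation.
move=> n y p c.
have h : exists z, spair sm y p = sec (T (Y, S (Z, W))) n z.
  by exists (retsum y p); apply: spair_collapsed.
elim/(vee_ind ve): p c {h} => z c.
- rewrite ul (spair_collapsed sm) ?vinl_sec /retsum ?ret_vinl //.
  case: c => [[x ->]|[x]]; first exact: collapsed_secl.
  by rewrite -(vinl_sec ve) => /vinl_inj ->; exact: collapsed_secr.
- rewrite ur (spair_collapsed sm) ?vinr_sec /retsum ?ret_vinr //.
  case: c => [[x ->]|[x]]; first exact: collapsed_secl.
  by rewrite -(vinr_sec ve) => /vinr_inj ->; exact: collapsed_secr.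
Qed.

Lemma smash_distl_homl n (y : Y n) z :
  smash_distl_hom n (spair sm y (vinl ve W z)) = vinl ve (T (Y, W))
    (spair sm y z).
Proof. by rewrite smash_caseE ul. Qed.

Lemma smash_distl_homr n (y : Y n) w :
  smash_distl_hom n (spair sm y (vinr ve Z w)) = vinr ve (T (Y, Z))
    (spair sm y w).
Proof. by rewrite smash_caseE ur. Qed.

End Distl.

(** The inverse is the canonical map out of the sum, induced by the two inclusions; only the forward
    map requires eliminating a pair. *)
Program Definition smash_distl Y Z W : @iso (R_ X) (T (Y, S (Z, W))) (S (T (Y,
  Z), T (Y, W))) :=
  @Iso (R_ X) _ _ (smash_distl_hom Y Z W)
    (vee_case ve (smash_map T (rhom_id Y) (vinl_map ve Z W))
       (smash_map T (rhom_id Y) (vinr_map ve Z W))) _ _.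
Next Obligation.
move=> Y Z W; apply: rhom_ext => n; apply: (spair_ind sm) => y p.
by elim/(vee_ind ve): p => z;
  rewrite rhom_cmpE (smash_distl_homl, smash_distl_homr) !(caseE, smash_mapE).
Qed.
Next Obligation.
move=> Y Z W; apply: rhom_ext => n; apply: (vee_ind ve) => p;
  elim/(spair_ind sm): p => y z;
  by rewrite !(caseE, smash_mapE) (smash_distl_homl, smash_distl_homr).
Qed.

Lemma smash_distll Y Z W n (y : Y n) (z : Z n) :
  iso_fwd (smash_distl Y Z W) n (spair sm y (vinl ve W z)) = vinl ve (T (Y, W))
    (spair sm y z).
Proof. exact: smash_distl_homl. Qed.

Lemma smash_distlr Y Z W n (y : Y n) (w : W n) :
  iso_fwd (smash_distl Y Z W) n (spair sm y (vinr ve Z w)) = vinr ve (T (Y, Z))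
    (spair sm y w).
Proof. exact: smash_distl_homr. Qed.

Lemma smash_distlVl Y Z W n (y : Y n) (z : Z n) :
  iso_bwd (smash_distl Y Z W) n (vinl ve (T (Y, W)) (spair sm y z))
    = spair sm y (vinl ve W z).
Proof. by rewrite !(caseE, smash_mapE). Qed.

Lemma smash_distlVr Y Z W n (y : Y n) (w : W n) :
  iso_bwd (smash_distl Y Z W) n (vinr ve (T (Y, Z)) (spair sm y w))
    = spair sm y (vinr ve Z w).
Proof. by rewrite !(caseE, smash_mapE). Qed.

Definition vee_map Y Z Y' Z' (f : rhom Y Y') (g : rhom Z Z') : rhom (S (Y, Z))
  (S (Y', Z')) :=
  @bimap (R_ X) (R_ X) (R_ X) S Y Y' Z Z' f g.

Lemma vee_mapEl Y Z Y' Z' (f : rhom Y Y') (g : rhom Z Z') n y :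
  vee_map f g n (vinl ve Z y) = vinl ve Z' (f n y).
Proof. exact: vee_mapl. Qed.

Lemma vee_mapEr Y Z Y' Z' (f : rhom Y Y') (g : rhom Z Z') n z :
  vee_map f g n (vinr ve Y z) = vinr ve Y' (g n z).
Proof. exact: vee_mapr. Qed.

Let distE := (smash_distll, smash_distlr, smash_distlVl, smash_distlVr,
  smash_symm_homE,
  vee_mapEl, vee_mapEr, rhom_cmpE, rhom_compE, rhom_idE).

Program Definition smash_distr Y Z W : @iso (R_ X) (T (S (Y, Z), W)) (S (T (Y,
  W), T (Z, W))) :=
  @Iso (R_ X) _ _
    (rhom_comp (vee_map (smash_symm_hom sm W Y) (smash_symm_hom sm W Z))
      (rhom_comp (iso_fwd (smash_distl W Y Z)) (smash_symm_hom sm (S (Y, Z))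
        W)))
    (rhom_comp (smash_symm_hom sm W (S (Y, Z)))
      (rhom_comp (iso_bwd (smash_distl W Y Z))
         (vee_map (smash_symm_hom sm Y W) (smash_symm_hom sm Z W)))) _ _.
Next Obligation.
move=> Y Z W; apply: rhom_ext => n; apply: (spair_ind sm) => p y.
by elim/(vee_ind ve): p => z; rewrite !distE.
Qed.
Next Obligation.
move=> Y Z W; apply: rhom_ext => n; apply: (vee_ind ve) => p;
  elim/(spair_ind sm): p => y z; by rewrite !distE.
Qed.

Lemma smash_distrl Y Z W n (y : Y n) (w : W n) :
  iso_fwd (smash_distr Y Z W) n (spair sm (vinl ve Z y) w) = vinl ve (T (Z, W))
    (spair sm y w).
Proof. by rewrite !distE. Qed.

Lemma smash_distrr Y Z W n (z : Z n) (w : W n) :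
  iso_fwd (smash_distr Y Z W) n (spair sm (vinr ve Y z) w) = vinr ve (T (Y, W))
    (spair sm z w).
Proof. by rewrite !distE. Qed.

Program Definition smash_annl Y : @iso (R_ X) (T (O, Y)) O :=
  @Iso (R_ X) _ _ (to_zero (T (O, Y))) (from_zero (T (O, Y))) _ _.
Next Obligation.
move=> Y; apply: rhom_ext => n; apply: (spair_ind sm) => x y.
rewrite (spair_collapsed sm) ?rmap_sec //; by left; exists x.
Qed.
Next Obligation. by move=> Y; apply: to_zero_eq. Qed.

Program Definition smash_annr Y : @iso (R_ X) (T (Y, O)) O :=
  @Iso (R_ X) _ _ (to_zero (T (Y, O))) (from_zero (T (Y, O))) _ _.
Next Obligation.
move=> Y; apply: rhom_ext => n; apply: (spair_ind sm) => y x.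
rewrite (spair_collapsed sm) ?rmap_sec //; by right; exists x.
Qed.
Next Obligation. by move=> Y; apply: to_zero_eq. Qed.

Lemma smash_annlE Y n (x : O n) (y : Y n) :
  iso_fwd (smash_annl Y) n (spair sm x y) = retsum x y.
Proof. exact: ret_spair. Qed.

Lemma smash_annrE Y n (y : Y n) (x : O n) :
  iso_fwd (smash_annr Y) n (spair sm y x) = retsum y x.
Proof. exact: ret_spair. Qed.

(** Morphisms agree on sections in any case, and every other simplex here pairs the extra point with
    some [y]. *)
Lemma smash_unitl_ext Y W (f g : rhom (T (I, Y)) W) :
  (forall n (y : Y n), f n (spair sm (upt un n) y) = g n (spair sm (upt un n)
    y)) -> f = g.
Proof.
move=> fg; apply: rhom_ext => n; apply: (spair_ind sm) => i y.
elim/(unit_ind un): i => [x|//].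
by rewrite (spair_collapsed sm (collapsed_secl _ _ _)) !rmap_sec.
Qed.

Lemma smash_unitr_ext Y W (f g : rhom (T (Y, I)) W) :
  (forall n (y : Y n), f n (spair sm y (upt un n))
    = g n (spair sm y (upt un n))) -> f = g.
Proof.
move=> fg; apply: rhom_ext => n; apply: (spair_ind sm) => y i.
elim/(unit_ind un): i => [x|//].
by rewrite (spair_collapsed sm (collapsed_secr _ _ _)) !rmap_sec.
Qed.

Definition vee_monoidal : symmetric_monoidal S O.
Proof.
refine (@SymmetricMonoidal (R_ X) S O (vee_assoc ve) (vee_lunit ve)
  (vee_runit ve)
  (vee_symm ve) _ _ _ _ _ _ _ _ _).
all: intros; apply: rhom_ext => n; do ?refine (vee_ind ve _ _ _); move=> y.
all: by rewrite !(rhom_cmpE, rhom_idE, veeE) ?rmap_sec ?vinr_sec ?vinl_sec.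
Defined.

Definition smash_monoidal : symmetric_monoidal T I.
Proof.
refine (@SymmetricMonoidal (R_ X) T I (smash_assoc sm) (smash_lunit sm un)
  (smash_runit sm un) (smash_symm sm) _ _ _ _ _ _ _ _ _).
- intros; apply: rhom_ext => n; apply: (spair_ind sm) => p z.
  by elim/(spair_ind sm): p => x y; rewrite !(rhom_cmpE, smashE).
- by intros; apply: smash_unitl_ext => n y; rewrite !(rhom_cmpE, rhom_idE,
  smashE).
- by intros; apply: smash_unitr_ext => n y; rewrite !(rhom_cmpE, rhom_idE,
  smashE).
- intros; apply: rhom_ext => n; apply: (spair_ind sm) => p z.
  by rewrite !(rhom_cmpE, smashE).
- intros; apply: rhom_ext => n; apply: (spair_ind sm) => p w.
  elim/(spair_ind sm): p => p z; elim/(spair_ind sm): p => x y.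
  by rewrite !(rhom_cmpE, rhom_idE, smashE).
- intros; apply: rhom_ext => n; apply: (spair_ind sm) => p z.
  elim/(spair_ind sm): p => y i; elim/(unit_ind un): i => [x|].
    rewrite (spair_collapsed sm (collapsed_secr _ _ _)).
    by rewrite (spair_collapsed sm (collapsed_secl _ _ _)) !rmap_sec.
  by rewrite !(rhom_cmpE, rhom_idE, smashE).
- intros; apply: rhom_ext => n; apply: (spair_ind sm) => y z.
  by rewrite !(rhom_cmpE, rhom_idE, smashE).
- by [].
- intros; apply: rhom_ext => n; apply: (spair_ind sm) => p z.
  by elim/(spair_ind sm): p => x y; rewrite !(rhom_cmpE, rhom_idE, smashE).
Defined.

End Isos.

(** * Laplaza's coherence conditions *)

Section Bimonoidal.
Variables (X : sabgroup) (S T : functor (prod_cat (R_ X) (R_ X)) (R_ X)).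
Variables (ve : vee_spec S) (sm : smash_spec T) (I : retr X) (un : unit_spec I).
Let O : retr X := zero_retr X.

Definition distE := (smash_distll, smash_distlr, smash_distrl, smash_distrr,
  smash_annlE, smash_annrE).

(** These projections are computed while everything is transparent; afterwards the structure maps
    are opaque and known only through their values on generators. *)
Lemma vee_monoidal_symm : symm (vee_monoidal ve) = vee_symm ve.
Proof. by []. Qed.

Lemma vee_monoidal_assoc : assoc (vee_monoidal ve) = vee_assoc ve.
Proof. by []. Qed.

Lemma vee_monoidal_lunit : lunit (vee_monoidal ve) = vee_lunit ve.
Proof. by []. Qed.

Lemma vee_monoidal_runit : runit (vee_monoidal ve) = vee_runit ve.
Proof. by []. Qed.

Lemma smash_monoidal_symm : symm (smash_monoidal sm un) = smash_symm sm.
Proof. by []. Qed.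

Lemma smash_monoidal_assoc : assoc (smash_monoidal sm un) = smash_assoc sm.
Proof. by []. Qed.

Lemma smash_monoidal_lunit : lunit (smash_monoidal sm un) = smash_lunit sm un.
Proof. by []. Qed.

Lemma smash_monoidal_runit : runit (smash_monoidal sm un) = smash_runit sm un.
Proof. by []. Qed.

Definition monE := (vee_monoidal_symm, vee_monoidal_assoc, vee_monoidal_lunit,
  vee_monoidal_runit, smash_monoidal_symm, smash_monoidal_assoc,
  smash_monoidal_lunit, smash_monoidal_runit).
Local Opaque vee_symm vee_assoc vee_lunit vee_runit smash_symm smash_assoc
  smash_lunit smash_runit smash_distl smash_distr smash_annl smash_annr
  vee_monoidal smash_monoidal.
Definition cohE := (rhom_cmpE, rhom_idE, veeE, smashE, distE).

Lemma smash_bimonoidal : symmetric_bimonoidal S O T I.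
Proof.
refine (@SymmetricBimonoidal (R_ X) S O T I (vee_monoidal ve)
  (smash_monoidal sm un)
  (smash_annl sm) (smash_annr sm) (smash_distl ve sm) (smash_distr ve sm)
   _ _ _ _ _ _ _ _ _ _ _ _ _ _ _ _ _ _ _ _ _ _ _ _ _ _ _ _).
all: intros; rewrite /middle_swap ?monE.
(* Conditions with target the zero object hold because it is terminal; the remaining ones start from
   a smash product and are tested on pairs. *)
all: try exact: to_zero_eq.
all: apply: rhom_ext => n; refine (spair_ind sm _ _) => p q.
- elim/(vee_ind ve): q => q; by rewrite !cohE.
- elim/(vee_ind ve): p => p; by rewrite !cohE.
- elim/(vee_ind ve): q => q; by rewrite !cohE.
- elim/(vee_ind ve): p => p; by rewrite !cohE.
- elim/(vee_ind ve): p => p; by rewrite !cohE.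
- do 2?[elim/(vee_ind ve): p => p]; by rewrite !cohE.
- do 2?[elim/(vee_ind ve): q => q]; by rewrite !cohE.
- elim/(spair_ind sm): p => p r; elim/(vee_ind ve): q => q; by rewrite !cohE.
- elim/(spair_ind sm): p => p r; elim/(vee_ind ve): p => p; by rewrite !cohE.
- elim/(spair_ind sm): p => p r; elim/(vee_ind ve): r => r; by rewrite !cohE.
- elim/(vee_ind ve): p => p; elim/(vee_ind ve): q => q; by rewrite !cohE.
- elim/(vee_ind ve): q => q; rewrite !cohE //.
  by rewrite (spair_collapsed sm (collapsed_secr _ _ _)) /retsum retK.
- elim/(vee_ind ve): p => p; rewrite !cohE //.
  by rewrite (spair_collapsed sm (collapsed_secl _ _ _)) /retsum retK.
- elim/(vee_ind ve): q => q; rewrite !cohE //.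
  by rewrite (spair_collapsed sm (collapsed_secr _ _ _)) /retsum retK.
- elim/(vee_ind ve): p => p; rewrite !cohE //.
  by rewrite (spair_collapsed sm (collapsed_secl _ _ _)) /retsum retK.
- elim/(unit_ind un): p => [x|].
    by rewrite (spair_collapsed sm (collapsed_secl _ _ _)) !rmap_sec.
  by elim/(vee_ind ve): q => q; rewrite !cohE.
- elim/(unit_ind un): q => [x|].
    by rewrite (spair_collapsed sm (collapsed_secr _ _ _)) !rmap_sec.
  by elim/(vee_ind ve): p => p; rewrite !cohE.
Qed.

End Bimonoidal.

(** * Simplices of smash products *)

Section PushoutElim.
Variables (A B C : sset) (f : smap A B) (g : smap A C) (n : nat).

(** Elimination into a bare type, without simplicial structure on the target; it serves to tell
    simplices of a pushout apart. *)
Definition po_elim (T : Type) (u : B n -> T) (v : C n -> T) :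
    pushout f g n -> T :=
  qlift (fun x : {classic (B n + C n)%type} =>
    match x with inl b => u b | inr c => v c end).

Section Elim.
Variables (T : Type) (u : B n -> T) (v : C n -> T).
Hypothesis uv : forall a, u (f n a) = v (g n a).

Let po_elimE x : po_elim u v (po_pi f g x) =
  match x with inl b => u b | inr c => v c end.
Proof.
rewrite /po_elim /po_pi qliftE // => {}x y [a [-> ->]].
exact: uv.
Qed.

Lemma po_elim_inl b : po_elim u v (po_inl f g n b) = u b.
Proof. exact: (po_elimE (inl b)). Qed.

Lemma po_elim_inr c : po_elim u v (po_inr f g n c) = v c.
Proof. exact: (po_elimE (inr c)). Qed.

End Elim.

Hypothesis finj : injective (f n).

(** Normal form: an element of the image of [f] is moved to its glued partner in [C]. The partner is
    unique by injectivity of [f], so normal forms decide equality in the pushout. *)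
Let nf_inl (b : B n) : B n + C n :=
  match pselect (exists a, b = f n a) with
  | left h => inr (g n (projT1 (cid h)))
  | right _ => inl b
  end.

Let nf_inl_im a : nf_inl (f n a) = inr (g n a).
Proof.
rewrite /nf_inl; case: pselect => [h|[]]; last by exists a.
by case: cid => a' /= /finj ->.
Qed.

Let nf_inl_nim b : ~ (exists a, b = f n a) -> nf_inl b = inl b.
Proof. by rewrite /nf_inl; case: pselect. Qed.

Lemma po_inr_inj : injective (po_inr f g n).
Proof.
move=> c c' /(congr1 (po_elim nf_inl inr)).
by rewrite !po_elim_inr // => -[].
Qed.

Lemma po_inl_eq b b' : po_inl f g n b = po_inl f g n b' ->
  b = b' \/ exists a a', [/\ b = f n a, b' = f n a' & g n a = g n a'].
Proof.
move=> /(congr1 (po_elim nf_inl inr)); rewrite !po_elim_inl //.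
have [[a ->]|nb] := pselect (exists a, b = f n a);
have [[a' ->]|nb'] := pselect (exists a, b' = f n a).
- by rewrite !nf_inl_im => -[gg]; right; exists a, a'.
- by rewrite nf_inl_im nf_inl_nim.
- by rewrite nf_inl_im nf_inl_nim.
- by rewrite !nf_inl_nim // => -[->]; left.
Qed.

Lemma po_inl_inr b c : po_inl f g n b = po_inr f g n c ->
  exists2 a, b = f n a & c = g n a.
Proof.
move=> /(congr1 (po_elim nf_inl inr)); rewrite !(po_elim_inl, po_elim_inr) //.
have [[a ->]|nb] := pselect (exists a, b = f n a).
  by rewrite nf_inl_im => -[<-]; exists a.
by rewrite nf_inl_nim.
Qed.

End PushoutElim.

Section Smash.
Variable X : sabgroup.
Implicit Types Y Z W : retr X.
Local Notation smash_ob Y Z := (fob (smash X) (Y, Z)).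

Definition smash_pair Y Z n (y : Y n) (z : Z n) : smash_ob Y Z n :=
  po_inl (sec (ext_smash_ob Y Z)) (mult X) n
    (po_inr (fat_wedge_ret Y Z) (fat_wedge_incl Y Z) n (y, z)).

Lemma smash_pair_collapsed Y Z n (y : Y n) (z : Z n) : collapsed y z ->
  smash_pair y z = sec (smash_ob Y Z) n (retsum y z).
Proof.
move=> yz; rewrite /smash_pair /=.
have -> : retsum y z = mult X n (ret Y n y, ret Z n z) by [].
rewrite -po_glue /=; congr (po_inl _ _ _ _).
case: yz => -[x ->]; rewrite !retK.
- have -> : (x, ret Z n z) = fat_wedge_ret Y Z n (po_inr _ _ n ((x, z)
  : sprod X Z n)).
    by rewrite /fat_wedge_ret po_case_inr.
  by rewrite po_glue /fat_wedge_incl po_case_inr.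
- have -> : (ret Y n y, x) = fat_wedge_ret Y Z n (po_inl _ _ n ((y, x)
  : sprod Y X n)).
    by rewrite /fat_wedge_ret po_case_inl.
  by rewrite po_glue /fat_wedge_incl po_case_inl.
Qed.

(** Simplices contributed by the base in either of the two pushouts are section simplices, and a
    section simplex is the pair of the sections of [x] and 0. *)
Lemma smash_pair_ind Y Z n (P : smash_ob Y Z n -> Prop) :
  (forall y z, P (smash_pair y z)) -> forall p, P p.
Proof.
move=> h; have hsec (x : X n) : P (sec (smash_ob Y Z) n x).
  have := h (sec Y n x) (sec Z n (0 : sab X n)).
  rewrite (smash_pair_collapsed (collapsed_secl _ _ _)).
  by rewrite /retsum !retK addr0.
apply: po_ind => [|x]; last exact: hsec.
apply: po_ind => [[x1 x2]|[y z]]; last exact: h.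
rewrite (_ : po_inl _ _ _ _ = sec (smash_ob Y Z) n (mult X n (x1, x2))) //.
exact: (@po_glue _ _ _ (sec (ext_smash_ob Y Z)) (mult X) n (x1, x2)).
Qed.

Lemma smash_pair_eq Y Z n (y y' : Y n) (z z' : Z n) :
  smash_pair y z = smash_pair y' z' ->
  (y = y' /\ z = z') \/ (collapsed y z /\ collapsed y' z').
Proof.
(* A complete invariant of the class: the image in [X] for a collapsed pair, the pair itself
   otherwise. It descends through the exterior smash product and then through the pushout along the
   multiplication. *)
pose u (y : Y n) (z : Z n) :=
  if pselect (collapsed y z) then inl (retsum y z) else inr (y, z).
have uE a b a' b' : collapsed a b -> collapsed a' b' ->
    retsum a b = retsum a' b' -> u a b = u a' b'.
  move=> c c'; rewrite /u.
  by case: pselect => // ?; case: pselect => // ? ->.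
have uw (w : fat_wedge Y Z n) :
    u (sec Y n (fat_wedge_ret Y Z n w).1) (sec Z n (fat_wedge_ret Y Z n w).2) =
    u (fat_wedge_incl Y Z n w).1 (fat_wedge_incl Y Z n w).2.
  elim/po_ind: w => -[a b]; rewrite /fat_wedge_ret /fat_wedge_incl
    !(po_case_inl, po_case_inr) /=; apply: uE; rewrite /retsum ?retK //;
    by [apply: collapsed_secl | apply: collapsed_secr].
pose v := @po_elim _ _ _ (fat_wedge_ret Y Z) (fat_wedge_incl Y Z) n _
  (fun x => u (sec Y n x.1) (sec Z n x.2)) (fun p => u p.1 p.2).
have vx (x : sprod X X n) : v (sec (ext_smash_ob Y Z) n x) =
    u (sec Y n (mult X n x)) (sec Z n (0 : sab X n)).
  rewrite /v po_elim_inl //; apply: uE; rewrite /retsum ?retK ?addr0 //;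
    exact: collapsed_secl.
move=> /(congr1 (@po_elim _ _ _ (sec (ext_smash_ob Y Z)) (mult X) n _ v
  (fun x => u (sec Y n x) (sec Z n (0 : sab X n))))).
rewrite !po_elim_inl // /v !po_elim_inr //= /u.
case: pselect => c; case: pselect => c' //; first by right.
by case=> -> ->; left.
Qed.

Definition smash_smash_spec : smash_spec (smash X).
Proof.
apply: (@SmashSpec X (smash X) smash_pair smash_pair_ind) => //.
- by move=> Y Z m n h y z; rewrite /smash_pair -!sfun_act.
- by move=> Y Z n y z; rewrite /= po_case_inl /= po_case_inr.
- exact: smash_pair_collapsed.
- exact: smash_pair_eq.
- by move=> Y Z Y' Z' f g n y z; rewrite /smash_pair /= po_map_inl /=
  po_map_inr.
Defined.

Definition vee_vee_spec : vee_spec (vee X).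
Proof.
apply: (@VeeSpec X (vee X) (fun Y Z => po_inl (sec Y) (sec Z)) (fun Y Z =>
  po_inr (sec Y) (sec Z))) => //.
- by move=> Y Z; exact: po_ind.
- by move=> Y Z m n h y; rewrite -sfun_act.
- by move=> Y Z m n h y; rewrite -sfun_act.
- by move=> Y Z n y; rewrite /= po_case_inl.
- by move=> Y Z n y; rewrite /= po_case_inr.
- by move=> Y Z n x; rewrite -po_glue.
- move=> Y Z n y y' /po_inl_eq[|//|[x [x' [-> ->]]]]; first exact: sec_inj.
  by move=> /sec_inj ->.
- by move=> Y Z n; apply: po_inr_inj; exact: sec_inj.
- by move=> Y Z n y z /po_inl_inr[|x -> ->]; [exact: sec_inj|exists x].
- by move=> Y Z Y' Z' f g n y; exact: po_map_inl.
- by move=> Y Z Y' Z' f g n y; exact: po_map_inr.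
Defined.

Definition unit_unit_spec : unit_spec (unit_retr X).
Proof.
apply: (@UnitSpec X (unit_retr X) (fun n => po_inr (zero_pt X)
  base_pt n false)).
- move=> n P h1 h2; apply: po_ind => [x|[]]; [exact: h1| |exact: h2].
  by rewrite -(@po_glue _ _ _ (zero_pt X) base_pt n tt); exact: h1.
- by move=> m n h; rewrite -sfun_act.
- by move=> n; rewrite /= po_case_inr.
- by move=> n x /esym/po_inl_inr[[] []|].
Defined.

End Smash.

(** * The simplex category and finiteness *)

Section Delta.

Lemma delta_mono m n (f : delta m n) (i j : 'I_m.+1) : (i <= j)%N ->
  (f i <= f j)%N.
Proof. by move=> ij; have := @omorph_le _ _ _ _ f i j; rewrite !leEord =>
  ->. Qed.

Lemma delta_ext m n (f g : delta m n) : f =1 g -> f = g.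
Proof.
case: f => f [[fP]]; case: g => g [[gP]] /= fg.
have e : f = g by apply/funext.
by case: _ / e gP => gP; rewrite (Prop_irrelevance fP gP).
Qed.

Lemma mk_delta_subproof m n (f : 'I_m.+1 -> 'I_n.+1) :
  (forall i j : 'I_m.+1, (i <= j)%N -> (f i <= f j)%N) ->
  {homo f : x y / (x <= y)%O >-> (x <= y)%O}.
Proof. by move=> fP i j; rewrite !leEord => /fP. Qed.

Definition mk_delta m n (f : 'I_m.+1 -> 'I_n.+1)
    (fP : forall i j : 'I_m.+1, (i <= j)%N -> (f i <= f j)%N) : delta m n :=
  HB.pack f (Order.isOrderMorphism.Build _ _ _ _ f (mk_delta_subproof fP)).

Lemma mk_deltaE m n (f : 'I_m.+1 -> 'I_n.+1) fP i : @mk_delta m n f fP i = f i.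
Proof. by []. Qed.

Lemma delta_compE l m n (g : delta m n) (f : delta l m)
  i : delta_comp g f i = g (f i).
Proof. by []. Qed.

Lemma finite_delta m n : finite_set [set: delta m n].
Proof.
pose F (f : delta m n) : {ffun 'I_m.+1 -> 'I_n.+1} := [ffun i => f i].
rewrite -[X in finite_set X](preimage_setT F).
apply: finite_preimage; last first.
  exact: (@finite_finset {ffun 'I_m.+1 -> 'I_n.+1}).
move=> f g _ _ fg; apply: delta_ext => i.
by have /ffunP/(_ i) := fg; rewrite !ffunE.
Qed.

Definition surj_delta m n (f : delta m n) := forall j, exists i, f i = j.

(** The list [s] holds the image in increasing order; [h] records the position of a value in it and
    [d] reads the value back. *)
Lemma epi_mono n k (f : delta n k) : exists m (h : delta n m) (d : delta m k),
  [/\ surj_delta h, injective d & f = delta_comp d h].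
Proof.
pose s := [seq j <- enum 'I_k.+1 | j \in codom f].
have us : uniq s by rewrite filter_uniq // enum_uniq.
have ss : sorted ltn (map val s).
  rewrite sorted_map; apply: sorted_filter; first by move=> a b c /=;
    apply: ltn_trans.
  by have := iota_ltn_sorted 0 k.+1; rewrite -val_enum_ord sorted_map.
have fs i : f i \in s by rewrite mem_filter codom_f mem_enum.
have s0 : (0 < size s)%N by case: (s) (fs ord0).
pose m := (size s).-1; have sm : size s = m.+1 by rewrite /m prednK.
have hm i : (index (f i) s < m.+1)%N by rewrite -sm index_mem.
pose h (i : 'I_n.+1) : 'I_m.+1 := Ordinal (hm i).
pose d (j : 'I_m.+1) : 'I_k.+1 := nth ord0 s j.
have dlt (i j : 'I_m.+1) : (i < j)%N -> (d i < d j)%N.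
  move=> ij; have := sorted_ltn_nth ltn_trans 0%N ss.
  move=> /(_ i j); rewrite !inE !size_map sm !ltn_ord => /(_ isT isT ij).
  by rewrite !(nth_map ord0) ?sm.
have dP (i j : 'I_m.+1) : (i <= j)%N -> (d i <= d j)%N.
  by rewrite leq_eqVlt => /predU1P[/val_inj -> //|/dlt/ltnW].
have dh i : d (h i) = f i by rewrite /d /h /= nth_index.
have hP (i j : 'I_n.+1) : (i <= j)%N -> (h i <= h j)%N.
  move=> ij; rewrite leqNgt; apply/negP => /dlt; rewrite !dh ltnNge.
  by rewrite delta_mono.
exists m, (mk_delta hP), (mk_delta dP); split.
- move=> j; have /codomP[i ji] : d j \in codom f.
    by have := mem_nth ord0 (n := j) (s := s); rewrite sm ltn_ord => /(_ isT);
      rewrite mem_filter => /andP[].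
  exists i; apply: val_inj; rewrite /= -ji /d index_uniq ?sm //.
- move=> i j /= dij; apply: val_inj => /=.
  by case: (ltngtP i j) => // /dlt; rewrite dij ltnn.
- by apply: delta_ext => i; rewrite delta_compE /= dh.
Qed.

Lemma surj_delta_leq m n (f : delta m n) : surj_delta f -> (n <= m)%N.
Proof.
move=> fs; have := fintype.leq_image_card f 'I_m.+1; rewrite card_ord.
suff -> : #|fintype.image f 'I_m.+1| = n.+1 by [].
rewrite -[RHS](card_ord n.+1); apply: eq_card => j.
by have [i <-] := fs j; rewrite codom_f inE.
Qed.

Lemma inj_delta_leq m n (f : delta m n) : injective f -> (m <= n)%N.
Proof. by move=> /leq_card; rewrite !card_ord. Qed.

(** A surjective self-map of a finite chain is injective, hence strictly increasing, and then has no
    room to move any point. *)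
Lemma surj_delta_inj n (f : delta n n) : surj_delta f -> f = delta_id n.
Proof.
move=> fs.
have finj : injective f.
  apply/injectiveP; rewrite /injectiveb /dinjectiveb; apply/card_uniqP.
  rewrite size_map -cardE; apply: eq_card => j.
  by have [i <-] := fs j; rewrite [RHS]inE map_f ?mem_enum.
have flt (i j : 'I_n.+1) : (i < j)%N -> (f i < f j)%N.
  move=> ij; rewrite ltn_neqAle delta_mono ?(ltnW ij) // andbT.
  by apply/eqP => /val_inj/finj e; rewrite e ltnn in ij.
(* A strictly increasing map gains at least 1 per step. Run from [i] up to [n] this gives
   [f i <= i]; run from 0 to [i] it gives the converse. *)
have fD (i : 'I_n.+1) k (h : (i + k < n.+1)%N) : (f i + k <= f (Ordinal h))%N.
  elim: k h => [|k IH] h; first by rewrite addn0; apply: delta_mono;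
    rewrite /= addn0.
  have h' : (i + k < n.+1)%N by apply: leq_trans h; rewrite addnS ltnS leqW.
  by rewrite addnS; apply: leq_ltn_trans (IH h') _; apply: flt;
    rewrite /= addnS.
apply: delta_ext => i; apply/val_inj/eqP; rewrite eqn_leq; apply/andP; split =>
  /=.
  have hi : (i + (n - i) < n.+1)%N by rewrite subnKC // -ltnS.
  have := fD i (n - i)%N hi; have := ltn_ord (f (Ordinal hi)); rewrite ltnS =>
    h1 h2.
  have := leq_trans h2 h1; move: (f i) => a.
  have /subnKC e : (i <= n)%N by rewrite -ltnS.
  by rewrite -[X in (_ <= X)%N]e leq_add2r.
have h0 : (@ord0 n + i < n.+1)%N by rewrite /= add0n.
have := fD ord0 i h0; rewrite (_ : Ordinal h0 = i); last by apply: val_inj;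
  rewrite /= add0n.
by move=> h; apply: leq_trans h; apply: leq_addl.
Qed.

End Delta.

Section Sections.

(** Any choice of preimages is monotone because [f] is; the preimage of [f i] may be chosen freely,
    so the section can pass through [i]. *)
Lemma surj_delta_section n k (f : delta n k) i : surj_delta f ->
  exists d : delta k n, delta_comp f d = delta_id k /\ d (f i) = i.
Proof.
move=> fs; pose d j := if j == f i then i else projT1 (cid (fs j)).
have fd j : f (d j) = j.
  by rewrite /d; case: eqP => [->//|_]; case: cid.
have dP (a b : 'I_k.+1) : (a <= b)%N -> (d a <= d b)%N.
  rewrite leq_eqVlt => /predU1P[/val_inj -> //|ab].
  rewrite leqNgt; apply/negP => /ltnW/(delta_mono f); rewrite !fd.
  by rewrite leqNgt ab.
exists (mk_delta dP); split; first by apply: delta_ext => j; exact: fd.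
by rewrite /= /d eqxx.
Qed.

(** In the epi-mono factorization, an injection between chains of equal size would be onto and make
    [f] onto. *)
Lemma nonsurj_delta_factor n k (f : delta n k) : ~ surj_delta f ->
  exists m (h : delta n m) (d : delta m k), (m < k)%N /\ f = delta_comp d h.
Proof.
move=> nf; have [m [h [d [hs di e]]]] := epi_mono f.
exists m, h, d; split=> //; rewrite ltn_neqAle (inj_delta_leq di) andbT.
apply/eqP => mk; subst m; apply: nf => j.
have [i ij] : exists i, d i = j.
  by have /bij_inj := injF_bij di; have [g _ gK] := injF_bij di; exists (g j).
by have [l li] := hs i; exists l; rewrite e -ij -li.
Qed.

End Sections.

(** * Eilenberg-Zilber decomposition of simplices *)

Section Skeleta.
Variable V : sset.

(** Uniqueness half of the Eilenberg-Zilber lemma. A section [d] of [f] gives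
    [x = act (delta_comp g d) y], and this composite must be the identity, or [x] would come from a
    lower dimension. Sections through every [i] then yield [f = g]. *)
Lemma nondeg_act_unique n k (f g : delta n k) (x y : V k) :
  (forall (z : V k), z = x \/ z = y -> forall m (h : delta k m) (w : V m),
    (m < k)%N -> z <> act h w) ->
  surj_delta f -> surj_delta g -> act f x = act g y -> f = g /\ x = y.
Proof.
move=> nd fs gs e.
have key i : exists d : delta k n, [/\ delta_comp f d = delta_id k,
  delta_comp g d = delta_id k & d (f i) = i].
  have [d [fd di]] := surj_delta_section i fs; exists d; split => //.
  apply: surj_delta_inj; apply: contrapT => /nonsurj_delta_factor[m [h [c [mk
    gd]]]].
  have xE : x = act h (act c y).
    by rewrite -act_comp -gd act_comp -e -act_comp fd act_id.
  exact: (nd x (or_introl erefl) m h (act c y) mk xE).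
split.
  apply: delta_ext => i; have [d [_ gd di]] := key i.
  have : delta_comp g d (f i) = f i by rewrite gd.
  by rewrite delta_compE di => ->.
have [d [fd gd _]] := key ord0.
by rewrite -(act_id x) -fd act_comp e -act_comp gd act_id.
Qed.

End Skeleta.

Section Degenerate.
Variable V : sset.

Lemma act_surj_degenerate n m (f : delta n m) (x : V n) :
  surj_delta f -> m <> n -> (exists y, x = act f y) -> degenerate x.
Proof.
move=> fs /eqP mn [y ->]; exists m, f, y; split=> //.
by rewrite ltn_neqAle mn (surj_delta_leq fs).
Qed.

(** Existence half of the Eilenberg-Zilber lemma, by induction on the dimension. *)
Lemma nondegenerate_repr n (x : V n) : exists m (h : delta n m) (y : V m),
  [/\ surj_delta h, ~ degenerate y & x = act h y].
Proof.
elim/ltn_ind: n x => n IH x.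
have [[m [f [y [mn fs ->]]]]|nd] := pselect (degenerate x); last first.
  by exists n, (delta_id n), x; split => // [j|]; [exists j|rewrite act_id].
have [k [h [z [hs nz ->]]]] := IH m mn y.
exists k, (delta_comp h f), z; split => //; last by rewrite act_comp.
by move=> j; have [i <-] := hs j; have [l <-] := fs i; exists l.
Qed.

(** Factor [e] as an epi followed by a mono: [x] is the image under the epi of a face of itself, and
    the epi lowers the dimension, since otherwise it would be the identity and [e] injective. *)
Lemma act_fixed_degenerate n (x : V n) (e : delta n n) :
  ~ injective e -> x = act e x -> degenerate x.
Proof.
move=> einj xe; have [m [h [d [hs di eE]]]] := epi_mono e.
apply: (act_surj_degenerate hs); last by exists (act d x);
  rewrite -act_comp -eE.
move=> mn; subst m; apply: einj => i j.
by rewrite eE !delta_compE => /di; rewrite (surj_delta_inj hs).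
Qed.

End Degenerate.

(** * Finiteness of smash products *)

Section Finite.
Variables (X : sabgroup) (T : functor (prod_cat (R_ X) (R_ X)) (R_ X)).
Variable sm : smash_spec T.
Implicit Types Y Z W : retr X.

(** The formula is the idempotent operator that merges the vertices from [i] to [j] into [i]. *)
Lemma merge_subproof n (i j : 'I_n.+1) (a b : 'I_n.+1) : (a <= b)%N ->
  ((if (i < a <= j)%N then i else a) <= (if (i < b <= j)%N then i else b))%N.
Proof.
case: ifP => [/andP[ia aj]|/negbT]; case: ifP => [/andP[ib bj]|_] //.
  by move=> ab; apply: ltnW; apply: leq_trans ab.
rewrite negb_and -leqNgt -ltnNge => /orP[//|ja] ab.
by have := leq_trans ja (leq_trans ab bj); rewrite ltnn.
Qed.

(** Pigeonhole: with more vertices than pairs of values, some [i < j] agree under both [f] and [g],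
    which are then constant between them by monotonicity. Merging this interval fixes the pair but
    is not injective. *)
Lemma nondegenerate_pair Y Z n m k (f : delta n m) (g : delta n k) (y : Y m)
  (z : Z k) :
  ~ degenerate (spair sm (act f y) (act g z)) -> (n < m.+1 * k.+1)%N.
Proof.
move=> nd; rewrite -ltnS -[n.+1]card_ord -(card_ord m.+1) -(card_ord k.+1)
  -card_prod.
rewrite ltnS.
apply: (@leq_card _ _ (fun i => (f i, g i))) => i j [fij gij].
wlog ij : i j fij gij / (i < j)%N.
  move=> w; case: (ltngtP i j) => [/w->//|/w-> //|/val_inj//].
exfalso; apply: nd.
pose e := mk_delta (@merge_subproof n i j).
have eK p (h : delta n p) : h i = h j -> delta_comp h e = h.
  move=> hij; apply: delta_ext => a; rewrite delta_compE mk_deltaE.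
  case: ifP => // /andP[/ltnW ia aj]; apply/val_inj/eqP => /=.
  by rewrite eqn_leq delta_mono //= hij delta_mono.
apply: (@act_fixed_degenerate _ _ _ e).
  move=> /(_ i j); rewrite !mk_deltaE ltnn ij leqnn /= => /(_ erefl) e'.
  by rewrite e' ltnn in ij.
by rewrite act_spair -!act_comp !eK.
Qed.

Lemma finite_smash Y Z : finite_retr Y -> finite_retr Z -> finite_retr (T (Y,
  Z)).
Proof.
rewrite /finite_retr => fY fZ.
set DY := (X in finite_set X) in fY; set DZ := (X in finite_set X) in fZ.
pose F (yz : {n & Y n} * {n & Z n}) n
  (fg : delta n (projT1 yz.1) * delta n (projT1 yz.2)) : {n & T (Y, Z) n} :=
  existT (fun n => T (Y, Z) n) n
    (spair sm (act fg.1 (projT2 yz.1)) (act fg.2 (projT2 yz.2))).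
apply: (@sub_finite_set _ _ (\bigcup_(yz in DY `*` DZ)
   \bigcup_(n in `I_((projT1 yz.1).+1 * (projT1 yz.2).+1))
     [set F yz n fg | fg in setT])%classic); last first.
  apply: bigcup_finite => [|yz _]; first exact: finite_setX.
  apply: bigcup_finite => [|n _]; first exact: finite_II.
  apply: finite_image; rewrite -setXTT; apply: finite_setX; exact: finite_delta.
move=> [n p] /=; elim/(spair_ind sm): p => y z [nsec nd].
have [m [f [y' [fs ndy ey]]]] := nondegenerate_repr y.
have [k [g [z' [gs ndz ez]]]] := nondegenerate_repr z.
(* Neither representative lies in a section, since otherwise the pair would be collapsed. *)
exists (existT _ m y', existT _ k z').
  split; split => //= x e.
  - apply: (nsec (retsum y z)); apply: spair_collapsed; left.
    by exists (@act X n m f x); rewrite ey e sfun_act.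
  - apply: (nsec (retsum y z)); apply: spair_collapsed; right.
    by exists (@act X n k g x); rewrite ez e sfun_act.
exists n; last by exists (f, g) => //; rewrite /F /= ey ez.
by move: nd; rewrite ey ez => /nondegenerate_pair.
Qed.

End Finite.

(** * Pushouts *)

Section LevelPushout.
Variable X : sset.

(** A pushout of sets in every dimension. This form has no simplicial test objects, so it can be
    checked on pairs, whereas the universal property in [Rf] quantifies over finite objects. *)
Record level_pushout (A B C D : retr X) (f : rhom A B) (g : rhom A C)
    (i : rhom B D) (j : rhom C D) : Prop := LevelPushout {
  lpo_comm : forall n a, i n (f n a) = j n (g n a);
  lpo_cover : forall n d, (exists b, d = i n b) \/ (exists c, d = j n c);
  lpo_elim : forall n (U : Type) (u : B n -> U) (v : C n -> U),
    (forall a, u (f n a) = v (g n a)) ->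
    exists w : D n -> U, (forall b, w (i n b) = u b) /\ (forall c, w (j n c)
      = v c) }.

Section Explicit.
Variables (A B C : retr X) (f : rhom A B) (g : rhom A C).

Lemma po_retr_subproof n (a : A n) : ret B n (f n a) = ret C n (g n a).
Proof. by rewrite !rmap_ret. Qed.

Program Definition po_retr : retr X :=
  @Retr X (pushout f g) (po_case po_retr_subproof) (smap_comp (po_inl f g)
    (sec B)) _.
Next Obligation. by move=> n x; rewrite /= po_case_inl retK. Qed.

Program Definition po_retr_inl : rhom B po_retr :=
  @RHom X B po_retr (po_inl f g) _ _.
Next Obligation. by move=> n b; rewrite /= po_case_inl. Qed.
Next Obligation. by []. Qed.

Program Definition po_retr_inr : rhom C po_retr :=
  @RHom X C po_retr (po_inr f g) _ _.
Next Obligation. by move=> n b; rewrite /= po_case_inr. Qed.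
Next Obligation.
by move=> n x; rewrite /= -(rmap_sec g) -(rmap_sec f) po_glue.
Qed.

(** Allows the explicit pushout to serve as a test object in [Rf]. *)
Lemma finite_po_retr : finite_retr B -> finite_retr C -> finite_retr po_retr.
Proof.
rewrite /finite_retr => fB fC.
set DB := (X in finite_set X) in fB; set DC := (X in finite_set X) in fC.
pose FB (b : {n & B n}) : {n & po_retr n} := existT (fun n => po_retr n)
  (projT1 b) (po_inl f g _ (projT2 b)).
pose FC (b : {n & C n}) : {n & po_retr n} := existT (fun n => po_retr n)
  (projT1 b) (po_inr f g _ (projT2 b)).
apply: (@sub_finite_set _ _ ([set FB b | b in DB]
  `|` [set FC c | c in DC])%classic); last first.
  by rewrite finite_setU; split; apply: finite_image.
have nd (V : retr X) (h : rhom V po_retr) n (x : V n) : ~ degenerate (h n x) ->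
  ~ degenerate x.
  by move=> H [m [k [y [mn ks e]]]]; apply: H; exists m, k, (h m y); split;
    rewrite // e sfun_act.
move=> [n p] /=; elim/po_ind: p => b [nsec ndeg].
- left; exists (existT _ n b) => //; split => /= [x e|];
  last exact: (nd _ po_retr_inl).
  by apply: (nsec x); rewrite /= e.
- right; exists (existT _ n b) => //; split => /= [x e|];
  last exact: (nd _ po_retr_inr).
  by apply: (nsec x); rewrite /= in e *; rewrite e;
    exact: (rmap_sec po_retr_inr x).
Qed.

End Explicit.

(** The universal property, tested on the finite explicit pushout, gives [psi]; the canonical map
    [phi] back is a left inverse of [psi]. That suffices to transport covering and elimination from
    the explicit pushout. *)
Lemma is_pushout_level (a b c d : Rf X) (f : Defs.hom a b) (g : Defs.hom a c)
    (i : Defs.hom b d) (j : Defs.hom c d) :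
  is_pushout f g i j -> @level_pushout (sval a) (sval b) (sval c) (sval d)
    f g i j.
Proof.
move=> [comm univ].
have comm' n x : (i : rhom (sval b) (sval d)) n ((f : rhom (sval a) (sval b))
  n x) =
    (j : rhom (sval c) (sval d)) n ((g : rhom (sval a) (sval c)) n x).
  by have := congr1 (fun h : rhom (sval a) (sval d) => h n x) comm.
pose p : Rf X := exist _ (po_retr f g) (@finite_po_retr (sval a) (sval b)
  (sval c) f g (svalP b) (svalP c)).
have [|psi [[psii psij] _]] := univ p (po_retr_inl f g) (po_retr_inr f g).
  by apply: rhom_ext => n x; rewrite /= po_glue.
pose phim : smap (pushout _ _) (sval d) := po_case comm'.
have [phi phiE] : exists phi : rhom (po_retr f g) (sval d), rmap phi = phim.
  unshelve eexists (@RHom X (po_retr f g) (sval d) phim _ _) => //.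
  - move=> n; apply: po_ind => y; rewrite /phim /=.
      by rewrite !po_case_inl rmap_ret.
    by rewrite !po_case_inr rmap_ret.
  - by move=> n x; rewrite /phim /= po_case_inl rmap_sec.
have phipsi n y : phi n ((psi : rhom (sval d) (po_retr f g)) n y) = y.
  (* Uniqueness for the cocone of [d] itself identifies the composite with the identity. *)
  have [w [_ wu]] := univ d i j comm.
  have e1 : w = idm d by apply: wu; split; apply: cmp_idl.
  have e2 : w = (@cmp (Rf X) d p d phi psi).
    apply: wu; split; rewrite -cmp_assoc ?psii ?psij; apply: rhom_ext => m z.
      by rewrite rhom_compE phiE /phim po_case_inl.
    by rewrite rhom_compE phiE /phim po_case_inr.
  have := congr1 (fun h : rhom (sval d) (sval d) => h n y) e2.
  by rewrite e1 => /esym.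
split=> //.
- move=> n y; have := phipsi n y.
  move: (rmap (psi : rhom _ (po_retr f g)) n y); apply: po_ind => z <-;
    rewrite phiE /phim.
    by left; exists z; rewrite po_case_inl.
  by right; exists z; rewrite po_case_inr.
- move=> n U u v uv; exists (fun y => po_elim u v ((psi : rhom _ (po_retr f g))
  n y)); split => z.
  + have -> : (psi : rhom _ (po_retr f g)) n ((i : rhom _ _) n z)
    = po_inl f g n z.
      exact: (congr1 (fun h : rhom (sval b) (po_retr f g) => h n z) psii).
    by rewrite po_elim_inl.
  + have -> : (psi : rhom _ (po_retr f g)) n ((j : rhom _ _) n z)
    = po_inr f g n z.
      exact: (congr1 (fun h : rhom (sval c) (po_retr f g) => h n z) psij).
    by rewrite po_elim_inr.
Qed.

Lemma level_is_pushout (a b c d : Rf X) (f : Defs.hom a b) (g : Defs.hom a c)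
    (i : Defs.hom b d) (j : Defs.hom c d) :
  @level_pushout (sval a) (sval b) (sval c) (sval d) f g i j ->
    is_pushout f g i j.
Proof.
move=> L; split; first by apply: rhom_ext => n x; exact: lpo_comm L _ _.
move=> e u v uv.
have uv' n x : (u : rhom (sval b) (sval e)) n ((f : rhom (sval a) (sval b)) n x)
  =
    (v : rhom (sval c) (sval e)) n ((g : rhom (sval a) (sval c)) n x).
  by have := congr1 (fun h : rhom (sval a) (sval e) => h n x) uv.
pose w n := projT1 (cid (lpo_elim L (u := rmap (u : rhom _ _) n) (v :=
  rmap (v : rhom _ _) n) (uv' n))).
have wi n x : w n ((i : rhom _ _) n x) = (u : rhom _ _) n x by rewrite /w;
  case: cid => ? [].
have wj n x : w n ((j : rhom _ _) n x) = (v : rhom _ _) n x by rewrite /w;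
  case: cid => ? [].
have [h hE] : exists h : rhom (sval d) (sval e), forall n y, h n y = w n y.
  unshelve eexists (@RHom X (sval d) (sval e) (@SMap _ _ w _) _ _) => //.
  - move=> m n k y; have [[x ->]|[x ->]] := lpo_cover L y.
      by rewrite -sfun_act !wi sfun_act.
    by rewrite -sfun_act !wj sfun_act.
  - move=> n y /=; have [[x ->]|[x ->]] := lpo_cover L y.
      by rewrite wi !rmap_ret.
    by rewrite wj !rmap_ret.
  - by move=> n x /=; rewrite -(rmap_sec (i : rhom _ _)) wi rmap_sec.
exists h; split.
  by split; apply: rhom_ext => n x; rewrite rhom_compE hE ?wi ?wj.
move=> h' [hi hj]; apply: rhom_ext => n y; rewrite hE.
have [[x ->]|[x ->]] := lpo_cover L y.
- by rewrite wi -hi.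
- by rewrite wj -hj.
Qed.

End LevelPushout.

(** * Smash products preserve injections and pushouts *)

Section SmashExact.
Variables (X : sabgroup) (T : functor (prod_cat (R_ X) (R_ X)) (R_ X)).
Variable sm : smash_spec T.
Implicit Types Y Z W : retr X.

(** Injective morphisms reflect sections: if [f y] is a section simplex, it is also the image of
    one. So collapsed images come from collapsed pairs, which are determined by their image in
    [X]. *)
Lemma smash_map_inj Y Z Y' Z' (f : rhom Y Y') (g : rhom Z Z') :
  injective_smap f -> injective_smap g -> injective_smap (smash_map T f g).
Proof.
move=> finj ginj n p q; elim/(spair_ind sm): p => y z; elim/(spair_ind sm): q =>
  y' z'.
rewrite !(smash_mapE sm) => e.
have col a b : collapsed (f n a) (g n b) -> collapsed a b.
  by case=> -[x ex]; [left|right]; exists x; [apply: finj|apply: ginj];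
    rewrite rmap_sec.
have := congr1 (ret (T (Y', Z')) n) e; rewrite !ret_spair /retsum !rmap_ret =>
  re.
have [[/finj -> /ginj ->]//|[/col c /col c']] := spair_eq e.
exact: (spair_collapsed_eq sm c c' re).
Qed.

(** Elimination takes place in the first variable for each fixed [z]; the values descend because on
    collapsed pairs they depend only on the image in [X]. *)
Lemma smash_level_pushout_l (A B C D W : retr X) (f : rhom A B) (g : rhom A C)
    (i : rhom B D) (j : rhom C D) :
  level_pushout f g i j ->
  level_pushout (smash_map T f (rhom_id W)) (smash_map T g (rhom_id W))
                (smash_map T i (rhom_id W)) (smash_map T j (rhom_id W)).
Proof.
move=> L; split.
- move=> n p; elim/(spair_ind sm): p => a z.
  by rewrite !(smash_mapE sm) (lpo_comm L).
- move=> n p; elim/(spair_ind sm): p => d z; have [[b ->]|[c ->]] :=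
  lpo_cover L d.
    by left; exists (spair sm b z); rewrite (smash_mapE sm).
  by right; exists (spair sm c z); rewrite (smash_mapE sm).
- move=> n U u v uv.
  have uvz z a : u (spair sm (f n a) z) = v (spair sm (g n a) z).
    by have := uv (spair sm a z); rewrite !(smash_mapE sm).
  pose w z := projT1 (cid (lpo_elim L (u := fun b => u (spair sm b z))
    (v := fun c => v (spair sm c z)) (uvz z))).
  have wi z b : w z (i n b) = u (spair sm b z) by rewrite /w; case: cid => ? [].
  have wj z c : w z (j n c) = v (spair sm c z) by rewrite /w; case: cid => ? [].
  (* The two candidates agree on the section, because its simplices come from the smash product of
     [A] with [W]. *)
  have uvs s : u (sec (T (B, W)) n s) = v (sec (T (C, W)) n s).
    by have := uv (sec (T (A, W)) n s); rewrite !rmap_sec.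
  have wc d z : collapsed d z -> w z d = u (sec (T (B, W)) n (retsum d z)).
    case=> -[x ->].
      rewrite -(rmap_sec i) wi (spair_collapsed sm (collapsed_secl _ _ _)).
      by rewrite /retsum rmap_ret.
    have [[b ->]|[c ->]] := lpo_cover L d.
      by rewrite wi (spair_collapsed sm (collapsed_secr _ _ _))
        /retsum rmap_ret.
    by rewrite wj (spair_collapsed sm (collapsed_secr _ _ _))
      /retsum rmap_ret uvs.
  have wE d z : smash_elim sm (fun d z => w z d) (spair sm d z) = w z d.
    by apply: smash_elimE => {}d {}z d' z' c c' e; rewrite !wc // e.
  exists (smash_elim sm (fun d z => w z d)); split => p.
    by elim/(spair_ind sm): p => b z; rewrite (smash_mapE sm) wE wi.
  by elim/(spair_ind sm): p => c z; rewrite (smash_mapE sm) wE wj.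
Qed.

Lemma smash_level_pushout_r (A B C D W : retr X) (f : rhom A B) (g : rhom A C)
    (i : rhom B D) (j : rhom C D) :
  level_pushout f g i j ->
  level_pushout (smash_map T (rhom_id W) f) (smash_map T (rhom_id W) g)
                (smash_map T (rhom_id W) i) (smash_map T (rhom_id W) j).
Proof.
move=> /(@smash_level_pushout_l _ _ _ _ W) L.
have symK Y Z n p : smash_symm_hom sm Y Z n (smash_symm_hom sm Z Y n p) = p.
  by elim/(spair_ind sm): p => y z; rewrite !smash_symm_homE.
have nat Y Z (h : rhom Y Z) n p : smash_map T h (rhom_id W)
  n (smash_symm_hom sm W Y n p) =
    smash_symm_hom sm W Z n (smash_map T (rhom_id W) h n p).
  by elim/(spair_ind sm): p => y z; rewrite !(smash_mapE sm, smash_symm_homE).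
have nat' Y Z (h : rhom Y Z) n p : smash_map T (rhom_id W)
  h n (smash_symm_hom sm Y W n p) =
    smash_symm_hom sm Z W n (smash_map T h (rhom_id W) n p).
  by elim/(spair_ind sm): p => y z; rewrite !(smash_mapE sm, smash_symm_homE).
split.
- move=> n p; rewrite -(symK A W n p) !nat'.
  by rewrite (lpo_comm L).
- move=> n p; have [[b e]|[c e]] := lpo_cover L (smash_symm_hom sm _ _ n p).
    by left; exists (smash_symm_hom sm _ _ n b); rewrite nat' -e symK.
  by right; exists (smash_symm_hom sm _ _ n c); rewrite nat' -e symK.
- move=> n U u v uv.
  have [p|w [wi wj]] := lpo_elim L (u := u \o smash_symm_hom sm _ _ n) (v :=
    v \o smash_symm_hom sm _ _ n).
    by rewrite /= -!nat' uv.
  exists (w \o smash_symm_hom sm _ _ n); split => p /=.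
    by rewrite -nat wi /= symK.
  by rewrite -nat wj /= symK.
Qed.

End SmashExact.

Local Open Scope classical_set_scope.

(** * Geometric realization *)

Section TopologyLemmas.

Lemma cts_comp (S T U : topologicalType) (f : S -> T) (g : T -> U) :
  continuous f -> continuous g -> continuous (fun s => g (f s)).
Proof. by move=> cf cg s; apply: (@continuous_comp _ _ _ f g);
  [exact: cf|exact: cg]. Qed.

Lemma cts_pair (S T U : topologicalType) (f : S -> T) (g : S -> U) :
  continuous f -> continuous g -> continuous (fun s => (f s, g s)).
Proof. by move=> cf cg s; apply: cvg_pair; [exact: cf|exact: cg]. Qed.

Lemma cts_id (S : topologicalType) : continuous (fun s : S => s).
Proof. by move=> s; exact: cvg_id. Qed.

Lemma cts_cst (S T : topologicalType) (t : T) : continuous (fun _ : S => t).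
Proof. by move=> s; exact: cvg_cst. Qed.

Lemma cts_fst (S T : topologicalType) : continuous (@fst S T).
Proof. by move=> s; exact: cvg_fst. Qed.

Lemma cts_snd (S T : topologicalType) : continuous (@snd S T).
Proof. by move=> s; exact: cvg_snd. Qed.

(** Pasting lemma for finitely many closed sets; each piece is a restriction of a globally
    continuous map, which avoids subspace topologies. *)
Lemma continuous_closed_cover (S T : topologicalType) (I : choiceType)
  (D : set I)
    (C : I -> set S) (F : S -> T) (G : I -> S -> T) :
  finite_set D -> (forall i, D i -> closed (C i)) ->
  (forall s, exists2 i, D i & C i s) ->
  (forall i, D i -> continuous (G i)) -> (forall i s, D i -> C i s ->
    F s = G i s) ->
  continuous F.
Proof.
move=> finD clC cov cG FG; apply/continuous_closedP => A cA.
have -> : F @^-1` A = \bigcup_(i in D) (C i `&` G i @^-1` A).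
  apply/seteqP; split => [s /= As|s /= [i Di [Cs]] /=].
    by have [i Di Cs] := cov s; exists i => //; split => //=; rewrite -FG.
  by rewrite (FG i).
apply: closed_bigcup => // i Di; apply: closedI; first exact: clC.
by have /continuous_closedP := cG i Di; apply.
Qed.

(** Local compactness in the form of a base of compact neighbourhoods, as needed for products with
    quotient maps. *)
Definition compactly_based (K : topologicalType) := forall (k : K) (U : set K),
  nbhs k U -> exists C, [/\ nbhs k C, compact C & C `<=` U].

(** Tube lemma: an open condition stays open when quantified over a compact set. *)
Lemma tube (S K T : topologicalType) (F : S * K -> T) (C : set K) (U : set T) :
  compact C -> open U -> continuous F ->
  open [set s | forall k, C k -> U (F (s, k))].
Proof.
move=> /compact_near_coveringP cC oU cF; rewrite openE => s0 /= Us0.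
apply: (cC S (nbhs s0) (fun s k => U (F (s, k)))) => k Ck /=.
have : nbhs (s0, k) (F @^-1` U).
  by apply: cF; apply: open_nbhs_nbhs; split => //; apply: Us0.
case=> -[A B] /= [nA nB] AB; exists (B, A) => //= -[k' s] /= [Bk As].
exact: (AB (s, k')).
Qed.

Lemma compactly_based_prod (K L : topologicalType) :
  compactly_based K -> compactly_based L -> compactly_based (K * L)%type.
Proof.
move=> cK cL [k l] U [[A B] /= [nA nB] AB].
have [C [nC cC CA]] := cK k A nA; have [D [nD cD DB]] := cL l B nB.
exists (C `*` D); split; [by exists (C, D)|exact: compact_setX|].
by move=> [k' l'] /= [/CA ? /DB ?]; apply: AB.
Qed.

Lemma compactly_based_real (R : realType) : compactly_based R.
Proof.
move=> x U /nbhs_ballP[e /= e0 eU].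
exists `[x - e / 2, x + e / 2]; split.
- apply/nbhs_ballP; exists (e / 2); first by rewrite /= divr_gt0.
  move=> y; rewrite /ball /= in_itv /= => /ltW.
  by rewrite distrC ler_distl => /andP[-> ->].
- exact: segment_compact.
- move=> y; rewrite /= in_itv /= => /andP[h1 h2]; apply: eU; rewrite /ball /=.
  rewrite distrC; apply: (@le_lt_trans _ _ (e / 2));
    first by rewrite ler_distl h1 h2.
  by rewrite ltr_pdivrMr // ltr_pMr // ltr1n.
Qed.

End TopologyLemmas.

(** * Topological simplices *)

Section Simplex.
Variable R : realType.
Local Notation simplex := (simplex R).

Definition coord n (t : simplex n) (i : 'I_n.+1) : R := (\val t : 'rV[R]_n.+1)
  ord0 i.

Lemma coord_ge0 n (t : simplex n) i : 0 <= coord t i.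
Proof. by case: t => t tP; have [h _] := set_mem tP; apply: h. Qed.

Lemma sum_coord n (t : simplex n) : \sum_i coord t i = 1.
Proof. by case: t => t tP; have [_ <-] := set_mem tP. Qed.

Lemma coord_inj n (t u : simplex n) : coord t =1 coord u -> t = u.
Proof. by move=> tu; apply/val_inj/rowP => i; exact: tu. Qed.

Lemma mk_simplex_subproof n (u : 'I_n.+1 -> R) : (forall i, 0 <= u i) ->
  \sum_i u i = 1 ->
  \row_i u i \in @simplex_set R n.
Proof.
move=> u0 u1; apply/mem_set; split => [i|]; first by rewrite mxE.
by rewrite -u1; apply: eq_bigr => i _; rewrite mxE.
Qed.

Definition mk_simplex n (u : 'I_n.+1 -> R) u0 u1 : simplex n :=
  exist (fun u => u \in @simplex_set R n) _ (@mk_simplex_subproof n u u0 u1).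

Lemma coord_mk n (u : 'I_n.+1 -> R) u0 u1 i : coord (@mk_simplex n u u0 u1)
  i = u i.
Proof. by rewrite /coord mxE. Qed.

Lemma coord_push m n (f : delta m n) (t : simplex m) j :
  coord (simplex_push f t) j = \sum_(i | f i == j) coord t i.
Proof. by rewrite /coord mxE. Qed.

Lemma continuous_coord n (i : 'I_n.+1) : continuous (fun t : simplex n =>
  coord t i).
Proof.
have h : continuous (fun M : 'rV[R]_n.+1 => M ord0 i)
  by exact: coord_continuous.
have hv : continuous (fun t : simplex n => (\val t : 'rV[R]_n.+1))
  by exact: initial_continuous.
by move=> t; exact: (continuous_comp (hv t) (h _)).
Qed.

Lemma simplex_continuous (S : topologicalType) n (f : S -> simplex n) :
  (forall i, continuous (fun s => coord (f s) i)) -> continuous f.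
Proof.
move=> fc; apply: continuous_comp_initial => s U /= [P nP PU].
have h : \forall s' \near s, forall i, P ord0 i (coord (f s') i).
  by apply: filter_forall => i; apply: (fc i); apply: nP.
apply: filterS h => s' h; apply: PU => i j; rewrite (ord1 i); exact: h.
Qed.

Lemma cts_sum (S : topologicalType) (I : finType) (P : pred I) (f : I -> S -> R)
  :
  (forall i, P i -> continuous (f i)) -> continuous (fun s => \sum_(i | P i)
    f i s).
Proof.
move=> fc; rewrite (_ : (fun _ => _) = (fun s => \sum_(i <- index_enum I | P i)
  f i s)) //.
elim: (index_enum I) => [|i r IH].
  rewrite (_ : (fun _ => _) = fun=> 0); first exact: cts_cst.
  by apply/funext => s; rewrite big_nil.
have [Pi|nPi] := boolP (P i).
  rewrite (_ : (fun _ => _) = (fun s => f i s + \sum_(i <- r | P i) f i s)).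
    by move=> s; apply: cvgD; [exact: fc|exact: IH].
  by apply/funext => s; rewrite big_cons Pi.
rewrite (_ : (fun _ => _) = (fun s => \sum_(i <- r | P i) f i s)) //.
by apply/funext => s; rewrite big_cons (negbTE nPi).
Qed.

Lemma simplex_push_continuous m n (f : delta m n) :
  continuous (simplex_push f : simplex m -> simplex n).
Proof.
apply: simplex_continuous => j; under eq_fun do rewrite coord_push.
by apply: cts_sum => i _; exact: continuous_coord.
Qed.

Lemma closed_simplex_set n : closed (@simplex_set R n).
Proof.
have cc i : continuous (fun M : 'rV[R]_n.+1 => M ord0 i)
  by exact: coord_continuous.
rewrite (_ : @simplex_set R n = (\bigcap_(i in [set: 'I_n.+1])
    (fun M : 'rV[R]_n.+1 => M ord0 i) @^-1` [set x | 0 <= x]) `&`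
    (fun M : 'rV[R]_n.+1 => \sum_i M ord0 i) @^-1` [set x | x = 1]).
  apply: closedI.
    apply: closed_bigI => i _; apply: preimage_closed; last exact: closed_ge.
    by move=> x _; exact: cc.
  apply: preimage_closed; last exact: closed_eq.
  by move=> x _; apply: cts_sum => i _; exact: cc.
apply/seteqP; split=> t [t0 t1].
- by split=> // i _; exact: t0.
- by split=> // i; exact: (t0 i Logic.I).
Qed.

Lemma compact_simplex_set n : compact (@simplex_set R n).
Proof.
have c : compact [set v : 'rV[R]_n.+1 | forall i, `[0, 1]%classic (v ord0 i)].
  by apply: (@rV_compact R n.+1 (fun=> `[0, 1]%classic)) => i;
    exact: segment_compact.
apply: subclosed_compact (@closed_simplex_set n) c _.
move=> t [t0 t1] i /=; rewrite in_itv /= t0 -t1 (bigD1 i) //= lerDl.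
by apply: sumr_ge0 => j _; exact: t0.
Qed.

Lemma compact_simplex n : compact [set: simplex n].
Proof.
move=> F PF _; pose v (t : simplex n) : 'rV[R]_n.+1 := \val t.
have [|a [Aa clA]] := @compact_simplex_set n (v @ F) _.
  have -> : (v @ F) (@simplex_set R n) = F setT; last exact: filterT.
  by congr F; apply/seteqP; split => // -[t tA] _; exact: set_mem tA.
exists (exist _ a (mem_set Aa)); split=> // B U FB [_ [/= [O oO <-] Oa] OU].
have FvB : (v @ F) [set v t | t in B].
  suff h : F (v @^-1` (v @` B)) by [].
  by apply: filterS FB => t Bt; exists t.
have [_ [[t Bt <-] Ot]] := clA _ _ FvB (open_nbhs_nbhs (conj oO Oa)).
by exists t; split => //; apply: OU.
Qed.

Lemma hausdorff_simplex n : hausdorff_space (simplex n).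
Proof.
move=> p q pq; apply: val_inj; apply: (@norm_hausdorff R 'rV[R]_n.+1) =>
  A B nA nB.
have hv : continuous (fun t : simplex n => (\val t : 'rV[R]_n.+1))
  by exact: initial_continuous.
have [t [At Bt]] := pq _ _ (hv p A nA) (hv q B nB).
by exists (\val t).
Qed.

Lemma compactly_based_simplex n : compactly_based (simplex n).
Proof.
move=> t U nU.
have [V nV VU] := compact_regular (@hausdorff_simplex n) (@compact_simplex n)
  filterT nU.
exists (closure V); split=> //.
  by apply: filterS nV; exact: subset_closure.
by apply: subclosed_compact (@compact_simplex n) _ => //; exact: closed_closure.
Qed.

End Simplex.

Local Open Scope classical_set_scope.

(** * Points and continuity on the realization *)

Section Realization.
Variable R : realType.
Local Notation simplex := (simplex R).
Local Notation "⟦ X ⟧" := (realization R X) (at level 0, format "⟦ X ⟧").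
Implicit Types X Y : sset.

Definition pt X n (x : X n) (t : simplex n) : ⟦X⟧ := qpi (@cell_rel R X)
  (cell x t).

Lemma pt_ind X (P : ⟦X⟧ -> Prop) : (forall n (x : X n) t, P (pt x t)) ->
  forall p, P p.
Proof. by move=> h; apply: quot_ind => -[n [x t]]; exact: (h n x t). Qed.

Lemma pt_act X m n (f : delta m n) (x : X n) (t : simplex m) :
  pt (act f x) t = pt x (simplex_push f t).
Proof. by apply/qpiP/Relation_Operators.rst_step; exists m, n, f, x, t. Qed.

Section Lift.
Variables (X : sset) (T : Type) (F : forall n, X n -> simplex n -> T).
Hypothesis FE : forall m n (f : delta m n) (x : X n) (t : simplex m),
  F (act f x) t = F x (simplex_push f t).

Definition rlift : ⟦X⟧ -> T :=
  qlift (fun u : cells R X => F (projT2 u).1 (projT2 u).2).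

Lemma rlift_pt n (x : X n) t : rlift (pt x t) = F x t.
Proof.
rewrite /rlift /pt qliftE // => u v [m [k [f [y [s [-> ->]]]]]].
exact: FE.
Qed.

End Lift.

Lemma realization_map_pt X Y (f : smap X Y) n (x : X n) t :
  realization_map f (pt x t) = pt (f n x) t.
Proof. exact: realization_mapE. Qed.

Lemma realization_open X (V : set ⟦X⟧) :
  (forall n (x : X n), open [set t | V (pt x t)]) -> open V.
Proof.
move=> oV; rewrite /open /= /quotient_open; apply/sigT_openP => n.
rewrite openE => -[x t] /= Vxt.
exists ([set x], [set t | V (pt x t)]) => /=.
  split; first exact: discrete_set1.
  by apply: open_nbhs_nbhs; split; [exact: oV|].
by move=> [x' t'] /= [-> //].
Qed.

Lemma realization_continuous X (T : topologicalType) (F : ⟦X⟧ -> T) :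
  (forall n (x : X n), continuous (fun t => F (pt x t))) -> continuous F.
Proof.
move=> cF; apply/continuousP => A oA; apply: realization_open => n x.
by have /continuousP := cF n x; apply.
Qed.

Lemma pt_continuous X n (x : X n) : continuous (fun t : simplex n => pt x t).
Proof.
have c1 : continuous (\pi_(quot (@cell_rel R X)) : cells R X ->
  ⟦X⟧)%qT by exact: pi_continuous.
have c2 : continuous (fun t : simplex n => cell x t).
  apply: (cts_comp (f := fun t : simplex n =>
    ((x : discrete_topology {classic X n}), t))).
    by apply: cts_pair; [exact: cts_cst|exact: cts_id].
  exact: existT_continuous.
exact: (cts_comp c2 c1).
Qed.

(** A quotient map times the identity of a locally compact space is again a
    quotient map, so continuity can be tested cell by cell. *)
Lemma realization_continuous2 X (K T : topologicalType) (F : ⟦X⟧ * K -> T) :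
  compactly_based K ->
  (forall n (x : X n), continuous (fun tk : simplex n * K => F (pt x tk.1,
    tk.2))) ->
  continuous F.
Proof.
move=> bK cF [q k] U' /=.
rewrite nbhsE /= => -[U [oU UF] UU'].
elim/pt_ind: q UF => n x t UF.
have ck : continuous (fun k => F (pt x t, k)).
  apply: (cts_comp (f := fun k : K => (t, k)) _ (cF n x)).
  by apply: cts_pair; [exact: cts_cst|exact: cts_id].
have [C [nC cC CU]] := bK k ((fun k => F (pt x t, k)) @^-1` U)
  (ck k U (open_nbhs_nbhs (conj oU UF))).
exists ([set q | forall k, C k -> U (F (q, k))], C) => /=; last first.
  by move=> [q l] /= [h Cl]; apply/UU'/h.
split; last exact: nC.
suff oV : open [set q | forall k, C k -> U (F (q, k))].
  by apply: (open_nbhs_nbhs (conj oV _)) => l /CU.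
by apply: realization_open => m y; exact: (tube cC oU (cF m y)).
Qed.

Lemma realization_map_continuous X Y (f : smap X Y)
  : continuous (@realization_map R _ _ f).
Proof.
apply: realization_continuous => n x; rewrite (_ : (fun _ => _) = pt (f n x)).
  exact: pt_continuous.
by apply/funext => t; rewrite realization_map_pt.
Qed.

End Realization.

(** * Realization of products *)

Section Supports.
Variable R : realType.
Local Notation simplex := (simplex R).

(** Each [l] goes to the largest element of [S] not above it, or to the least element [b] of [S] if
    there is none; the bound [maxn l b] covers both cases. *)
Lemma retract_on k (S : pred 'I_k.+1) (s0 : 'I_k.+1) : S s0 ->
  exists e : delta k k, (forall l, S (e l)) /\ (forall l, S l -> e l = l).
Proof.
move=> Ss0.
case: (@arg_minnP _ s0 S val Ss0) => b Sb bmin.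
have bP l : S b && (b <= maxn l b)%N by rewrite Sb leq_maxr.
pose e (l : 'I_k.+1) := [arg max_(i > b | S i && (i <= maxn l b)%N) (i : nat)].
have eP (l : 'I_k.+1) : [/\ S (e l), (e l <= maxn l b)%N & forall i : 'I_k.+1,
  S i -> (i <= maxn l b)%N -> (i <= e l)%N].
  rewrite /e; case: (@arg_maxnP _ b (fun i => S i && (i <= maxn l b)%N)
    val (bP l)) => i /andP[Si il] imax.
  by split => // j Sj jl; apply: imax; rewrite Sj.
have emono (i j : 'I_k.+1) : (i <= j)%N -> (e i <= e j)%N.
  move=> ij; have [Sei ei _] := eP i; have [_ _ ej] := eP j; apply: ej => //.
  by apply: leq_trans ei _; rewrite geq_max leq_maxr leq_max ij.
exists (mk_delta emono); split => l; first by have [] := eP l.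
move=> Sl; apply/val_inj/eqP; rewrite /= eqn_leq; have [Sel el eM] := eP l.
rewrite eM ?leq_maxl // andbT; apply: leq_trans el _.
by rewrite geq_max leqnn bmin.
Qed.

Lemma simplex_push_eq m n (f g : delta m n) (t : simplex m) :
  (forall i, 0 < coord t i -> f i = g i) -> simplex_push f t = simplex_push g t.
Proof.
move=> fg; apply: coord_inj => j; rewrite !coord_push big_mkcond [RHS]big_mkcond
  /=.
apply: eq_bigr => i _; have := coord_ge0 t i; rewrite le_eqVlt =>
  /predU1P[<-|/fg -> //].
by rewrite !if_same.
Qed.

Lemma simplex_push_id m (t : simplex m) : simplex_push (delta_id m) t = t.
Proof. by apply: coord_inj => j; rewrite coord_push big_pred1_eq. Qed.

Lemma simplex_push_comp l m n (g : delta m n) (f : delta l m) (t : simplex l) :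
  simplex_push (delta_comp g f) t = simplex_push g (simplex_push f t).
Proof.
apply: coord_inj => j; rewrite !coord_push.
rewrite (partition_big (fun i => f i) (fun a => g a == j)) //=.
apply: eq_bigr => a /eqP ga; rewrite coord_push; apply: eq_bigl => i.
by rewrite andbC; case: eqP => [->|] //; rewrite ga eqxx.
Qed.

Lemma supp_nonempty n (t : simplex n) : exists i, 0 < coord t i.
Proof.
apply: contrapT => /forallNP h; have := sum_coord t.
rewrite big1 => [/esym/eqP|i _]; first by rewrite oner_eq0.
by apply/eqP; rewrite eq_le coord_ge0 andbT leNgt; apply/negP.
Qed.

(** Only the face spanned by the support of [t] matters: a retraction of the vertices onto the
    support fixes [t], so it can be moved across to the simplices. *)
Lemma pt_eq (V : sset) k (x x' : V k) (t : simplex k) :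
  (forall e : delta k k, (forall l, 0 < coord t (e l)) -> act e x = act e x') ->
  pt x t = pt x' t.
Proof.
move=> h; have [i ti] := supp_nonempty t.
have [e [eS eid]] := retract_on (S := fun l => 0 < coord t l) ti.
have te : simplex_push e t = t.
  by rewrite -[RHS]simplex_push_id; apply: simplex_push_eq => l /eid.
by rewrite -te -!pt_act h.
Qed.

End Supports.

(** * Comonotone couplings of barycentric coordinates *)

Section Coupling.
Variable R : realType.
Local Notation simplex := (simplex R).

(** The inequality is strict: vertex [i] occupies the interval from [cumul s i] to [cumul s i.+1],
    and these intervals tile the unit interval. *)
Definition cumul m (s : simplex m) (i : nat) : R :=
  \sum_(a : 'I_m.+1 | (a < i)%N) coord s a.

Lemma cumul0 m (s : simplex m) : cumul s 0 = 0.
Proof. exact: big_pred0. Qed.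

Lemma cumul_top m (s : simplex m) : cumul s m.+1 = 1.
Proof. by rewrite -(sum_coord s); apply: eq_bigl => a; rewrite ltn_ord. Qed.

Lemma cumulS m (s : simplex m) (i : 'I_m.+1) : cumul s i.+1 = cumul s i + coord
  s i.
Proof.
rewrite /cumul (bigD1 i) //= addrC; congr (_ + _); apply: eq_bigl => a.
by rewrite ltnS (ltn_neqAle a) andbC.
Qed.

Lemma cumul_mono m (s : simplex m) i j : (i <= j)%N -> cumul s i <= cumul s j.
Proof.
move=> ij; rewrite /cumul [X in _ <= X](bigID (fun a : 'I_m.+1 => (a < i)%N))
  /=.
rewrite [X in _ <= X + _](eq_bigl (fun a : 'I_m.+1 => (a < i)%N)) => [|a].
  by rewrite lerDl; apply: sumr_ge0 => a _; exact: coord_ge0.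
case: (ltnP a i) => ai; rewrite ?andbF // andbT; exact: leq_trans ai ij.
Qed.

Lemma cumul_le1 m (s : simplex m) i : cumul s i <= 1.
Proof.
case: (leqP i m.+1) => [/(cumul_mono s)|/ltnW h]; first by rewrite cumul_top.
rewrite -(cumul_top s) /cumul le_eqVlt; apply/orP; left; apply/eqP/eq_bigl => a.
by rewrite ltn_ord (leq_trans (ltn_ord a) h).
Qed.

Section Comonotone.
Variables (m n : nat) (s : simplex m) (t : simplex n).

(** The comonotone coupling of [s] and [t]: its distribution function is the
    minimum of the two marginal distribution functions. *)
Definition cdf (i j : nat) : R := Num.min (cumul s i) (cumul t j).

(** Mixed second difference of [cdf], hence the mass at [p]: the length of the overlap of the
    intervals occupied by [p.1] and [p.2]. *)
Definition coupling (p : 'I_m.+1 * 'I_n.+1) : R :=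
  (cdf p.1.+1 p.2.+1 - cdf p.1 p.2.+1) - (cdf p.1.+1 p.2 - cdf p.1 p.2).

Lemma coupling_ge0 p : 0 <= coupling p.
Proof.
have := cumul_mono s (leqnSn p.1); have := cumul_mono t (leqnSn p.2).
rewrite /coupling /cdf !minEle.
by do !case: ifP => //; move=> *; lra.
Qed.

Lemma coupling_gt0 p : 0 < coupling p ->
  cumul s p.1 < cumul t p.2.+1 /\ cumul t p.2 < cumul s p.1.+1.
Proof.
have := cumul_mono s (leqnSn p.1); have := cumul_mono t (leqnSn p.2).
rewrite /coupling /cdf !minEle => h1 h2 h3; split; rewrite ltNge; apply/negP =>
  h4;
  move: h3; do !case: ifP => //; move=> *; lra.
Qed.

(** If the first interval of [q] lies to the right of that of [p], the overlaps keep its second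
    interval from lying to the left. *)
Lemma coupling_chain p q : 0 < coupling p -> 0 < coupling q -> (p.1 < q.1)%N ->
  (p.2 <= q.2)%N.
Proof.
move=> /coupling_gt0[_ h1] /coupling_gt0[h2 _] pq; rewrite -ltnS ltnNge;
  apply/negP => h3.
have := cumul_mono s pq; have := cumul_mono t h3; lra.
Qed.

(** The sum telescopes, and at its two ends the minimum is a cumulative sum of [s] or 0. *)
Lemma coupling_marg1 (i : 'I_m.+1) : \sum_j coupling (i, j) = coord s i.
Proof.
rewrite /coupling /=.
rewrite -(big_mkord xpredT (fun j => cdf i.+1 j.+1 - cdf i j.+1 - (cdf i.+1 j -
  cdf i j))).
rewrite (@telescope_sumr _ 0 n.+1 (fun j => cdf i.+1 j - cdf i j)) //.
rewrite /cdf cumul_top cumul0.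
have c0 k : 0 <= cumul s k by apply: sumr_ge0 => a _; exact: coord_ge0.
by rewrite !(min_l (cumul_le1 _ _)) !(min_r (c0 _)) cumulS; lra.
Qed.

Lemma coupling_marg2 (j : 'I_n.+1) : \sum_i coupling (i, j) = coord t j.
Proof.
transitivity (\sum_(i < m.+1) ((cdf i.+1 j.+1 - cdf i.+1 j)
  - (cdf i j.+1 - cdf i j))).
  by apply: eq_bigr => i _; rewrite /coupling /=; lra.
rewrite -(big_mkord xpredT (fun i => cdf i.+1 j.+1 - cdf i.+1 j - (cdf i j.+1 -
  cdf i j))).
rewrite (@telescope_sumr _ 0 m.+1 (fun i => cdf i j.+1 - cdf i j)) //.
rewrite /cdf cumul_top cumul0.
have c0 k : 0 <= cumul t k by apply: sumr_ge0 => a _; exact: coord_ge0.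
by rewrite !(min_r (cumul_le1 _ _)) !(min_l (c0 _)) cumulS; lra.
Qed.

(** The coordinate sum increases strictly along a chain in the product order, so it places the
    support of the coupling among the vertices of an [(m + n)]-simplex. *)
Definition rank (p : 'I_m.+1 * 'I_n.+1) : 'I_(m + n).+1 := inord (p.1 + p.2).

Lemma rankE p : rank p = (p.1 + p.2)%N :> nat.
Proof. by rewrite inordK // ltnS leq_add // -ltnS. Qed.

(** The support of the coupling is a chain; this path runs through it. *)
Definition path1 (k : 'I_(m + n).+1) : 'I_m.+1 :=
  inord (\max_(p : 'I_m.+1 * 'I_n.+1 | (0 < coupling p) && (rank p <= k)%N)
    p.1).
Definition path2 (k : 'I_(m + n).+1) : 'I_n.+1 :=
  inord (\max_(p : 'I_m.+1 * 'I_n.+1 | (0 < coupling p) && (rank p <= k)%N)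
    p.2).

Lemma path1E k : path1 k = \max_(p : 'I_m.+1 * 'I_n.+1 | (0 < coupling p)
  && (rank p <= k)%N) p.1 :> nat.
Proof. by rewrite inordK // ltnS; apply/bigmax_leqP => p _; rewrite -ltnS. Qed.

Lemma path2E k : path2 k = \max_(p : 'I_m.+1 * 'I_n.+1 | (0 < coupling p)
  && (rank p <= k)%N) p.2 :> nat.
Proof. by rewrite inordK // ltnS; apply/bigmax_leqP => p _; rewrite -ltnS. Qed.

Lemma path1_mono (k l : 'I_(m + n).+1) : (k <= l)%N -> (path1 k <= path1 l)%N.
Proof.
move=> kl; rewrite !path1E; apply/bigmax_leqP => p /andP[p0 pk].
by apply: (leq_bigmax_cond (F := fun p : 'I_m.+1 * 'I_n.+1 => p.1 : nat));
  rewrite p0 (leq_trans pk kl).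
Qed.

Lemma path2_mono (k l : 'I_(m + n).+1) : (k <= l)%N -> (path2 k <= path2 l)%N.
Proof.
move=> kl; rewrite !path2E; apply/bigmax_leqP => p /andP[p0 pk].
by apply: (leq_bigmax_cond (F := fun p : 'I_m.+1 * 'I_n.+1 => p.2 : nat));
  rewrite p0 (leq_trans pk kl).
Qed.

Definition cpath1 : delta (m + n) m := mk_delta path1_mono.
Definition cpath2 : delta (m + n) n := mk_delta path2_mono.

Lemma coupling_le p q : 0 < coupling p -> 0 < coupling q ->
  (rank q <= rank p)%N ->
  (q.1 <= p.1)%N /\ (q.2 <= p.2)%N.
Proof.
move=> p0 q0; rewrite !rankE => qp.
case: (ltngtP q.1 p.1) => h.
- by split=> //; exact: coupling_chain h.
- by have := coupling_chain p0 q0 h; lia.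
- by split=> //; lia.
Qed.

Lemma cpath_rank p : 0 < coupling p -> cpath1 (rank p) = p.1 /\ cpath2 (rank p)
  = p.2.
Proof.
move=> p0; split; apply/val_inj/eqP => /=.
  rewrite path1E eqn_leq; apply/andP; split.
    by apply/bigmax_leqP => q /andP[q0 qp]; have [] := coupling_le p0 q0 qp.
  by apply: (leq_bigmax_cond (F := fun p : 'I_m.+1 * 'I_n.+1 => p.1 : nat));
    rewrite p0 leqnn.
rewrite path2E eqn_leq; apply/andP; split.
  by apply/bigmax_leqP => q /andP[q0 qp]; have [] := coupling_le p0 q0 qp.
by apply: (leq_bigmax_cond (F := fun p : 'I_m.+1 * 'I_n.+1 => p.2 : nat));
  rewrite p0 leqnn.
Qed.

Definition cweight_fun (k : 'I_(m + n).+1) : R := \sum_(p | rank p == k)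
  coupling p.

Lemma sum_coupling : \sum_p coupling p = 1.
Proof.
rewrite -(sum_coord s) -(pair_big xpredT xpredT (fun i j => coupling (i, j)))
  /=.
  by apply: eq_bigr => i _; exact: coupling_marg1.
Qed.

Lemma cweight_ge0 k : 0 <= cweight_fun k.
Proof. by apply: sumr_ge0 => p _; exact: coupling_ge0. Qed.

Lemma cweight_sum : \sum_k cweight_fun k = 1.
Proof. by rewrite -sum_coupling (partition_big rank xpredT). Qed.

Definition cweight : simplex (m + n) := mk_simplex cweight_ge0 cweight_sum.

Lemma sum_cweight (Q : pred 'I_(m + n).+1) :
  \sum_(k | Q k) coord cweight k = \sum_(p | Q (rank p)) coupling p.
Proof.
rewrite (partition_big rank Q) //=; apply: eq_bigr => k Qk.
by rewrite coord_mk; apply: eq_bigl => p; rewrite andbC; case: eqP => [->|].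
Qed.

Lemma sum_coupling_supp (P Q : pred ('I_m.+1 * 'I_n.+1)) :
  (forall p, 0 < coupling p -> P p = Q p) ->
  \sum_(p | P p) coupling p = \sum_(p | Q p) coupling p.
Proof.
move=> PQ; rewrite big_mkcond [RHS]big_mkcond; apply: eq_bigr => p _.
have := coupling_ge0 p; rewrite le_eqVlt => /predU1P[<-|/PQ -> //].
by rewrite !if_same.
Qed.

(** On the support the path recovers the coordinate from the rank, so pushing forward along it gives
    a marginal of the coupling. *)
Lemma cweight_marg1 : simplex_push cpath1 cweight = s.
Proof.
apply: coord_inj => i; rewrite coord_push (sum_cweight (fun k =>
  cpath1 k == i)).
rewrite (sum_coupling_supp (Q := fun p => (p.1 == i) && true)) =>
  [|p /cpath_rank[-> _]];
  last by rewrite andbT.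
rewrite -(pair_big (fun a => a == i) xpredT (fun a j => coupling (a, j))) /=.
  by rewrite big_pred1_eq coupling_marg1.
Qed.

Lemma cweight_marg2 : simplex_push cpath2 cweight = t.
Proof.
apply: coord_inj => j; rewrite coord_push (sum_cweight (fun k =>
  cpath2 k == j)).
rewrite (sum_coupling_supp (Q := fun p => true && (p.2 == j))) =>
  [|p /cpath_rank[_ ->] //].
rewrite -(pair_big xpredT (fun a => a == j) (fun i j => coupling (i, j))) /=.
  by rewrite -coupling_marg2; apply: eq_bigr => i _; rewrite big_pred1_eq.
Qed.

End Comonotone.

Lemma cumul_push k m (f : delta k m) (u : simplex k) i :
  cumul (simplex_push f u) i = \sum_(l | (f l < i)%N) coord u l.
Proof.
rewrite /cumul; under eq_bigr do rewrite coord_push.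
rewrite [RHS](partition_big (fun l => f l) (fun a : 'I_m.+1 => (a < i)%N)) //=.
apply: eq_bigr => a ai; apply: eq_bigl => l.
by rewrite andbC; case: eqP => [->|].
Qed.

(** Sublevel sets of nondecreasing maps are initial segments, hence nested. *)
Lemma cdf_push k m n (f : delta k m) (g : delta k n) (u : simplex k) i j :
  cdf (simplex_push f u) (simplex_push g u) i j =
  \sum_(l | (f l < i)%N && (g l < j)%N) coord u l.
Proof.
have subM (P Q : pred 'I_k.+1) : (forall l, P l -> Q l) ->
    Num.min (\sum_(l | P l) coord u l) (\sum_(l | Q l) coord u l)
      = \sum_(l | P l && Q l) coord u l.
  move=> PQ; rewrite min_l; first by apply: eq_bigl => l; case: (boolP (P l)) =>
    // /PQ ->.
  rewrite big_mkcond [X in _ <= X]big_mkcond; apply: ler_sum => l _.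
  case: (boolP (P l)) => [/PQ -> //|_]; case: ifP => // _; exact: coord_ge0.
rewrite /cdf !cumul_push.
have [h|/existsNP[a /not_implyP[fa /negP ga]]] := pselect (forall l,
  (f l < i)%N -> (g l < j)%N).
  exact: subM.
rewrite minC [RHS](eq_bigl (fun l => (g l < j)%N && (f l < i)%N)) => [|l];
  last exact: andbC.
apply: subM => l gl; have la : (l <= a)%N.
  rewrite leqNgt; apply/negP => /ltnW/(delta_mono g) al.
  by move: ga; rewrite (leq_ltn_trans al gl).
exact: leq_ltn_trans (delta_mono f la) fa.
Qed.

(** Two monotone images of one point are always coupled comonotonically, so the coupling is their
    joint image. The compatibility of [theta0] with simplicial operators rests on this. *)
Lemma coupling_push k m n (f : delta k m) (g : delta k n) (u : simplex k) p :
  coupling (simplex_push f u) (simplex_push g u) p =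
  \sum_(l | (f l, g l) == p) coord u l.
Proof.
case: p => i j; rewrite /coupling /= !cdf_push.
rewrite !(big_mkcond (fun l => _ && _)) /= big_mkcond /= -!sumrB;
  apply: eq_bigr => l _.
rewrite ?xpair_eqE -!val_eqE /= !ltnS.
case: (ltngtP (f l) i) => _; case: (ltngtP (g l) j) => _ /=; lra.
Qed.

End Coupling.

(** * The inverse of the comparison map *)

Section Theta.
Variable R : realType.
Local Notation simplex := (simplex R).
Local Notation "⟦ X ⟧" := (realization R X) (at level 0, format "⟦ X ⟧").
Variables Y W : sset.

Definition theta0 m (y : Y m) (s : simplex m) n (w : W n) (t : simplex n)
  : ⟦sprod Y W⟧ :=
  @pt R (sprod Y W) _ (act (cpath1 s t) y, act (cpath2 s t) w) (cweight s t).

(** Independence of the common simplex: the rank of the pair of operators carries [u] to the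
    coupling weight, and on the support of [u] the two paths recover [f] and [g]. *)
Lemma theta0E k m n (f : delta k m) (g : delta k n) (u : simplex k) (y : Y m)
  (w : W n) :
  theta0 y (simplex_push f u) w (simplex_push g u) =
  @pt R (sprod Y W) k (act f y, act g w) u.
Proof.
set s := simplex_push f u; set t := simplex_push g u.
have emono (i j : 'I_k.+1) : (i <= j)%N -> (rank (f i, g i) <= rank (f j,
  g j))%N.
  by move=> ij; rewrite !rankE leq_add ?delta_mono.
pose e := mk_delta emono.
have supp l : 0 < coord u l -> 0 < coupling s t (f l, g l).
  move=> ul; rewrite coupling_push; apply: (lt_le_trans ul).
  by rewrite (bigD1 l) //= lerDl; apply: sumr_ge0 => i _; exact: coord_ge0.
have eu : simplex_push e u = cweight s t.
  apply: coord_inj => a; rewrite coord_push coord_mk /cweight_fun.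
  under [RHS]eq_bigr do rewrite coupling_push.
  rewrite (partition_big (fun l => (f l, g l)) (fun p => rank p == a)) //=.
  apply: eq_bigr => p pa; apply: eq_bigl => l.
  by rewrite andbC; case: eqP => [->|].
rewrite /theta0 -eu -pt_act; apply: pt_eq => h hu; congr pair;
  rewrite /= -!act_comp; congr act;
  apply: delta_ext => l; rewrite !delta_compE;
  by have [e1 e2] := cpath_rank (supp _ (hu l)); rewrite ?[RHS]e1 ?[RHS]e2.
Qed.

(** The coupling simplex of [s] and [t], with its paths composed with [f] and [g], also presents the
    pushed points, so [theta0E] applies to it. *)
Lemma theta0_act m m' n n' (f : delta m' m) (g : delta n' n) (y : Y m)
  (s : simplex m')
    (w : W n) (t : simplex n') :
  theta0 (act f y) s (act g w) t = theta0 y (simplex_push f s)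
    w (simplex_push g t).
Proof.
have := theta0E (delta_comp f (cpath1 s t)) (delta_comp g (cpath2 s t))
  (cweight s t) y w.
by rewrite !simplex_push_comp cweight_marg1 cweight_marg2 => ->;
  rewrite /theta0 !act_comp.
Qed.

(** Inverse to the comparison map from [|Y * W|] to [|Y| * |W|]. It need not be
    continuous, but it is once the second factor is restricted to a cell. *)
Definition theta (p : ⟦Y⟧) (q : ⟦W⟧) : ⟦sprod Y W⟧ :=
  rlift (fun m (y : Y m) s => rlift (fun n (w : W n) t => theta0 y s w t) q) p.

Let theta0_actr m (y : Y m) (s : simplex m) n n' (g : delta n' n) (w : W n) t :
  theta0 y s (act g w) t = theta0 y s w (simplex_push g t).
Proof. by have := theta0_act (delta_id m) g y s w t;
  rewrite act_id simplex_push_id. Qed.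

Lemma thetaE m (y : Y m) (s : simplex m) n (w : W n) (t : simplex n) :
  theta (pt y s) (pt w t) = theta0 y s w t.
Proof.
have inner k (z : Y k) u n' (w' : W n') t' :
    rlift (fun n (w : W n) t => theta0 z u w t) (pt w' t') = theta0 z u w' t'.
  by rewrite rlift_pt // => *; exact: theta0_actr.
rewrite /theta rlift_pt ?inner // => m' k f {}y {}s.
elim/pt_ind: (pt w t) => n' w' t'; rewrite !inner.
by have := theta0_act f (delta_id n') y s w' t'; rewrite act_id simplex_push_id.
Qed.

Definition spr1 : smap (sprod Y W) Y := @SMap (sprod Y W) Y (fun _ x => x.1)
  (fun _ _ _ _ => erefl).
Definition spr2 : smap (sprod Y W) W := @SMap (sprod Y W) W (fun _ x => x.2)
  (fun _ _ _ _ => erefl).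

Lemma theta_pr (p : ⟦sprod Y W⟧) : theta (realization_map spr1 p)
  (realization_map spr2 p) = p.
Proof.
elim/pt_ind: p => n [y w] t; rewrite !realization_map_pt thetaE /=.
rewrite -[t in LHS]simplex_push_id.
by have := theta0E (delta_id n) (delta_id n) t y w;
  rewrite !act_id !simplex_push_id.
Qed.

(** For fixed [y] and [w] only finitely many pairs of monotone maps can occur. The preimage of a
    closed set is the union, over these pairs, of images of closed subsets of a compact simplex, and
    such images are closed in a Hausdorff space. *)
Lemma theta_continuousl n (w : W n) :
  continuous (fun pq : ⟦Y⟧ * simplex n => theta pq.1 (pt w pq.2)).
Proof.
apply: realization_continuous2; first exact: compactly_based_simplex.
move=> m y /=.
pose D : set {classic (delta (m + n) m * delta (m + n) n)%type} := setT.
apply/continuous_closedP => A cA.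
pose push (c : delta (m + n) m * delta (m + n) n) (u : simplex (m + n))
  : simplex m * simplex n :=
  (simplex_push c.1 u, simplex_push c.2 u).
pose G (c : delta (m + n) m * delta (m + n) n) (u : simplex (m + n)) :=
  @pt R (sprod Y W) _ (act c.1 y, act c.2 w) u.
rewrite (_ : (fun _ => _) @^-1` A = \bigcup_(c in D)
  (push c @` (G c @^-1` A)))%classic; last first.
  apply/seteqP; split => [[s t] /= | st [c _ [u /= GA <-]]] /=.
    rewrite thetaE => st; exists (cpath1 s t, cpath2 s t) => //.
    exists (cweight s t) => //; by rewrite /push /= cweight_marg1 cweight_marg2.
  by rewrite thetaE theta0E.
apply: closed_bigcup => [|c _].
  by rewrite /D -setXTT; exact: (finite_setX (@finite_delta _ _)
    (@finite_delta _ _)).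
apply: compact_closed.
  move=> [p1 p2] [q1 q2] pq; congr pair; apply: (@hausdorff_simplex R) =>
    A1 B1 nA nB.
    have [|//|[a b] [/= Aa Ba]] := pq (A1 `*` setT)%classic (B1 `*`
      setT)%classic.
    - by exists (A1, setT) => //; split => //; exact: filterT.
    - by exists (B1, setT) => //; split => //; exact: filterT.
    by exists a; split; [case: Aa|case: Ba].
  have [|//|[a b] [/= Aa Ba]] := pq (setT `*` A1)%classic (setT `*` B1)%classic.
  - by exists (setT, A1) => //; split => //; exact: filterT.
  - by exists (setT, B1) => //; split => //; exact: filterT.
  by exists b; split; [case: Aa|case: Ba].
apply: continuous_compact.
  apply: continuous_subspaceT; apply: cts_pair; exact: simplex_push_continuous.
apply: (@subclosed_compact _ _ [set: simplex (m + n)]%classic) => //;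
  last exact: compact_simplex.
by have /continuous_closedP := @pt_continuous R (sprod Y W) _ (act c.1 y,
  act c.2 w); apply.
Qed.

End Theta.

Local Open Scope classical_set_scope.

(** * Homotopy equivalences and deformation retracts *)

Section Homotopy.
Variable R : realType.

(** Retraction of the line onto the unit interval. It allows homotopies to be continuous on all of
    [S * R] instead of within a strip. *)
Definition clamp (x : R) : R := Num.max 0 (Num.min 1 x).

Lemma clamp_ge0 x : 0 <= clamp x. Proof. by rewrite le_max lexx. Qed.

Lemma clamp_le1 x : clamp x <= 1. Proof. by rewrite ge_max ler01 ge_min lexx.
  Qed.

Lemma clamp_id x : 0 <= x <= 1 -> clamp x = x.
Proof. by move=> /andP[x0 x1]; rewrite /clamp min_r // max_r. Qed.

Lemma clamp0 : clamp 0 = 0. Proof. by rewrite clamp_id // lexx ler01. Qed.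

Lemma clamp1 : clamp 1 = 1. Proof. by rewrite clamp_id // lexx ler01. Qed.

Lemma clamp_clamp x : clamp (clamp x) = clamp x.
Proof. by rewrite clamp_id // clamp_ge0 clamp_le1. Qed.

Section Reals.
Variable S : topologicalType.
Implicit Types f g : S -> R.

Lemma cts_max f g : continuous f -> continuous g -> continuous (fun s =>
  Num.max (f s) (g s)).
Proof. by move=> cf cg s; apply: continuous_max; [exact: cf|exact: cg]. Qed.

Lemma cts_min f g : continuous f -> continuous g -> continuous (fun s =>
  Num.min (f s) (g s)).
Proof. by move=> cf cg s; apply: continuous_min; [exact: cf|exact: cg]. Qed.

Lemma cts_add f g : continuous f -> continuous g -> continuous (fun s =>
  f s + g s).
Proof. by move=> cf cg s; apply: cvgD; [exact: cf|exact: cg]. Qed.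

Lemma cts_opp f : continuous f -> continuous (fun s => - f s).
Proof. by move=> cf s; apply: cvgN; exact: cf. Qed.

Lemma cts_mul f g : continuous f -> continuous g -> continuous (fun s =>
  f s * g s).
Proof. by move=> cf cg s; apply: cvgM; [exact: cf|exact: cg]. Qed.

Lemma cts_inv f : (forall s, f s != 0) -> continuous f -> continuous (fun s =>
  (f s)^-1).
Proof. by move=> f0 cf s; apply: cvgV; [exact: f0|exact: cf]. Qed.

Lemma cts_clamp f : continuous f -> continuous (fun s => clamp (f s)).
Proof. by move=> cf; apply: cts_max; [exact: cts_cst|apply: cts_min => //;
  exact: cts_cst]. Qed.

Lemma closed_eq0 f : continuous f -> closed [set s | f s = 0].
Proof.
by move=> cf; apply: (@preimage_closed _ _ f [set x | x = 0]); [move=> x _;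
  exact: cf|exact: closed_eq].
Qed.

Lemma closed_le0 f : continuous f -> closed [set s | f s <= 0].
Proof.
by move=> cf; apply: (@preimage_closed _ _ f [set x | x <= 0]); [move=> x _;
  exact: cf|exact: closed_le].
Qed.

Lemma closed_le_fun f g : continuous f -> continuous g ->
  closed [set s | f s <= g s].
Proof.
move=> cf cg; rewrite (_ : [set _ | _] = [set s | f s + - g s <= 0]).
  by apply: closed_le0; apply: cts_add => //; exact: cts_opp.
by apply/seteqP; split => s /=; rewrite subr_le0.
Qed.

End Reals.

Definition htpy (S T : topologicalType) (f g : S -> T) : Prop :=
  exists H : S * R -> T, [/\ continuous H, forall s, H (s, 0) = f s & forall s,
    H (s, 1) = g s].

Lemma within_comp (S T U : topologicalType) (A : set T) (H : T -> U) (phi : S ->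
  T) :
  {within A, continuous H} -> continuous phi -> (forall s, A (phi s)) ->
  continuous (H \o phi).
Proof.
move=> cH cphi Aphi s V nV.
have := cH (phi s) V nV; rewrite /= nbhs_simpl /= {1}/nbhs /= -nbhs_subspace_in;
  last exact: Aphi.
move=> /(cphi s); rewrite nbhs_simpl /= => h.
by apply: filterS h => s' /= h; apply: h.
Qed.

Lemma homotopic_htpy (S T : topologicalType) (f g : S -> T)
  : @homotopic R S T f g <-> htpy f g.
Proof.
split=> -[H [cH H0 H1]]; last first.
  by exists H; split => //; exact: continuous_subspaceT.
exists (H \o (fun p => (p.1, clamp p.2))); split => [|s|s] /=.
- apply: within_comp cH _ _ => [|p /=]; last by rewrite clamp_ge0 clamp_le1.
  by apply: cts_pair; [exact: cts_fst|apply: cts_clamp; exact: cts_snd].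
- by rewrite clamp0.
- by rewrite clamp1.
Qed.

Lemma htpy_refl (S T : topologicalType) (f : S -> T) : continuous f -> htpy f f.
Proof. by move=> cf; exists (fun p => f p.1); split => //; apply: cts_comp cf;
  exact: cts_fst. Qed.

Lemma htpy_sym (S T : topologicalType) (f g : S -> T) : htpy f g -> htpy g f.
Proof.
move=> [H [cH H0 H1]]; exists (fun p => H (p.1, 1 - p.2)); split => [|s|s] /=.
- apply: cts_comp cH; apply: cts_pair; first exact: cts_fst.
  by apply: cts_add; [exact: cts_cst|apply: cts_opp; exact: cts_snd].
- by rewrite subr0.
- by rewrite subrr.
Qed.

Definition hconcat (S T : Type) (H K : S * R -> T) (p : S * R) : T :=
  if p.2 <= 2^-1 then H (p.1, p.2 *+ 2) else K (p.1, p.2 *+ 2 - 1).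

Lemma hconcat_continuous (S T : topologicalType) (H K : S * R -> T) :
  continuous H -> continuous K -> (forall s, H (s, 1) = K (s, 0)) ->
    continuous (hconcat H K).
Proof.
move=> cH cK HK.
pose C (b : bool) : set (S * R) := if b then [set p | p.2 <= 2^-1]
  else [set p | 2^-1 <= p.2].
pose G (b : bool) (p : S * R) : T := if b then H (p.1, p.2 *+ 2) else K (p.1,
  p.2 *+ 2 - 1).
have c2 : continuous (fun p : S * R => p.2 *+ 2).
  by rewrite (_ : (fun _ => _) = (fun p : S * R => p.2 + p.2)) //;
    apply: cts_add; exact: cts_snd.
apply: (@continuous_closed_cover _ _ bool setT C _ G).
- exact: finite_finset.
- by case=> _ /=; apply: closed_le_fun => //;
  do ?[exact: cts_snd|exact: cts_cst].
- move=> s; case: (leP s.2 2^-1) => [h|/ltW h]; [exists true|exists false] =>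
  //.
- case=> _ /=.
    by apply: cts_comp cH; apply: cts_pair => //; exact: cts_fst.
  apply: cts_comp cK; apply: cts_pair; first exact: cts_fst.
  by apply: cts_add => //; exact: cts_cst.
- case=> -[s r] _ /=; rewrite /hconcat /= => h; first by rewrite h.
  case: ifP => // h'; have -> : r = 2^-1 by apply/eqP; rewrite eq_le h h'.
  by rewrite (_ : 2^-1 *+ 2 = 1) ?subrr ?HK //; lra.
Qed.

Lemma hconcat0 (S T : Type) (H K : S * R -> T) s : hconcat H K (s, 0) = H (s,
  0).
Proof. by rewrite /hconcat /= invr_ge0 ler0n mul0rn. Qed.

Lemma hconcat1 (S T : Type) (H K : S * R -> T) s : hconcat H K (s, 1) = K (s,
  1).
Proof.
rewrite /hconcat /= ifF; last by apply/negbTE; rewrite -ltNge; lra.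
by congr K; congr pair; lra.
Qed.

Lemma htpy_trans (S T : topologicalType) (f g h : S -> T) : htpy f g ->
  htpy g h -> htpy f h.
Proof.
move=> [H [cH H0 H1]] [K [cK K0 K1]]; exists (hconcat H K); split => [|s|s].
- by apply: hconcat_continuous => // s; rewrite H1 K0.
- by rewrite hconcat0.
- by rewrite hconcat1.
Qed.

Lemma htpy_compl (S T U : topologicalType) (k : T -> U) (f g : S -> T) :
  continuous k -> htpy f g -> htpy (k \o f) (k \o g).
Proof.
move=> ck [H [cH H0 H1]]; exists (k \o H); split => [|s|s] /=;
  rewrite ?H0 ?H1 //.
exact: cts_comp ck.
Qed.

Lemma htpy_compr (S T U : topologicalType) (k : U -> S) (f g : S -> T) :
  continuous k -> htpy f g -> htpy (f \o k) (g \o k).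
Proof.
move=> ck [H [cH H0 H1]]; exists (fun p => H (k p.1, p.2)); split => [|s|s] /=;
  rewrite ?H0 ?H1 //.
apply: cts_comp cH; apply: cts_pair; last exact: cts_snd.
by apply: cts_comp ck; exact: cts_fst.
Qed.

Definition heq (S T : topologicalType) (f : S -> T) : Prop :=
  continuous f /\ exists g : T -> S, [/\ continuous g, htpy (g \o f)
    id & htpy (f \o g) id].

Lemma heqE (S T : topologicalType) (f : S -> T) : homotopy_equivalence R f <->
  heq f.
Proof.
by split=> -[cf [g [cg gf fg]]]; split => //; exists g; split => //;
  apply/homotopic_htpy.
Qed.

Lemma heq_comp (S T U : topologicalType) (f : S -> T) (g : T -> U) :
  heq f -> heq g -> heq (g \o f).
Proof.
move=> [cf [f' [cf' f'f ff']]] [cg [g' [cg' g'g gg']]]; split;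
  first exact: cts_comp cg.
exists (f' \o g'); split; first exact: cts_comp cf'.
- apply: htpy_trans f'f; rewrite (_ : _ \o _ = f' \o (g' \o g) \o f) //.
  by rewrite -[X in htpy _ X](_ : f' \o id \o f = _) //; apply: htpy_compr =>
    //; apply: htpy_compl.
- apply: htpy_trans gg'; rewrite (_ : _ \o _ = g \o (f \o f') \o g') //.
  by rewrite -[X in htpy _ X](_ : g \o id \o g' = _) //; apply: htpy_compr =>
    //; apply: htpy_compl.
Qed.

(** Two-out-of-three: [n] after an inverse of the composite is inverse to [m]. For one of the two
    homotopies an inverse of [n] is inserted and cancelled. *)
Lemma heq_cancelr (S T U : topologicalType) (n : S -> T) (m : T -> U) :
  continuous m -> heq n -> heq (m \o n) -> heq m.
Proof.
move=> cm [cn [n' [cn' n'n nn']]] [_ [k [ck kmn mnk]]]; split => //.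
exists (n \o k); split => //; first exact: cts_comp cn.
apply: (htpy_trans _ nn'); apply: (@htpy_trans _ _ _ (n \o (k \o m \o n)
  \o n')).
  apply: htpy_sym; rewrite (_ : _ \o _ = (n \o k \o m) \o (n \o n')) //.
  rewrite -[X in htpy _ X](_ : (n \o k \o m) \o id = _) //; apply: htpy_compl =>
    //.
  by apply: cts_comp; [exact: cm|apply: cts_comp; [exact: ck|exact: cn]].
by rewrite -[X in htpy _ X](_ : n \o id \o n' = _) //; apply: htpy_compr => //;
  apply: htpy_compl.
Qed.

Lemma heq_cancell (S T U : topologicalType) (n : S -> T) (m : T -> U) :
  continuous n -> heq m -> heq (m \o n) -> heq n.
Proof.
move=> cn [cm [m' [cm' m'm mm']]] [_ [k [ck kmn mnk]]]; split => //.
exists (k \o m); split => //; first exact: cts_comp ck.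
apply: (htpy_trans _ m'm); apply: (@htpy_trans _ _ _ (m' \o (m \o n \o k)
  \o m)).
  apply: htpy_sym; rewrite (_ : _ \o _ = (m' \o m) \o (n \o k \o m)) //.
  rewrite -[X in htpy _ X](_ : id \o (n \o k \o m) = _) //; apply: htpy_compr =>
    //.
  by apply: cts_comp; [exact: cm|apply: cts_comp; [exact: ck|exact: cn]].
by rewrite -[X in htpy _ X](_ : m' \o id \o m = _) //; apply: htpy_compr => //;
  apply: htpy_compl.
Qed.

Lemma heq_bij (S T : topologicalType) (f : S -> T) (g : T -> S) :
  continuous f -> continuous g -> cancel f g -> cancel g f -> heq f.
Proof.
move=> cf cg fK gK; split => //; exists g; split => //.
- by rewrite (_ : _ \o _ = id) ?funeqE //; apply: htpy_refl => s; exact: cvg_id.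
- by rewrite (_ : _ \o _ = id) ?funeqE //; apply: htpy_refl => s; exact: cvg_id.
Qed.

End Homotopy.

Local Open Scope classical_set_scope.

(** * Deformation retracts under products and pushouts *)

Section DeformationRetracts.
Variable R : realType.
Local Notation simplex := (simplex R).
Local Notation "⟦ X ⟧" := (realization R X) (at level 0, format "⟦ X ⟧").
Local Notation rmapR f := (@realization_map R _ _ f).

Lemma realization_map_comp (A B C : sset) (g : smap B C) (f : smap A B) p :
  rmapR (smap_comp g f) p = rmapR g (rmapR f p).
Proof. by elim/pt_ind: p => n x t; rewrite !realization_map_pt. Qed.

Lemma realization_map_id (A : sset) (f : smap A A) :
  (forall n x, f n x = x) -> forall p, rmapR f p = p.
Proof. by move=> fE p; elim/pt_ind: p => n x t;
  rewrite realization_map_pt fE. Qed.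

Lemma realization_map_eq (A B : sset) (f g : smap A B) :
  (forall n x, f n x = g n x) -> forall p, rmapR f p = rmapR g p.
Proof. by move=> fg p; elim/pt_ind: p => n x t;
  rewrite !realization_map_pt fg. Qed.

Lemma heq_smap_iso (A B : sset) (f : smap A B) (g : smap B A) :
  (forall n x, g n (f n x) = x) -> (forall n x, f n (g n x) = x) ->
    heq R (rmapR f).
Proof.
move=> gf fg; apply: (@heq_bij R _ _ _ (rmapR g));
  try exact: realization_map_continuous.
- by move=> p; rewrite -realization_map_comp realization_map_id.
- by move=> p; rewrite -realization_map_comp realization_map_id.
Qed.

(** Strong deformation retracts. *)
Definition sdr (A B : sset) (j : smap A B) : Prop :=
  exists (rho : ⟦B⟧ -> ⟦A⟧) (H : ⟦B⟧ * R -> ⟦B⟧),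
    [/\ continuous rho, continuous H, forall a, rho (rmapR j a) = a,
        forall b, H (b, 0) = b /\ H (b, 1) = rmapR j (rho b) &
        forall a r, H (rmapR j a, r) = rmapR j a].

Lemma sdr_heq (A B : sset) (j : smap A B) : sdr j -> heq R (rmapR j).
Proof.
move=> [rho [H [crho cH rhoj Hb Hj]]]; split;
  first exact: realization_map_continuous.
exists rho; split => //.
- by rewrite (_ : _ \o _ = id) ?funeqE //; apply: htpy_refl => s; exact: cvg_id.
- by apply: htpy_sym; exists H; split=> // b; have [] := Hb b.
Qed.

Section Product.

Lemma theta_map (Y Z W : sset) (f : smap Y Z) (p : ⟦Y⟧) (q : ⟦W⟧) :
  rmapR (sprod_map f (smap_id W)) (theta p q) = theta (rmapR f p) q.
Proof.
elim/pt_ind: p => m y s; elim/pt_ind: q => n w t.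
by rewrite realization_map_pt !thetaE /theta0 realization_map_pt /= sfun_act.
Qed.

Lemma spr1_map (Y Z W : sset) (f : smap Y Z) p :
  rmapR (spr1 Z W) (rmapR (sprod_map f (smap_id W)) p)
    = rmapR f (rmapR (spr1 Y W) p).
Proof. by rewrite -!realization_map_comp; apply: realization_map_eq. Qed.

Lemma spr2_map (Y Z W : sset) (f : smap Y Z) p :
  rmapR (spr2 Z W) (rmapR (sprod_map f (smap_id W)) p) = rmapR (spr2 Y W) p.
Proof. by rewrite -!realization_map_comp; apply: realization_map_eq. Qed.

(** On a single cell of [Z * W] the second projection stays in the cell of [w], so the continuity of
    [theta] on the realization times a cell is enough. *)
Lemma theta_homotopy_continuous (Y Z W : sset) (G : ⟦Z⟧ * R -> ⟦Y⟧)
  : continuous G ->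
  continuous (fun p : ⟦sprod Z W⟧ * R =>
    theta (G (rmapR (spr1 Z W) p.1, p.2)) (rmapR (spr2 Z W) p.1)).
Proof.
move=> cG; apply: realization_continuous2; first exact: compactly_based_real.
move=> n [z w] /=.
rewrite (_ : (fun _ => _) = (fun ur => theta (G (pt z ur.1, ur.2))
  (pt w ur.1))); last first.
  by apply/funext => -[u r]; rewrite !realization_map_pt.
apply: (cts_comp (f := fun ur : simplex n * R => (G (pt z ur.1, ur.2), ur.1))
  _ (@theta_continuousl R Y W n w)).
apply: cts_pair; last exact: cts_fst.
apply: cts_comp cG; apply: cts_pair; last exact: cts_snd.
by apply: cts_comp (@pt_continuous R Z n z); exact: cts_fst.
Qed.

Lemma sdr_prod (Y Z W : sset) (j : smap Y Z) : sdr j ->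
  sdr (sprod_map j (smap_id W)).
Proof.
move=> [rho [H [crho cH rhoj Hb Hj]]].
exists (fun p => theta (rho (rmapR (spr1 Z W) p)) (rmapR (spr2 Z W) p)).
exists (fun p => theta (H (rmapR (spr1 Z W) p.1, p.2)) (rmapR (spr2 Z W) p.1)).
split.
- apply: (cts_comp (f := fun p => (p, 0 : R)) _ (theta_homotopy_continuous (G :=
  rho \o fst) _)).
    by apply: cts_pair; [exact: cts_id|exact: cts_cst].
  by apply: cts_comp crho; exact: cts_fst.
- exact: (theta_homotopy_continuous cH).
- by move=> p; rewrite spr1_map spr2_map rhoj theta_pr.
- move=> p /=; have [H0 H1] := Hb (rmapR (spr1 Z W) p); rewrite H0 H1.
  by rewrite theta_pr theta_map.
- by move=> p r /=; rewrite spr1_map spr2_map Hj -theta_map theta_pr.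
Qed.

End Product.

Section Pushout.
Variables (A B C : sset) (j : smap A B) (g : smap A C).
Let P := pushout j g.
Let inl' : ⟦B⟧ -> ⟦P⟧ := rmapR (po_inl j g).
Let inr' : ⟦C⟧ -> ⟦P⟧ := rmapR (po_inr j g).

Lemma realization_po_ind (Q : ⟦P⟧ -> Prop) :
  (forall b, Q (inl' b)) -> (forall c, Q (inr' c)) -> forall p, Q p.
Proof.
move=> hb hc p; elim/pt_ind: p => n x t; elim/po_ind: x => y.
- by have := hb (pt y t); rewrite /inl' realization_map_pt.
- by have := hc (pt y t); rewrite /inr' realization_map_pt.
Qed.

Lemma realization_po_elim (T : Type) (u : ⟦B⟧ -> T) (v : ⟦C⟧ -> T) :
  (forall a, u (rmapR j a) = v (rmapR g a)) ->
  exists w : ⟦P⟧ -> T, (forall b, w (inl' b) = u b) /\ (forall c, w (inr' c)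
    = v c).
Proof.
move=> uv.
pose F n (x : P n) (t : simplex n) : T :=
  @po_elim _ _ _ j g n T (fun b => u (pt b t)) (fun c => v (pt c t)) x.
have uvt n (t : simplex n) a : u (pt (j n a) t) = v (pt (g n a) t).
  by have := uv (pt a t); rewrite !realization_map_pt.
have Fl n b t : F n (po_inl j g n b) t = u (pt b t) by rewrite /F po_elim_inl.
have Fr n c t : F n (po_inr j g n c) t = v (pt c t) by rewrite /F po_elim_inr.
have FE m n (f : delta m n) x t : F m (act f x) t = F n x (simplex_push f t).
  by elim/po_ind: x => y; rewrite -sfun_act ?Fl ?Fr pt_act.
exists (rlift F); split => q; elim/pt_ind: q => n x t.
- by rewrite /inl' realization_map_pt rlift_pt // Fl.
- by rewrite /inr' realization_map_pt rlift_pt // Fr.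
Qed.

Lemma realization_po_continuous2 (T : topologicalType) (F : ⟦P⟧ * R -> T) :
  continuous (fun p : ⟦B⟧ * R => F (inl' p.1, p.2)) ->
  continuous (fun p : ⟦C⟧ * R => F (inr' p.1, p.2)) -> continuous F.
Proof.
have cpt (V : sset) n (x : V n) : continuous (fun q : simplex n * R =>
  (@pt R V n x q.1, q.2)).
  apply: cts_pair; last exact: cts_snd.
  by apply: cts_comp (@pt_continuous R V n x); exact: cts_fst.
move=> cl cr; apply: realization_continuous2; first exact: compactly_based_real.
move=> n; apply: po_ind => y.
- rewrite (_ : (fun _ => _) = (fun q : simplex n * R => F (inl' (pt y q.1),
  q.2))).
    exact: (cts_comp (cpt B n y) cl).
  by apply/funext => q; rewrite /inl' realization_map_pt.
- rewrite (_ : (fun _ => _) = (fun q : simplex n * R => F (inr' (pt y q.1),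
  q.2))).
    exact: (cts_comp (cpt C n y) cr).
  by apply/funext => q; rewrite /inr' realization_map_pt.
Qed.

(** The given homotopy on [B] and the constant one on [C] match along [A] because [H] fixes the
    image of [A] at all times. *)
Lemma sdr_pushout : sdr j -> sdr (po_inr j g).
Proof.
move=> [rho [H [crho cH rhoj Hb Hj]]].
have [|rP [rPl rPr]] := @realization_po_elim _ (rmapR g \o rho) id.
  by move=> a /=; rewrite rhoj.
have glue a : inl' (rmapR j a) = inr' (rmapR g a).
  rewrite /inl' /inr' -!realization_map_comp; apply: realization_map_eq =>
    n x /=.
  exact: po_glue.
have [|HP [HPl HPr]] := @realization_po_elim _ (fun b r => inl' (H (b, r)))
  (fun c r => inr' c).
  by move=> a; apply/funext => r; rewrite Hj glue.
have cl : continuous inl' by exact: realization_map_continuous.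
have cr : continuous inr' by exact: realization_map_continuous.
have crP : continuous (fun p : ⟦P⟧ * R => rP p.1).
  apply: realization_po_continuous2.
    rewrite (_ : (fun _ => _) = (fun p => rmapR g (rho p.1))).
      apply: (cts_comp (f := fun p => rho p.1));
        last exact: realization_map_continuous.
      by apply: cts_comp crho; exact: cts_fst.
    by apply/funext => p; rewrite rPl.
  rewrite (_ : (fun _ => _) = fst); first exact: cts_fst.
  by apply/funext => p; rewrite rPr.
exists rP, (fun p => HP p.1 p.2); split => //.
- apply: (cts_comp (f := fun p => (p, 0 : R)) _ crP).
  by apply: cts_pair; [exact: cts_id|exact: cts_cst].
- apply: realization_po_continuous2.
    rewrite (_ : (fun _ => _) = (fun p => inl' (H p)));
      first exact: cts_comp cl.
    by apply/funext => -[b r]; rewrite HPl.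
  rewrite (_ : (fun _ => _) = (fun p => inr' p.1)).
    by apply: cts_comp cr; exact: cts_fst.
  by apply/funext => -[b r]; rewrite HPr.
- apply: realization_po_ind => [b|c] /=.
    have [H0 H1] := Hb b; rewrite HPl H0 H1 rPl; split=> //; exact: glue.
  by rewrite HPr rPr.
- by move=> c r /=; rewrite HPr.
Qed.

End Pushout.
End DeformationRetracts.

Local Open Scope classical_set_scope.

(** * Homotopy extension *)

Section RadialProjection.
Variables (R : realType) (k : nat).
Local Notation simplex := (simplex R).

(** Reciprocal of the factor by which the ray from the projection centre through [(t, s)] must be
    stretched to leave the prism: the bottom contributes [1 - s / 2] and the [i]-th side
    [1 - (k + 1) t_i], and the first exit is the largest of these. *)
Definition rp_scale (t : simplex k) (s : R) : R :=
  \big[Num.max/1 - clamp s / 2]_(i < k.+1) (1 - k.+1%:R * coord t i).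

Lemma rp_scale_ge t s : 1 - clamp s / 2 <= rp_scale t s.
Proof. exact: bigmax_ge_id. Qed.

Lemma rp_scale_ge_coord t s i : 1 - k.+1%:R * coord t i <= rp_scale t s.
Proof. exact: (le_bigmax _ (fun i => 1 - k.+1%:R * coord t i)). Qed.

Lemma rp_scale_le1 t s : rp_scale t s <= 1.
Proof.
rewrite /rp_scale; elim/big_ind: _ => [|x y x1 y1|i _].
- by rewrite gerBl divr_ge0 ?clamp_ge0.
- by rewrite ge_max x1.
- by rewrite gerBl mulr_ge0 ?coord_ge0.
Qed.

Lemma rp_scaleP t s : rp_scale t s = 1 - clamp s / 2 \/
  exists i, rp_scale t s = 1 - k.+1%:R * coord t i.
Proof.
rewrite /rp_scale; elim/big_ind: _ => [|x y hx hy|i _]; first by left.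
- by rewrite /Num.max; case: ifP.
- by right; exists i.
Qed.

Lemma rp_scale_gt0 t s : 0 < rp_scale t s.
Proof. by have := rp_scale_ge t s; have := clamp_le1 s; lra. Qed.

Lemma rp_scale_neq0 t s : rp_scale t s != 0.
Proof. by rewrite gt_eqF ?rp_scale_gt0. Qed.

(** Radial projection, from the point at height [2] above the barycenter, of the
    prism onto the union of its bottom and its sides. *)
Definition rp_fun (t : simplex k) (s : R) (i : 'I_k.+1) : R :=
  (coord t i - (1 - rp_scale t s) / k.+1%:R) / rp_scale t s.

Lemma rp_ge0 t s i : 0 <= rp_fun t s i.
Proof.
rewrite divr_ge0 ?(ltW (rp_scale_gt0 _ _)) // subr_ge0 ler_pdivrMr ?ltr0Sn //.
by have := rp_scale_ge_coord t s i; lra.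
Qed.

Lemma rp_sum t s : \sum_i rp_fun t s i = 1.
Proof.
rewrite -mulr_suml sumrB sum_coord sumr_const card_ord -[X in _ - X]mulr_natr.
rewrite divfK ?pnatr_eq0 // subKr divff ?rp_scale_neq0 //.
Qed.

Definition rp_pt (t : simplex k) (s : R) : simplex k := mk_simplex (rp_ge0 t s)
  (rp_sum t s).
Definition rp_height (t : simplex k) (s : R) : R := 2 - (2 - clamp s)
  / rp_scale t s.

(** The maximum in [rp_scale] is attained, and the term attaining it tells whether the ray leaves
    through the bottom or through a side. *)
Lemma rp_cases t s : rp_height t s = 0 \/ exists i, coord (rp_pt t s) i = 0.
Proof.
have n0 := rp_scale_neq0 t s.
have [e|[i e]] := rp_scaleP t s; [left|right; exists i; rewrite coord_mk].
  rewrite /rp_height (_ : 2 - clamp s = 2 * rp_scale t s) ?mulfK ?subrr //.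
  by rewrite e; lra.
rewrite /rp_fun {1}e (_ : coord t i - _ = 0) ?mul0r //.
by rewrite subKr mulrC mulKf ?subrr // pnatr_eq0.
Qed.

Lemma rp_fix t s : rp_scale t s = 1 -> rp_pt t s = t /\ rp_height t s = clamp s.
Proof.
move=> e; split; last by rewrite /rp_height e divr1; lra.
by apply: coord_inj => i; rewrite coord_mk /rp_fun e subrr mul0r subr0 divr1.
Qed.

Lemma rp_bottom t : rp_scale t 0 = 1.
Proof.
apply/eqP; rewrite eq_le rp_scale_le1 /=.
by have := rp_scale_ge t 0; rewrite clamp0 mul0r subr0.
Qed.

Lemma rp_side t s i : coord t i = 0 -> rp_scale t s = 1.
Proof.
move=> ti; apply/eqP; rewrite eq_le rp_scale_le1 /=.
by have := rp_scale_ge_coord t s i; rewrite ti mulr0 subr0.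
Qed.

Lemma rp_clamp t s : rp_pt t (clamp s) = rp_pt t s /\ rp_height t (clamp s)
  = rp_height t s.
Proof.
have e : rp_scale t (clamp s) = rp_scale t s by rewrite /rp_scale clamp_clamp.
split; last by rewrite /rp_height e clamp_clamp.
by apply: coord_inj => i; rewrite !coord_mk /rp_fun e.
Qed.

Lemma rp_scale_continuous : continuous (fun ts : simplex k * R =>
  rp_scale ts.1 ts.2).
Proof.
rewrite /rp_scale; elim: (index_enum _) => [|i r IH].
  rewrite (_ : (fun _ => _) = fun ts : simplex k * R =>
    1 + - (clamp ts.2 * 2^-1)).
    apply: cts_add; first exact: cts_cst.
    apply: cts_opp; apply: cts_mul; last exact: cts_cst.
    by apply: cts_clamp; exact: cts_snd.
  by apply/funext => ts; rewrite big_nil.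
pose F := fun ts : simplex k * R => Num.max (1 + - (k.+1%:R * coord ts.1 i))
  (\big[Num.max/1 - clamp ts.2 / 2]_(i <- r) (1 - k.+1%:R * coord ts.1 i)).
rewrite (_ : (fun _ => _) = F).
  apply: cts_max => //; apply: cts_add; first exact: cts_cst.
  apply: cts_opp; apply: cts_mul; first exact: cts_cst.
  by apply: cts_comp (@continuous_coord R k i); exact: cts_fst.
by apply/funext => ts; rewrite big_cons.
Qed.

Lemma rp_pt_continuous : continuous (fun ts : simplex k * R => rp_pt ts.1 ts.2).
Proof.
apply: simplex_continuous => i; under eq_fun do rewrite coord_mk /rp_fun.
apply: cts_mul; last by apply: cts_inv => [ts|];
  [exact: rp_scale_neq0|exact: rp_scale_continuous].
apply: cts_add; first by apply: cts_comp (@continuous_coord R k i);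
  exact: cts_fst.
apply: cts_opp; apply: cts_mul; last exact: cts_cst.
apply: cts_add; first exact: cts_cst.
by apply: cts_opp; exact: rp_scale_continuous.
Qed.

Lemma rp_height_continuous : continuous (fun ts : simplex k * R =>
  rp_height ts.1 ts.2).
Proof.
apply: cts_add; first exact: cts_cst.
apply: cts_opp; apply: cts_mul; last by apply: cts_inv => [ts|];
  [exact: rp_scale_neq0|exact: rp_scale_continuous].
apply: cts_add; first exact: cts_cst.
by apply: cts_opp; apply: cts_clamp; exact: cts_snd.
Qed.

End RadialProjection.

Local Open Scope classical_set_scope.

(** * Extension skeleton by skeleton *)

Section HomotopyExtension.
Variable R : realType.
Local Notation simplex := (simplex R).
Local Notation "⟦ X ⟧" := (realization R X) (at level 0, format "⟦ X ⟧").
Variables (A B : sset) (j : smap A B).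
Hypothesis jinj : injective_smap j.
Variables (K T : topologicalType) (h0 : ⟦B⟧ * K -> T) (N : ⟦A⟧ * (K * R) -> T).
Hypotheses (ch0 : continuous h0) (cN : continuous N).
Hypothesis h0N : forall a k, N (a, (k, 0)) = h0 (realization_map j a, k).

(** [A] together with the [(k-1)]-skeleton of [B]. *)
Definition skel k n (b : B n) : Prop :=
  (exists a, b = j n a) \/
  exists m (f : delta n m) (c : B m), (m < k)%N /\ b = act f c.

Lemma skel_act k m n (f : delta m n) (b : B n) : skel k b -> skel k (act f b).
Proof.
case=> [[a ->]|[p [g [c [pk ->]]]]]; first by left; exists (act f a);
  rewrite sfun_act.
by right; exists p, (delta_comp g f), c; rewrite act_comp.
Qed.

Lemma skelS k n (b : B n) : skel k b -> skel k.+1 b.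
Proof.
case=> [h|[p [g [c [pk ->]]]]]; first by left.
by right; exists p, g, c; split => //; apply: leqW.
Qed.

Lemma skel_dim n (b : B n) : skel n.+1 b.
Proof. by right; exists n, (delta_id n), b; rewrite act_id. Qed.

Lemma skel_nonsurj k n (f : delta n k) (b : B k) : ~ surj_delta f ->
  skel k (act f b).
Proof.
move=> /nonsurj_delta_factor[m [h [d [mk ->]]]]; right.
by exists m, h, (act d b); rewrite act_comp.
Qed.

Lemma skel_surj k n (f : delta n k) (b : B k) : surj_delta f -> skel k (act f b)
  -> skel k b.
Proof.
move=> fs; have [d [fd _]] := surj_delta_section ord0 fs.
by move=> /(skel_act d); rewrite -act_comp fd act_id.
Qed.

Lemma skel_unique k n (f g : delta n k) (b c : B k) : ~ skel k b ->
  ~ skel k c ->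
  surj_delta f -> surj_delta g -> act f b = act g c -> f = g /\ b = c.
Proof.
move=> nb nc; apply: nondeg_act_unique => z [->|->] m h w mk e.
- by apply: nb; right; exists m, h, w.
- by apply: nc; right; exists m, h, w.
Qed.

(** A simplex new in this skeleton comes from dimension exactly [k], and by a surjection, since a
    non-surjective operator would land in the previous skeleton. *)
Lemma skelS_inv k n (x : B n) : skel k.+1 x -> ~ skel k x ->
  exists (f : delta n k) (b : B k), [/\ surj_delta f, ~ skel k b & x = act f b].
Proof.
case=> [h|[m [f [b [mk ->]]]]] nx; first by case: nx; left.
move: mk nx; rewrite ltnS leq_eqVlt => /predU1P[mk|mk] nx; last first.
  by case: nx; right; exists m, f, b.
subst m; exists f, b; split => //; last by move=> /(skel_act f).
by apply: contrapT => /skel_nonsurj h; exact: nx.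
Qed.

(** Values cell by cell, before passing to the quotient; [ext_act] is the compatibility that lets
    them descend. *)
Definition family := forall n, B n -> simplex n -> K * R -> T.

Record extension (S : forall n, B n -> Prop) (E : family) : Prop := Extension {
  ext_cts : forall n b, S n b -> continuous (fun tl : simplex n * (K * R) =>
    E n b tl.1 tl.2);
  ext_act : forall m n (f : delta m n) b t l, S n b -> E m (act f b)
    t l = E n b (simplex_push f t) l;
  ext_bottom : forall n b t k, S n b -> E n b t (k, 0) = h0 (pt b t, k);
  ext_side : forall n a t k s, E n (j n a) t (k, s) = N (pt a t, (k, clamp s));
  ext_clamp : forall n b t k s, S n b -> E n b t (k, clamp s) = E n b t (k, s)
    }.

Lemma extension0 : exists E, extension (skel 0) E.
Proof.
pose E : family := fun n b t l =>
  if pselect (exists a, b = j n a) is left h then N (pt (projT1 (cid h)) t,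
    (l.1, clamp l.2))
  else h0 (pt b t, l.1).
have EA n a t l : E n (j n a) t l = N (pt a t, (l.1, clamp l.2)).
  rewrite /E; case: pselect => [h|[]]; last by exists a.
  by case: cid => a' /= /jinj ->.
have S0 n (b : B n) : skel 0 b -> exists a, b = j n a.
  by case=> // -[m [f [c []]]].
exists E; split.
- move=> n b /S0[a ->]; under eq_fun do rewrite EA.
  apply: cts_comp cN; apply: cts_pair.
    by apply: cts_comp (@pt_continuous R A n a); exact: cts_fst.
  apply: cts_pair; first exact: (cts_comp (@cts_snd _ _) (@cts_fst _ _)).
  by apply: cts_clamp; exact: (cts_comp (@cts_snd _ _) (@cts_snd _ _)).
- by move=> m n f b t l /S0[a ->]; rewrite -sfun_act !EA pt_act.
- by move=> n b t k /S0[a ->]; rewrite EA /= clamp0 h0N realization_map_pt.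
- by move=> n a t k s; rewrite EA.
- by move=> n b t k s /S0[a ->]; rewrite !EA /= clamp_clamp.
Qed.

Section Step.
Variables (k : nat) (E : family).
Hypothesis eE : extension (skel k) E.

Definition fixes_supp n (e : delta n n) (t : simplex n) := forall i,
  0 < coord t i -> e i = i.

Lemma fixes_supp_push n (e : delta n n) (t : simplex n) : fixes_supp e t ->
  simplex_push e t = t.
Proof. by move=> h; rewrite -[RHS]simplex_push_id; apply: simplex_push_eq. Qed.

(** Compare both sides with the retraction onto the support of [t]. *)
Lemma boundary_indep (b : B k) (e e' : delta k k) (t : simplex k) l :
  ~ surj_delta e -> ~ surj_delta e' -> fixes_supp e t -> fixes_supp e' t ->
  E (act e b) t l = E (act e' b) t l.
Proof.
move=> ne ne' fe fe'; have [i ti] := supp_nonempty t.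
have [r [rS rid]] := retract_on (S := fun l => 0 < coord t l) ti.
have tr : simplex_push r t = t by apply: fixes_supp_push => l' /rid.
have h (d : delta k k) : ~ surj_delta d -> fixes_supp d t -> E (act d b)
  t l = E (act r b) t l.
  move=> nd fd; rewrite -{1}tr -(ext_act eE); last exact: skel_nonsurj.
  by rewrite -act_comp; congr (E (act _ b)); apply: delta_ext => a; exact: fd.
by rewrite h // h.
Qed.

(** This operator stands in for the [i]-th face: it retracts the vertices onto the complement of [i]
    and hence fixes every point of that face, without a change of dimension. *)
Lemma avoid_exists (i : 'I_k.+1) : (0 < k)%N -> exists e : delta k k,
  ~ surj_delta e /\ forall a, a != i -> e a = a.
Proof.
move=> k0; have [i' ii'] : exists i' : 'I_k.+1, i' != i.
  have [->|h] := eqVneq i ord0; last by exists ord0; rewrite eq_sym.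
  by exists ord_max; rewrite -val_eqE /= -lt0n.
have [e [eS eid]] := retract_on (S := fun a => a != i) ii'.
by exists e; split => // /(_ i)[a] ei; have := eS a; rewrite ei eqxx.
Qed.

(** For [k = 0] the boundary is empty and the value is arbitrary. *)
Definition avoid (i : 'I_k.+1) : delta k k :=
  if pselect (0 < k)%N is left h then projT1 (cid (avoid_exists i h))
    else delta_id k.

Lemma avoidP i : (0 < k)%N -> ~ surj_delta (avoid i) /\ forall a, a != i ->
  avoid i a = a.
Proof. by move=> k0; rewrite /avoid; case: pselect => // h; case: cid. Qed.

Lemma coord0_gt0 (t : simplex k) i : coord t i = 0 -> (0 < k)%N.
Proof.
move=> ti; rewrite lt0n; apply/negP => /eqP k0.
have := sum_coord t; rewrite big1 => [/esym/eqP|a _]; first by rewrite oner_eq0.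
suff -> : a = i by [].
by apply/val_inj; case: a i {ti} => a ha [i hi] /=; lia.
Qed.

Lemma avoid_fixes (t : simplex k) i : coord t i = 0 -> fixes_supp (avoid i) t.
Proof.
move=> ti a ta; apply: (avoidP i (coord0_gt0 ti)).2.
by apply/eqP => e; rewrite e ti ltxx in ta.
Qed.

(** Prescribed data on the bottom and the sides of the prism over [b]. Elsewhere the last branch is
    arbitrary; the radial projection never lands there. *)
Definition rim (b : B k) (t : simplex k) (l : K * R) : T :=
  if l.2 == 0 then h0 (pt b t, l.1)
  else if [pick i | coord t i == 0] is Some i then E (act (avoid i) b) t l
  else h0 (pt b t, l.1).

Lemma rim_bottom b t κ : rim b t (κ, 0) = h0 (pt b t, κ).
Proof. by rewrite /rim eqxx. Qed.

Lemma rim_side b t l i : coord t i = 0 -> rim b t l = E (act (avoid i) b) t l.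
Proof.
move=> ti; have k0 := coord0_gt0 ti; have [ns _] := avoidP i k0.
rewrite /rim; case: ifP => [/eqP l0|_].
  case: l l0 => κ s /= ->; rewrite (ext_bottom eE) ?pt_act;
    last exact: skel_nonsurj.
  by rewrite (fixes_supp_push (avoid_fixes ti)).
case: pickP => [i' /eqP ti'|/(_ i)]; last by rewrite ti eqxx.
apply: boundary_indep => //; [exact: (avoidP i' k0).1|exact: avoid_fixes|exact:
  avoid_fixes].
Qed.

Definition fill (b : B k) (t : simplex k) (l : K * R) : T :=
  rim b (rp_pt t l.2) (l.1, rp_height t l.2).

Lemma fill_bottom b t κ : fill b t (κ, 0) = h0 (pt b t, κ).
Proof. by rewrite /fill /=; have [-> ->] := rp_fix (rp_bottom t);
  rewrite clamp0 rim_bottom. Qed.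

Lemma fill_clamp b t κ s : fill b t (κ, clamp s) = fill b t (κ, s).
Proof. by rewrite /fill /=; have [-> ->] := rp_clamp t s. Qed.

(** A non-surjective [f] misses some vertex [i], so the pushed point lies on that side, where the
    radial projection only clamps the height and [rim] is given by [E]. *)
Lemma fill_side b n (f : delta n k) (t : simplex n) l : ~ surj_delta f ->
  fill b (simplex_push f t) l = E (act f b) t l.
Proof.
move=> nf; have [i fi] : exists i, forall a, f a != i.
  apply: contrapT => h; apply: nf => i; apply: contrapT => hi.
  by apply: h; exists i => a; apply/eqP => fa; apply: hi; exists a.
have ti : coord (simplex_push f t) i = 0.
  by rewrite coord_push big_pred0 // => a; exact/negbTE/fi.
have k0 := coord0_gt0 ti; have [ns av] := avoidP i k0.
case: l => κ s; rewrite /fill /=; have [-> ->] := rp_fix (rp_side s ti).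
rewrite (rim_side b _ ti) (ext_clamp eE); last exact: skel_nonsurj.
rewrite -(ext_act eE); last exact: skel_nonsurj.
rewrite -act_comp; congr (E (act _ b)); apply: delta_ext => a; exact: av.
Qed.

Lemma fill_continuous b : continuous (fun tl : simplex k * (K * R) =>
  fill b tl.1 tl.2).
Proof.
have cts2 : continuous (fun tl : simplex k * (K * R) => (tl.1, tl.2.2)).
  by apply: cts_pair; [exact: cts_fst|exact: (cts_comp (@cts_snd _ _)
    (@cts_snd _ _))].
have c1 : continuous (fun tl : simplex k * (K * R) => rp_pt tl.1 tl.2.2).
  exact: (cts_comp cts2 (@rp_pt_continuous R k)).
have c2 : continuous (fun tl : simplex k * (K * R) => rp_height tl.1 tl.2.2).
  exact: (cts_comp cts2 (@rp_height_continuous R k)).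
have cK : continuous (fun tl : simplex k * (K * R) => tl.2.1).
  exact: (cts_comp (@cts_snd _ _) (@cts_fst _ _)).
pose D : set (option 'I_k.+1) := [set o | if o is Some _ then (0 < k)%N : Prop
  else True].
pose C (o : option 'I_k.+1) : set (simplex k * (K * R)) :=
  if o is Some i then [set tl | coord (rp_pt tl.1 tl.2.2) i = 0]
    else [set tl | rp_height tl.1 tl.2.2 = 0].
pose G (o : option 'I_k.+1) (tl : simplex k * (K * R)) : T :=
  if o is Some i then E (act (avoid i) b) (rp_pt tl.1 tl.2.2) (tl.2.1,
    rp_height tl.1 tl.2.2)
  else h0 (pt b (rp_pt tl.1 tl.2.2), tl.2.1).
apply: (@continuous_closed_cover _ _ _ D C _ G).
- exact: finite_finset.
- case=> [i|] _ /=; apply: closed_eq0 => //.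
  exact: (cts_comp c1 (@continuous_coord R k i)).
- move=> tl; have [h|[i h]] := rp_cases tl.1 tl.2.2; first by exists None.
  by exists (Some i) => //; exact: coord0_gt0 h.
- case=> [i|] /= k0.
    have [ns _] := avoidP i k0.
    have cE := ext_cts eE (skel_nonsurj b ns).
    apply: (cts_comp (f := fun tl : simplex k * (K * R) =>
      (rp_pt tl.1 tl.2.2, (tl.2.1, rp_height tl.1 tl.2.2))) _ cE).
    by apply: cts_pair => //; exact: cts_pair.
  apply: cts_comp ch0; apply: cts_pair => //;
    exact: (cts_comp c1 (@pt_continuous R B k b)).
- case=> [i|] tl _ /= h; first exact: rim_side.
  by rewrite /fill h rim_bottom.
Qed.

(** A simplex outside the old skeleton is filled through a presentation by a surjection, which is
    unique by [skel_unique]. The last branch is arbitrary. *)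
Definition extend : family := fun n x t l =>
  if pselect (skel k x) then E x t l
  else if pselect (exists fb : delta n k * B k,
      [/\ surj_delta fb.1, ~ skel k fb.2 & x = act fb.1 fb.2]) is left h
    then let fb := projT1 (cid h) in fill fb.2 (simplex_push fb.1 t) l
  else E x t l.

Lemma extend_skel n (x : B n) t l : skel k x -> extend x t l = E x t l.
Proof. by move=> Sx; rewrite /extend; case: pselect. Qed.

Lemma extend_fill n (f : delta n k) (b : B k) t l : ~ skel k b ->
  extend (act f b) t l = fill b (simplex_push f t) l.
Proof.
move=> nb; have [fs|nf] := pselect (surj_delta f); last first.
  by rewrite extend_skel ?fill_side //; exact: skel_nonsurj.
rewrite /extend; case: pselect => [Sx|?]; first by case: nb;
  exact: skel_surj fs Sx.
case: pselect => [h|[]]; last by exists (f, b).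
case: cid => -[g c] /= [gs nc e].
by have [-> ->] := skel_unique nb nc fs gs e.
Qed.

Lemma extend_extension : extension (skel k.+1) extend.
Proof.
have cases n (x : B n) : skel k.+1 x -> skel k x \/
    exists (f : delta n k) (b : B k), ~ skel k b /\ x = act f b.
  move=> Sx; have [|nx] := pselect (skel k x); first by left.
  by right; have [f [b [_ nb ->]]] := skelS_inv Sx nx; exists f, b.
split.
- move=> n x /cases[Sx|[f [b [nb ->]]]].
    rewrite (_ : (fun _ => _) = (fun tl => E x tl.1 tl.2));
      first exact: ext_cts eE _ _ _.
    by apply/funext => tl; rewrite extend_skel.
  rewrite (_ : (fun _ => _) = (fun tl => fill b (simplex_push f tl.1) tl.2)).
    apply: (cts_comp (f := fun tl : simplex n * (K * R) => (simplex_push f tl.1,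
      tl.2))
      _ (@fill_continuous b)).
    apply: cts_pair; last exact: cts_snd.
    exact: (cts_comp (@cts_fst (simplex n) (K * R)%type)
      (@simplex_push_continuous R n k f)).
  by apply/funext => tl; rewrite extend_fill.
- move=> m n f x t l /cases[Sx|[g [b [nb ->]]]].
    by rewrite !extend_skel ?(ext_act eE) //; exact: skel_act.
  by rewrite -act_comp !extend_fill // simplex_push_comp.
- move=> n x t κ /cases[Sx|[f [b [nb ->]]]]; first by rewrite extend_skel
  ?(ext_bottom eE).
  by rewrite extend_fill // fill_bottom pt_act.
- by move=> n a t κ s; rewrite extend_skel ?(ext_side eE) //; left; exists a.
- move=> n x t κ s /cases[Sx|[f [b [nb ->]]]];
  first by rewrite !extend_skel ?(ext_clamp eE).
  by rewrite !extend_fill // fill_clamp.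
Qed.

End Step.

Lemma extension_total : exists E, extension (fun _ _ => True) E.
Proof.
have [E0 eE0] := extension0.
pose next k (e : {E | extension (skel k) E}) : {E | extension (skel k.+1) E} :=
  exist _ _ (extend_extension (svalP e)).
pose fix seq k : {E | extension (skel k) E} :=
  if k is k'.+1 then next k' (seq k') else exist _ E0 eE0.
have seq_le k l n (x : B n) t y : (k <= l)%N -> skel k x -> sval (seq l)
  n x t y = sval (seq k) n x t y.
  move=> kl Sx; rewrite -(subnKC kl); elim: (l - k)%N => [|d IH];
    first by rewrite addn0.
  rewrite addnS /= extend_skel // -[k]/(k); move: Sx.
  have up d' : skel k x -> skel (k + d') x.
    by elim: d' => [|d' IHd] h; rewrite ?addn0 // addnS; apply/skelS/IHd.
  exact: up.
(* Simplices of dimension [n] enter the skeleton at stage [n.+1], and later stages no longer change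
   their values. *)
pose E : family := fun n x => sval (seq n.+1) n x.
have EE n (x : B n) t y l : (n < l)%N -> E n x t y = sval (seq l) n x t y.
  by move=> nl; rewrite /E (seq_le n.+1 l) //; exact: skel_dim.
exists E; split.
- by move=> n x _; apply: (ext_cts (svalP (seq n.+1))); exact: skel_dim.
- move=> m n f x t y _; rewrite (EE m _ _ _ (maxn m n).+1) ?ltnS ?leq_maxl //.
  rewrite (EE n _ _ _ (maxn m n).+1) ?ltnS ?leq_maxr //.
  apply: (ext_act (svalP (seq (maxn m n).+1))).
  have Sn := skel_dim x; move: Sn.
  have up d' : skel n.+1 x -> skel (n.+1 + d') x.
    by elim: d' => [|d' IHd] h; rewrite ?addn0 // addnS; apply/skelS/IHd.
  by move=> /(up (maxn m n - n)%N); rewrite addSn subnKC // leq_maxr.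
- by move=> n x t κ _; apply: (ext_bottom (svalP (seq n.+1))); exact: skel_dim.
- by move=> n a t κ s; apply: (ext_side (svalP (seq n.+1))).
- by move=> n x t κ s _; apply: (ext_clamp (svalP (seq n.+1))); exact: skel_dim.
Qed.

(** With the line as parameter space [K], a homotopy between homotopies can be extended as well. *)
Theorem homotopy_extension : compactly_based K ->
  exists M : ⟦B⟧ * (K * R) -> T, [/\ continuous M,
    forall b κ, M (b, (κ, 0)) = h0 (b, κ) &
    forall a κ s, M (realization_map j a, (κ, s)) = N (a, (κ, clamp s))].
Proof.
move=> bK; have [E eE] := extension_total.
have FE m n (f : delta m n) (x : B n) t : E m (act f x)
  t = E n x (simplex_push f t).
  by apply/funext => l; rewrite (ext_act eE).
exists (fun p => rlift E p.1 p.2); split.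
- apply: realization_continuous2.
    by apply: compactly_based_prod => //; exact: compactly_based_real.
  move=> n x /=; rewrite (_ : (fun _ => _) = (fun tl => E n x tl.1 tl.2));
    first exact: (ext_cts eE).
  by apply/funext => tl; rewrite rlift_pt.
- by move=> b κ; elim/pt_ind: b => n x t /=; rewrite rlift_pt // (ext_bottom
  eE).
- by move=> a κ s; elim/pt_ind: a => n x t /=;
  rewrite realization_map_pt rlift_pt // (ext_side eE).
Qed.

End HomotopyExtension.

Local Open Scope classical_set_scope.

(** * Weak equivalences *)

Section InjectiveEquivalences.
Variable R : realType.
Local Notation simplex := (simplex R).
Local Notation "⟦ X ⟧" := (realization R X) (at level 0, format "⟦ X ⟧").
Local Notation rmapR f := (@realization_map R _ _ f).

(** The homotopy from the inverse [g0] composed with the map to the identity, extended over [B]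
    starting from [g0], ends at a strict left inverse still homotopic to [g0]. *)
Lemma strict_retraction (A B : sset) (j : smap A B) : injective_smap j ->
  heq R (rmapR j) ->
  exists g : ⟦B⟧ -> ⟦A⟧, [/\ continuous g, forall a, g (rmapR j a)
    = a & htpy R id (rmapR j \o g)].
Proof.
move=> jinj [cj [g0 [cg0 [G [cG G0 G1]] j0]]].
pose h0 (p : ⟦B⟧ * R) := g0 p.1.
pose N (p : ⟦A⟧ * (R * R)) := G (p.1, p.2.2).
have ch0 : continuous h0 by apply: cts_comp cg0; exact: cts_fst.
have cN : continuous N.
  apply: cts_comp cG; apply: cts_pair; first exact: cts_fst.
  exact: (cts_comp (@cts_snd _ _) (@cts_snd _ _)).
have [|M [cM M0 MA]] := homotopy_extension jinj ch0 cN _ (@compactly_based_real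
  R).
  by move=> a κ; rewrite /N /h0 /= G0.
have cMf : continuous (fun p : ⟦B⟧ * R => M (p.1, (0, p.2))).
  apply: cts_comp cM; apply: cts_pair; first exact: cts_fst.
  by apply: cts_pair; [exact: cts_cst|exact: cts_snd].
exists (fun b => M (b, (0, 1))); split.
- apply: (cts_comp (f := fun b : ⟦B⟧ => (b, 1 : R)) _ cMf).
  by apply: cts_pair; [exact: cts_id|exact: cts_cst].
- by move=> a; rewrite MA /N /= clamp1 G1.
- apply: htpy_sym; apply: htpy_trans j0; apply: htpy_compl => //;
  apply: htpy_sym.
  by exists (fun p : ⟦B⟧ * R => M (p.1, (0, p.2))); split => // b; rewrite M0.
Qed.

(** With [K] a homotopy from [id] to [J g], where [J] realizes [j], run [K] at
    [b] and then backwards at [J g b]. On [A] this is a loop traversed forth and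
    back; contracting it there and extending the contraction to [B], the other
    three sides of the square are a homotopy relative to [A]. *)
Definition tent (s : R) : R := Num.min (s *+ 2) (2 + - (s *+ 2)).

Lemma tentl s : s <= 2^-1 -> tent s = s *+ 2.
Proof. by move=> h; rewrite /tent min_l // mulr2n; lra. Qed.

Lemma tentr s : 2^-1 < s -> tent s = 1 + - (s *+ 2 - 1).
Proof. by move=> h; rewrite /tent min_r mulr2n; lra. Qed.

Lemma tent0 : tent 0 = 0.
Proof. by rewrite tentl ?mul0rn // invr_ge0 ler0n. Qed.

Lemma tent1 : tent 1 = 0.
Proof. by rewrite tentr; lra. Qed.

Lemma heq_sdr (A B : sset) (j : smap A B) : injective_smap j -> heq R (rmapR j)
  -> sdr R j.
Proof.
move=> jinj hj; have [g [cg gj [Kh [cK K0 K1]]]] := strict_retraction jinj hj.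
have cj : continuous (rmapR j) by exact: realization_map_continuous.
pose K' (p : ⟦B⟧ * R) := Kh (rmapR j (g p.1), 1 + - p.2).
have cK' : continuous K'.
  apply: cts_comp cK; apply: cts_pair.
    by apply: (cts_comp (f := fun p : ⟦B⟧ * R => g p.1)) => //;
      apply: cts_comp cg; exact: cts_fst.
  by apply: cts_add; [exact: cts_cst|apply: cts_opp; exact: cts_snd].
have KK' b : Kh (b, 1) = K' (b, 0) by rewrite /K' /= oppr0 addr0 !K1 /= gj.
pose L := hconcat Kh K'.
have cL : continuous L by exact: hconcat_continuous.
have La a s : L (rmapR j a, s) = Kh (rmapR j a, tent s).
  rewrite /L /hconcat /K' /=; case: ifP => [h|/negbT]; last rewrite -ltNge => h.
    by rewrite tentl.
  by rewrite gj tentr.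
(* The second parameter scales the time travelled along the loop from its full value down to 0. *)
pose N (p : ⟦A⟧ * (R * R)) := Kh (rmapR j p.1, (1 + - p.2.2) * tent p.2.1).
have c21 : continuous (fun p : ⟦A⟧ * (R * R) => p.2.1).
  exact: (cts_comp (@cts_snd _ _) (@cts_fst _ _)).
have c22 : continuous (fun p : ⟦A⟧ * (R * R) => p.2.2).
  exact: (cts_comp (@cts_snd _ _) (@cts_snd _ _)).
have cdbl : continuous (fun p : ⟦A⟧ * (R * R) => p.2.1 *+ 2).
  by rewrite (_ : (fun _ => _) = (fun p : ⟦A⟧ * (R * R) => p.2.1 + p.2.1)) //;
    exact: cts_add.
have cN : continuous N.
  apply: cts_comp cK; apply: cts_pair; first by apply: cts_comp cj;
    exact: cts_fst.
  apply: cts_mul; first by apply: cts_add; [exact: cts_cst|exact: cts_opp].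
  apply: cts_min => //; apply: cts_add; [exact: cts_cst|exact: cts_opp].
have [|M [cM M0 MA]] := homotopy_extension jinj cL cN _ (@compactly_based_real
  R).
  by move=> a s; rewrite /N /= oppr0 addr0 mul1r La.
have MA0 a u : M (rmapR j a, (0, u)) = rmapR j a by rewrite MA /N /= tent0 mulr0
  K0.
have MA1 a u : M (rmapR j a, (1, u)) = rmapR j a by rewrite MA /N /= tent1 mulr0
  K0.
have MAs a s : M (rmapR j a, (s, 1)) = rmapR j a.
  by rewrite MA /N /= clamp1 subrr mul0r K0.
(* The path around the square runs from the corner (0, 0) through (0, 1) and (1, 1) to (1, 0); on
   [A] the contraction is constant along all three sides. *)
pose P1 (p : ⟦B⟧ * R) := M (p.1, (0, p.2)).
pose P2 (p : ⟦B⟧ * R) := M (p.1, (p.2, 1)).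
pose P3 (p : ⟦B⟧ * R) := M (p.1, (1, 1 + - p.2)).
have c1 : continuous P1.
  apply: cts_comp cM; apply: cts_pair; first exact: cts_fst.
  by apply: cts_pair; [exact: cts_cst|exact: cts_snd].
have c2 : continuous P2.
  apply: cts_comp cM; apply: cts_pair; first exact: cts_fst.
  by apply: cts_pair; [exact: cts_snd|exact: cts_cst].
have c3 : continuous P3.
  apply: cts_comp cM; apply: cts_pair; first exact: cts_fst.
  apply: cts_pair; first exact: cts_cst.
  by apply: cts_add; [exact: cts_cst|apply: cts_opp; exact: cts_snd].
have P12 b : P1 (b, 1) = P2 (b, 0) by [].
have P23 b : hconcat P1 P2 (b, 1) = P3 (b, 0)
  by rewrite hconcat1 /P2 /P3 /= oppr0 addr0.
exists g, (hconcat (hconcat P1 P2) P3); split => //.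
- by do ?apply: hconcat_continuous.
- move=> b; rewrite hconcat0 hconcat0 hconcat1 /P1 /P3 /= subrr !M0 /L hconcat0
  K0.
  by rewrite hconcat1 /K' /= subrr K0.
- move=> a r; rewrite /hconcat /P1 /P2 /P3 /=.
  by case: ifP => _; [case: ifP => _|]; rewrite ?MA0 ?MAs ?MA1.
Qed.

Section PushoutProduct.
Variables (A B A' B' : sset) (j : smap A B) (j' : smap A' B').

Definition pprod : sset := pushout (sprod_map j (smap_id A'))
  (sprod_map (smap_id A) j').

Lemma pprod_incl_subproof n (x : sprod A A' n) :
  sprod_map (smap_id B) j' n (sprod_map j (smap_id A') n x) =
  sprod_map j (smap_id B') n (sprod_map (smap_id A) j' n x).
Proof. by []. Qed.

Definition pprod_incl : smap pprod (sprod B B') := po_case pprod_incl_subproof.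

Hypotheses (jinj : injective_smap j) (j'inj : injective_smap j').

Lemma pprod_incl_inj : injective_smap pprod_incl.
Proof.
move=> n; apply: po_ind => -[x y]; apply: po_ind => -[x' y'];
  rewrite /pprod_incl ?po_case_inl ?po_case_inr /= => -[].
- by move=> -> /j'inj ->.
- move=> -> <-; exact: (@po_glue _ _ _ (sprod_map j (smap_id A'))
  (sprod_map (smap_id A) j') n (x', y)).
- move=> <- ->; apply/esym.
  exact: (@po_glue _ _ _ (sprod_map j (smap_id A')) (sprod_map (smap_id A) j')
    n (x, y')).
- by move=> /jinj -> ->.
Qed.

(** The inclusion of [A * B'] into the pushout-product is a pushout of [j * A'], and its composite
    with [pprod_incl] is [j * B']. Two-out-of-three makes [pprod_incl] an equivalence, and
    injectivity makes it a strong deformation retract. *)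
Lemma sdr_pprod : sdr R j -> sdr R pprod_incl.
Proof.
move=> sj; apply: heq_sdr; first exact: pprod_incl_inj.
apply: (@heq_cancelr R _ _ _ (rmapR (po_inr (sprod_map j (smap_id A'))
  (sprod_map (smap_id A) j')))).
- exact: realization_map_continuous.
- by apply/sdr_heq/sdr_pushout/sdr_prod.
- rewrite (_ : _ \o _ = rmapR (sprod_map j (smap_id B')));
  first exact/sdr_heq/sdr_prod.
  apply/funext => p.
  rewrite -(@realization_map_eq R _ _ (smap_comp pprod_incl (po_inr _ _))
    _ _ p).
    by rewrite realization_map_comp.
  by move=> n x; rewrite [LHS]/= /pprod_incl po_case_inr.
Qed.

End PushoutProduct.

Lemma heq_smap_bij (A B : sset) (f : smap A B) : injective_smap f ->
  (forall n y, exists x, y = f n x) -> heq R (rmapR f).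
Proof.
move=> finj fsurj; pose g n y := projT1 (cid (fsurj n y)).
have gK n y : f n (g n y) = y by rewrite /g; case: cid.
have g_act m n (h : delta m n) y : g m (act h y) = act h (g n y).
  by apply: finj; rewrite gK sfun_act gK.
apply: (@heq_smap_iso R A B f (SMap g_act)) => n x //=.
by apply: finj; rewrite gK.
Qed.

End InjectiveEquivalences.

(** * Contracting standard simplices to a vertex *)

Section Interval.
Variable R : realType.
Local Notation simplex := (simplex R).
Local Notation "⟦ X ⟧" := (realization R X) (at level 0, format "⟦ X ⟧").
Local Notation rmapR f := (@realization_map R _ _ f).

Program Definition std_simplex k : sset :=
  @SSet (fun n => delta n k) (fun m n f g => delta_comp g f) _ _.
Next Obligation. by move=> k n x; apply: delta_ext. Qed.
Next Obligation. by move=> k l m n g f x; apply: delta_ext. Qed.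

Definition cst_delta n k (i : 'I_k.+1) : delta n k :=
  mk_delta (f := fun _ : 'I_n.+1 => i) (fun _ _ _ => leqnn i).

Lemma std_vertex_subproof k (i : 'I_k.+1) m n (h : delta m n) (x : unit) :
  cst_delta m i = delta_comp (cst_delta n i) h.
Proof. exact: delta_ext. Qed.

Definition std_vertex k (i : 'I_k.+1) : smap (const_sset unit) (std_simplex k)
  :=
  @SMap (const_sset unit) (std_simplex k) (fun n _ => cst_delta n i)
    (std_vertex_subproof i).

Lemma mix_ge0 k (t u : simplex k) (s : R) i : 0 <= (1 - clamp s)
  * coord t i + clamp s * coord u i.
Proof.
have := clamp_ge0 s; have := clamp_le1 s => h1 h0.
by rewrite addr_ge0 ?mulr_ge0 ?coord_ge0 ?subr_ge0.
Qed.

Lemma mix_sum k (t u : simplex k) (s : R) : \sum_i ((1 - clamp s)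
  * coord t i + clamp s * coord u i) = 1.
Proof. by rewrite big_split /= -!mulr_sumr !sum_coord !mulr1 subrK. Qed.

Definition mix k (t u : simplex k) (s : R) : simplex k :=
  mk_simplex (mix_ge0 t u s) (mix_sum t u s).

Lemma mix0 k (t u : simplex k) : mix t u 0 = t.
Proof. by apply: coord_inj => i; rewrite coord_mk clamp0 subr0 mul1r mul0r
  addr0. Qed.

Lemma mix1 k (t u : simplex k) : mix t u 1 = u.
Proof. by apply: coord_inj => i; rewrite coord_mk clamp1 subrr mul1r mul0r
  add0r. Qed.

Lemma mixx k (t : simplex k) s : mix t t s = t.
Proof. by apply: coord_inj => i; rewrite coord_mk -mulrDl subrK mul1r. Qed.

Lemma mix_continuous k (u : simplex k) : continuous (fun ts : simplex k * R =>
  mix ts.1 u ts.2).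
Proof.
apply: simplex_continuous => i; under eq_fun do rewrite coord_mk.
have cc : continuous (fun ts : simplex k * R => clamp ts.2) by apply: cts_clamp;
  exact: cts_snd.
apply: cts_add; apply: cts_mul => //; try exact: cts_cst.
  by apply: cts_add; [exact: cts_cst|exact: cts_opp].
by apply: cts_comp (@continuous_coord R k i); exact: cts_fst.
Qed.

Lemma vertex0_unique (t u : simplex 0) : t = u.
Proof.
apply: coord_inj => i.
by have := sum_coord t; have := sum_coord u; rewrite !big_ord1 (ord1 i) => ->
  ->.
Qed.

(** The composite of [chart] followed by [q] is the identity, so the linear contraction of the
    topological simplex to a vertex carries over to the realization. *)
Lemma sdr_std_vertex k (i : 'I_k.+1) : sdr R (std_vertex i).
Proof.
pose z : simplex 0 := @mk_simplex R 0 (fun=> 1) (fun=> ler01) (big_ord1 _ _).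
have pt1 (p : ⟦const_sset unit⟧) : p = @pt R (const_sset unit) 0 tt z.
  elim/pt_ind: p => n [] t.
  have := @pt_act R (const_sset unit) n 0 (cst_delta n ord0) tt t.
  by rewrite (vertex0_unique (simplex_push _ _) z).
pose chart : ⟦std_simplex k⟧ -> simplex k :=
  rlift (X := std_simplex k) (fun n (f : delta n k) t => simplex_push f t).
have chartE n (f : delta n k) t : chart (@pt R (std_simplex k) n f t)
  = simplex_push f t.
  by rewrite /chart rlift_pt // => *; exact: simplex_push_comp.
pose q (t : simplex k) : ⟦std_simplex k⟧ := @pt R (std_simplex k) k (delta_id k)
  t.
have qchart p : q (chart p) = p.
  elim/pt_ind: p => n f t; rewrite chartE /q -pt_act; congr pt.
  exact: delta_ext.
pose u : simplex k := simplex_push (cst_delta 0 i) z.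
have cchart : continuous chart.
  apply: realization_continuous => n f; under eq_fun do rewrite chartE.
  exact: simplex_push_continuous.
have vE p : rmapR (std_vertex i) p = q u.
  rewrite (pt1 p) realization_map_pt -[LHS]qchart chartE //.
exists (fun=> @pt R (const_sset unit) 0 tt z), (fun p => q (mix (chart p.1)
  u p.2)); split.
- exact: cts_cst.
- apply: (cts_comp (f := fun p : ⟦std_simplex k⟧ * R => mix (chart p.1) u p.2));
  last exact: pt_continuous.
  apply: (cts_comp (f := fun p : ⟦std_simplex k⟧ * R => (chart p.1, p.2))
    _ (@mix_continuous k u)).
  by apply: cts_pair; [apply: cts_comp cchart; exact: cts_fst|exact: cts_snd].
- by move=> a; rewrite (pt1 a).
- by move=> p /=; rewrite mix0 mix1 vE.
- move=> a r /=; rewrite vE; congr q.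
  by rewrite chartE simplex_push_id mixx.
Qed.

End Interval.

(** * Smash products preserve weak equivalences *)

Section SmashEquivalences.
Variables (R : realType) (X : sabgroup) (T : functor (prod_cat (R_ X) (R_ X))
  (R_ X)).
Variable sm : smash_spec T.
Implicit Types Y Z W : retr X.
Local Notation rmapR f := (@realization_map R _ _ f).

(** The smash product [Z ∧ W] is the pushout of [Z * W] and [Y ∧ W] along the
    pushout-product of [f] with the section of [W]. *)
Section Injective.
Variables (Y Z W : retr X) (f : rhom Y Z).
Hypothesis finj : injective_smap f.

Let incl := pprod_incl f (sec W).

Program Definition fold_wedge : smap (sprod Z X) (T (Y, W)) :=
  @SMap (sprod Z X) (T (Y, W))
    (fun n p => sec (T (Y, W)) n ((ret Z n p.1 : sab X n) + p.2)) _.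
Next Obligation.
move=> m n h [z x] /=; rewrite -sfun_act; congr (sec _ _ _).
by rewrite /= raddfD (sfun_act (ret Z) h z).
Qed.

Program Definition smash_quot (V V' : retr X) : smap (sprod V V') (T (V, V')) :=
  @SMap (sprod V V') (T (V, V')) (fun n p => spair sm p.1 p.2) _.
Next Obligation. by move=> V V' m n h [y w] /=; rewrite act_spair. Qed.

Lemma wedge_fold_subproof n (p : sprod Y X n) :
  fold_wedge n (sprod_map f (smap_id X) n p) =
  smash_quot Y W n (sprod_map (smap_id Y) (sec W) n p).
Proof.
by rewrite /= (spair_collapsed sm (collapsed_secr _ _ _)) rmap_ret /retsum retK.
Qed.

Definition wedge_fold : smap (pprod f (sec W)) (T (Y, W)) :=
  po_case wedge_fold_subproof.

Lemma smash_po_subproof n (p : pprod f (sec W) n) :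
  smash_quot Z W n (incl n p) = smash_map T f (rhom_id W) n (wedge_fold n p).
Proof.
elim/po_ind: p => -[z w]; rewrite /incl /pprod_incl /wedge_fold !(po_case_inl,
  po_case_inr) /=.
  by rewrite (spair_collapsed sm (collapsed_secr _ _ _)) rmap_sec /retsum retK.
by rewrite (smash_mapE sm).
Qed.

Definition smash_po : smap (pushout incl wedge_fold) (T (Z, W)) :=
  po_case smash_po_subproof.

Lemma smash_po_surj n p : exists x, p = smash_po n x.
Proof.
elim/(spair_ind sm): p => z w; exists (po_inl incl wedge_fold n (z, w)).
by rewrite /smash_po po_case_inl.
Qed.

(** A pair that is collapsed or comes from [f] can be moved to the side of [Y] and [W], where the
    smashed map is already injective; all other pairs are determined by their class. *)
Lemma smash_po_inj : injective_smap smash_po.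
Proof.
have inclI : injective_smap incl by apply: pprod_incl_inj => // n;
  exact: sec_inj.
have fI : injective_smap (smash_map T f (rhom_id W))
  by apply: (smash_map_inj sm finj) => n x y.
pose il n z w := po_inl incl wedge_fold n ((z, w) : sprod Z W n).
have glue n (z : Z n) (w : W n) : collapsed z w ->
    (exists y, z = f n y) \/ (exists x, w = sec W n x) ->
    il n z w = po_inr incl wedge_fold n (sec (T (Y, W)) n (retsum z w)).
  move=> c; case=> [[y zy]|[x ->]].
    have -> : il n z w = po_inl incl wedge_fold n (incl n (po_inr _ _ n ((y, w)
      : sprod Y W n))).
      by rewrite /incl /pprod_incl po_case_inr /= -zy.
    rewrite po_glue; congr (po_inr _ _ _ _).
    rewrite /wedge_fold po_case_inr /= (spair_collapsed sm)
      ?zy /retsum ?rmap_ret //.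
    case: c => -[x e]; [left|right]; exists x => //; apply: finj.
    by rewrite rmap_sec -zy.
  have -> : il n z (sec W n x) = po_inl incl wedge_fold n (incl n (po_inl _ _ n
    ((z, x) : sprod Z X n))).
    by rewrite /incl /pprod_incl po_case_inl.
  rewrite po_glue; congr (po_inr _ _ _ _).
  by rewrite /wedge_fold po_case_inl /= /retsum retK.
(* A collapsed pair always lies in the pushout-product, since a section simplex of [Z] is the image
   under [f] of one of [Y]. *)
have glue' n (z : Z n) (w : W n) : collapsed z w ->
    il n z w = po_inr incl wedge_fold n (sec (T (Y, W)) n (retsum z w)).
  move=> c; apply: glue (c) _; case: c => -[x e]; [left|by right; exists x].
  by exists (sec Y n x); rewrite rmap_sec.
have lr n z w q : spair sm z w = smash_map T f (rhom_id W) n q ->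
    il n z w = po_inr incl wedge_fold n q.
  elim/(spair_ind sm): q => y w'; rewrite (smash_mapE sm) => e.
  have := congr1 (ret (T (Z, W)) n) e; rewrite !ret_spair => re.
  have [[-> ->]|[c c']] := spair_eq e.
    have -> : il n (f n y) w' = po_inl incl wedge_fold n (incl n (po_inr _ _ n
      ((y, w') : sprod Y W n))).
      by rewrite /incl /pprod_incl po_case_inr.
    by rewrite po_glue; congr (po_inr _ _ _ _); rewrite /wedge_fold po_case_inr.
  rewrite glue' //; congr (po_inr _ _ _ _); apply: fI.
  by rewrite rmap_sec -(spair_collapsed sm c) e (smash_mapE sm).
move=> n; apply: po_ind => [[z w]|q]; apply: po_ind => [[z' w']|q'];
  rewrite /smash_po !(po_case_inl, po_case_inr) => e.
- have {}e : spair sm z w = spair sm z' w' := e.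
  have := congr1 (ret (T (Z, W)) n) e; rewrite !ret_spair => re.
  have [[-> ->]//|[c c']] := spair_eq e.
  by have := glue' n z w c; have := glue' n z' w' c'; rewrite /il => -> ->;
    rewrite re.
- exact: lr.
- by apply/esym/lr/esym.
- by rewrite (fI _ _ _ e).
Qed.

(** Up to the bijection [smash_po], the map is a pushout of the pushout-product of [f] with the
    section of [W], which is a strong deformation retract. *)
Lemma heq_smash_inj : heq R (rmapR f) -> heq R (rmapR (smash_map T f (rhom_id
  W))).
Proof.
move=> hf; have inclS : sdr R incl.
  by apply: sdr_pprod => //; [move=> n; exact: sec_inj|exact: heq_sdr].
have -> : rmapR (smash_map T f (rhom_id W)) = rmapR smash_po \o rmapR (po_inr
  incl wedge_fold).
  apply/funext => p.
  rewrite -(@realization_map_eq R _ _ (smap_comp smash_po (po_inr _ _)) _ _ p).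
    by rewrite realization_map_comp.
  by move=> n x; rewrite [LHS]/= /smash_po po_case_inr.
apply: heq_comp; first exact/sdr_heq/sdr_pushout.
apply: heq_smap_bij; [exact: smash_po_inj|exact: smash_po_surj].
Qed.

End Injective.

(** The reduced mapping cylinder of [f]: [X * Delta^1] is collapsed to [X]. *)
Section Cylinder.
Variables (Y Z : retr X) (f : rhom Y Z).

Let I := std_simplex 1.
Let top : smap (const_sset unit) I := std_vertex (ord_max : 'I_2).
Let bot n : I n := cst_delta n ord0.
Let incl := pprod_incl top (sec Y).

Program Definition cyl_collapse : smap (sprod I X) Z :=
  @SMap (sprod I X) Z (fun n p => sec Z n p.2) _.
Next Obligation. by move=> m n h [d x] /=; rewrite -sfun_act. Qed.

Program Definition cyl_end : smap (sprod (const_sset unit) Y) Z :=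
  @SMap (sprod (const_sset unit) Y) Z (fun n p => f n p.2) _.
Next Obligation. by move=> m n h [d x] /=; rewrite sfun_act. Qed.

Lemma cyl_attach_subproof n (p : sprod (const_sset unit) X n) :
  cyl_collapse n (sprod_map top (smap_id X) n p)
    = cyl_end n (sprod_map (smap_id _) (sec Y) n p).
Proof. by rewrite /= rmap_sec. Qed.

Definition cyl_attach : smap (pprod top (sec Y)) Z :=
  po_case cyl_attach_subproof.

Program Definition cyl_proj : smap (sprod I Y) Z :=
  @SMap (sprod I Y) Z (fun n p => f n p.2) _.
Next Obligation. by move=> m n h [d x] /=; rewrite sfun_act. Qed.

Lemma cyl_proj_subproof n (p : pprod top (sec Y) n) :
  cyl_proj n (incl n p) = smap_id Z n (cyl_attach n p).
Proof.
elim/po_ind: p => -[d y]; rewrite /incl /pprod_incl /cyl_attach !(po_case_inl,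
  po_case_inr) //=.
by rewrite rmap_sec.
Qed.

Let pr : smap (pushout incl cyl_attach) Z := po_case cyl_proj_subproof.

Program Definition cylinder : retr X :=
  @Retr X (pushout incl cyl_attach) (smap_comp (ret Z) pr)
    (smap_comp (po_inr incl cyl_attach) (sec Z)) _.
Next Obligation. by move=> n x; rewrite /= /pr po_case_inr retK. Qed.

Program Definition cyl_pr : rhom cylinder Z := @RHom X cylinder Z pr _ _.
Next Obligation. by []. Qed.
Next Obligation. by move=> n x; rewrite /= /pr po_case_inr. Qed.

Program Definition cyl_top : rhom Z cylinder :=
  @RHom X Z cylinder (po_inr incl cyl_attach) _ _.
Next Obligation. by move=> n z; rewrite /= /pr po_case_inr. Qed.
Next Obligation. by []. Qed.

Program Definition cyl_bot_map : smap Y cylinder :=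
  @SMap Y cylinder (fun n y => po_inl incl cyl_attach n ((bot n, y)
    : sprod I Y n)) _.
Next Obligation.
move=> m n h y; rewrite -sfun_act; congr (po_inl _ _ _ _) => /=.
by congr pair; apply: delta_ext.
Qed.

Program Definition cyl_bot : rhom Y cylinder :=
  @RHom X Y cylinder cyl_bot_map _ _.
Next Obligation. by move=> n y; rewrite /= /pr po_case_inl /= rmap_ret. Qed.
Next Obligation.
move=> n x /=.
have -> : ((bot n, sec Y n x) : sprod I Y n) = incl n (po_inl _ _ n ((bot n, x)
  : sprod I X n)).
  by rewrite /incl /pprod_incl po_case_inl.
by rewrite po_glue /cyl_attach po_case_inl.
Qed.

Lemma top_inj : injective_smap top.
Proof. by move=> n [] []. Qed.

Lemma cyl_incl_inj : injective_smap incl.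
Proof. by apply: pprod_incl_inj; [exact: top_inj|move=> n; exact: sec_inj]. Qed.

(** The bottom vertex differs from the top one, so the bottom end meets the attaching subobject only
    over the section, where the attaching map is injective. *)
Lemma cyl_bot_inj : injective_smap cyl_bot.
Proof.
have key n y p : ((bot n, y) : sprod I Y n) = incl n p -> exists2 x,
  y = sec Y n x & cyl_attach n p = sec Z n x.
  elim/po_ind: p => -[d x]; rewrite /incl /pprod_incl /cyl_attach !(po_case_inl,
    po_case_inr) /=.
    by move=> /(congr1 snd) /= ->; exists x.
  move=> /(congr1 fst) /= e.
  by have := congr1 (fun h : delta n 1 => h ord0) e.
move=> n y y' /= /(po_inl_eq (@cyl_incl_inj n))[[//]|[p [p' [/key[x -> ->]
  /key[x' -> ->]]]]].
by move=> /sec_inj ->.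
Qed.

Lemma cyl_top_inj : injective_smap cyl_top.
Proof. by move=> n; apply: po_inr_inj; exact: cyl_incl_inj. Qed.

(** The top end is a pushout of the pushout-product of a vertex of the interval with the section of
    [Y], and the vertex is a deformation retract of the interval. *)
Lemma cyl_top_heq : heq R (rmapR cyl_top).
Proof.
apply/sdr_heq/sdr_pushout/sdr_pprod; [exact: top_inj|by move=> n;
  exact: sec_inj|].
exact: sdr_std_vertex.
Qed.

Lemma cyl_pr_top : rhom_comp cyl_pr cyl_top = rhom_id Z.
Proof. by apply: rhom_ext => n z; rewrite /= /pr po_case_inr. Qed.

Lemma cyl_pr_bot : rhom_comp cyl_pr cyl_bot = f.
Proof. by apply: rhom_ext => n y; rewrite /= /pr po_case_inl. Qed.

End Cylinder.

Lemma realization_rhom_comp Y Z W (g : rhom Z W) (f : rhom Y Z) :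
  rmapR g \o rmapR f = rmapR (rhom_comp g f).
Proof. by apply/funext => p; rewrite /= -realization_map_comp. Qed.

Lemma heq_rhom_id Y : heq R (rmapR (rhom_id Y)).
Proof. by apply: (@heq_smap_iso R Y Y _ (smap_id Y)). Qed.

Lemma smash_map_comp Y Z V W (g : rhom Z V) (f : rhom Y Z) :
  rhom_comp (smash_map T g (rhom_id W)) (smash_map T f (rhom_id W)) =
  smash_map T (rhom_comp g f) (rhom_id W).
Proof.
apply: rhom_ext => n p; elim/(spair_ind sm): p => y w.
by rewrite rhom_compE !(smash_mapE sm).
Qed.

Lemma smash_map_id Y W : smash_map T (rhom_id Y) (rhom_id W) = rhom_id (T (Y,
  W)).
Proof.
by apply: rhom_ext => n p; elim/(spair_ind sm): p => y w;
  rewrite (smash_mapE sm).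
Qed.

(** Both ends of the cylinder are injective equivalences. The smashed top end is an equivalence and
    a section of the smashed projection, which is thus an equivalence by two-out-of-three; its
    composite with the smashed bottom end is the smash product with [f]. *)
Lemma heq_smash_l Y Z W (f : rhom Y Z) :
  heq R (rmapR f) -> heq R (rmapR (smash_map T f (rhom_id W))).
Proof.
move=> hf.
have cR V V' (h : rhom V V') : continuous (rmapR h)
  by exact: realization_map_continuous.
have hpr : heq R (rmapR (cyl_pr f)).
  apply: (@heq_cancelr R _ _ _ (rmapR (cyl_top f))) => //;
    first exact: cyl_top_heq.
  by rewrite realization_rhom_comp cyl_pr_top; exact: heq_rhom_id.
have hbot : heq R (rmapR (cyl_bot f)).
  apply: (@heq_cancell R _ _ _ _ (rmapR (cyl_pr f))) => //.
  by rewrite realization_rhom_comp cyl_pr_bot.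
rewrite -(cyl_pr_bot f) -smash_map_comp -realization_rhom_comp.
apply: heq_comp; first by apply: heq_smash_inj => //; exact: cyl_bot_inj.
apply: (@heq_cancelr R _ _ _ (rmapR (smash_map T (cyl_top f) (rhom_id W)))) =>
  //.
  by apply: heq_smash_inj; [exact: cyl_top_inj|exact: cyl_top_heq].
rewrite realization_rhom_comp smash_map_comp cyl_pr_top smash_map_id;
  exact: heq_rhom_id.
Qed.

Lemma heq_smash_r Y Z W (f : rhom Y Z) :
  heq R (rmapR f) -> heq R (rmapR (smash_map T (rhom_id W) f)).
Proof.
move=> hf.
have symK V V' n p : smash_symm_hom sm V V' n (smash_symm_hom sm V' V n p) = p.
  by elim/(spair_ind sm): p => y z; rewrite !smash_symm_homE.
have hsym V V' : heq R (rmapR (smash_symm_hom sm V V')).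
  by apply: (@heq_smap_iso R _ _ _ (smash_symm_hom sm V' V)) => n p;
    exact: symK.
have -> : smash_map T (rhom_id W) f = rhom_comp (smash_symm_hom sm Z W)
    (rhom_comp (smash_map T f (rhom_id W)) (smash_symm_hom sm W Y)).
  apply: rhom_ext => n p; elim/(spair_ind sm): p => w y.
  by rewrite !rhom_compE smash_symm_homE !(smash_mapE sm) smash_symm_homE.
rewrite -!realization_rhom_comp; apply: heq_comp => //; apply: heq_comp => //.
exact: heq_smash_l.
Qed.

End SmashEquivalences.

Theorem theorem2p1 (R : realType) (X : sabgroup) (Xconn : connected_sset X) :
  inhabited (symmetric_bimonoidal (vee X) (zero_retr X)
               (smash X) (unit_retr X)) /\
  exists closed : forall Y Z : R_ X,
      finite_retr Y -> finite_retr Z -> finite_retr (smash X (Y, Z)),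
    biexact (@cof_f X) (@we_f R X) (restrict_functor closed).
Proof.
pose sm := smash_smash_spec X.
split.
  exact: (inhabits (smash_bimonoidal (vee_vee_spec X) sm (unit_unit_spec X))).
exists (finite_smash sm) => W.
have idinj : injective_smap (rhom_id (sval W)) by move=> n x y.
split; split.
- move=> Y Z f finj; exact: (smash_map_inj sm finj idinj).
- move=> A B C D f g i j _ /is_pushout_level L.
  exact/level_is_pushout/(smash_level_pushout_l sm (sval W) L).
- by move=> Y Z f /heqE hf; apply/heqE; exact: (heq_smash_l sm (sval W) hf).
- move=> Y Z f finj; exact: (smash_map_inj sm idinj finj).
- move=> A B C D f g i j _ /is_pushout_level L.
  exact/level_is_pushout/(smash_level_pushout_r sm (sval W) L).
- by move=> Y Z f /heqE hf; apply/heqE; exact: (heq_smash_r sm (sval W) hf).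
Qed.
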